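(* Let $m_1,n\ge1$ and let $k\ge0$ be an integer. Take $r=0$ and consider the $osp(2m_1,2n)$-modules $\mathcal A^0_k$, $\mathcal H^0_k$ and the element $\eta$ defined in the context. If $k>2(n-m_1+1)$ or $k\le n-m_1+1$, then $\mathcal A^0_k=\mathcal H^0_k\oplus\eta\mathcal A^0_{k-2}$ and the subspace $\mathcal H^0_k$ is an irreducible $osp(2m_1,2n)$-submodule with highest weight vector $x_1^k$ and corresponding highest weight $k\lambda_1$. When $n-m_1+1<k\le2(n-m_1+1)$, $$\mathcal H^0_k\supset\eta^{\,k-(n-m_1+1)}\mathcal H^0_{2(n-m_1+1)-k}\supset\{0\}$$ is a composition series. Moreover, writing $N=\sum_{i=1}^{m_1-1}r_i+\sum_{j=1}^nl_j$, the set of all $$\sum_{\substack{r_1,\dots,r_{m_1-1}\in\mathbb N\\ l_1,\dots,l_n\in\{0,1\}}}\frac{(-1)^{N}\,\alpha_{m_1}!\,\alpha_{2m_1}!\prod_{i=1}^{m_1-1}r_i!\binom{\alpha_i}{r_i}\binom{\alpha_{m_1+i}}{r_i}\prod_{j=1}^n\delta_{l_j,1}(-1)^{\beta_j}\beta_j\beta_{n+j}}{(\alpha_{m_1}+N)!\,(\alpha_{2m_1}+N)!}\;x_{m_1}^{\alpha_{m_1}+N}x_{2m_1}^{\alpha_{2m_1}+N}\prod_{i=1}^{m_1-1}x_i^{\alpha_i-r_i}x_{m_1+i}^{\alpha_{m_1+i}-r_i}\prod_{j=1}^n\theta_j^{\beta_j-l_j}\theta_{n+j}^{\beta_{n+j}-l_j}$$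 with $\alpha_1,\dots,\alpha_{2m_1}\in\mathbb N$, $\beta_1,\dots,\beta_{2n}\in\{0,1\}$, $\alpha_{m_1}\alpha_{2m_1}=0$ and $\sum_{i=1}^{2m_1}\alpha_i+\sum_{j=1}^{2n}\beta_j=k$ is a basis of $\mathcal H^0_k$ ($k>0$).
   Context: $\mathbb N$ is the set of nonnegative integers, $\overline{i,j}=\{i,\dots,j\}$, and $\delta_{a,b}$ is the Kronecker delta. $E_{i,j}$ is the square matrix with $(i,j)$-entry $1$ and others zero. With $m=2m_1$, the Lie superalgebra $gl(m,2n)$ of $(m+2n)\times(m+2n)$ complex matrices has even part spanned by $E_{i,j}$ ($i,j\in\overline{1,m}$) and $E_{m+s,m+t}$ ($s,t\in\overline{1,2n}$), odd part spanned by $E_{i,m+s},E_{m+s,i}$ ($i\in\overline{1,m}$, $s\in\overline{1,2n}$), and bracket $[u,v]=uv-(-1)^{\iota_1\iota_2}vu$ for $u,v$ of parities $\iota_1,\iota_2$. $osp(2m_1,2n)$ is the subalgebra of matrices $$\begin{pmatrix}A&B&H&H_1\\ C&-A^T&K&K_1\\ K_1^T&H_1^T&D&E\\ -K^T&-H^T&F&-D^T\end{pmatrix}$$ with $A,B,C$ of size $m_1\times m_1$, $B=-B^T$, $C=-C^T$; $D,E,F$ of size $n\times n$, $E=E^T$, $F=F^T$; $H,H_1,K,K_1$ of size $m_1\times n$. $\mathcal A=\mathbb C[x_1,\dots,x_{2m_1},\theta_1,\dots,\theta_{2n}]$ with commuting $x_i$, anticommuting $\theta_p$, $x_i\theta_p=\theta_px_i$;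 $\partial_{\theta_p}$ is the odd (left) derivation with $\partial_{\theta_p}(\theta_q)=\delta_{p,q}$. For $r=0$ the action of $gl(m,2n)$ (restricted to $osp(2m_1,2n)$) on $\mathcal A$ is $E_{i,j}\mapsto x_i\partial_{x_j}$, $E_{i,m+p}\mapsto x_i\partial_{\theta_p}$, $E_{m+p,j}\mapsto\theta_p\partial_{x_j}$, $E_{m+p,m+q}\mapsto\theta_p\partial_{\theta_q}$ ($i,j\in\overline{1,m}$, $p,q\in\overline{1,2n}$). $\mathcal A^0_k$ is the subspace of polynomials homogeneous of total degree $k$ (with $\mathcal A^0_k=0$ for $k<0$); $$\Delta=\sum_{i=1}^{m_1}\partial_{x_i}\partial_{x_{m_1+i}}+\sum_{j=1}^n\partial_{\theta_j}\partial_{\theta_{n+j}},\qquad\eta=\sum_{i=1}^{m_1}x_ix_{m_1+i}+\sum_{j=1}^n\theta_j\theta_{n+j},$$ and $\mathcal H^0_k=\{f\in\mathcal A^0_k\mid\Delta(f)=0\}$. The Cartan subalgebra is spanned by $E_{i,i}-E_{m_1+i,m_1+i}$ ($1\le i\le m_1$) and $E_{2m_1+j,2m_1+j}-E_{2m_1+n+j,2m_1+n+j}$ ($1\le j\le n$); $\lambda_1,\dots,\lambda_{m_1},\nu_1,\dots,\nu_n$ are the fundamental weights of the even part $o(2m_1,\mathbb C)\oplus sp(2n,\mathbb C)$. $osp(2m_1,2n)^+$ is the span of $E_{i,j}-E_{m_1+j,m_1+i}$ and $E_{i,m_1+j}-E_{j,m_1+i}$ ($1\le i<j\le m_1$), $E_{2m_1+p,2m_1+q}-E_{2m_1+n+q,2m_1+n+p}$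 ($1\le p<q\le n$), $E_{2m_1+p,2m_1+n+q}+E_{2m_1+q,2m_1+n+p}$ ($1\le p\le q\le n$), $E_{i,2m_1+q}-E_{2m_1+n+q,m_1+i}$ and $E_{i,2m_1+n+q}+E_{2m_1+q,m_1+i}$ ($1\le i\le m_1$, $1\le q\le n$). A highest weight vector is a weight vector annihilated by $osp(2m_1,2n)^+$; its weight is the highest weight.
   Formalization: Basis formula corrected: a factor N! is added, and the factor with δ_{l_j,1} applies only when l_j=1 (else 1). For m_1=1 and k>n-m_1+1, irreducibility of H_k and of its quotient by the bottom term is false and not claimed. λ_1 means ε_1, also for m_1≤2. *)

(* Defs.v *)
From HB Require Import structures.
From mathcomp Require Import all_boot all_order all_algebra.
From mathcomp.multinomials Require Import mpoly.
From mathcomp Require Import ring.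

Set Implicit Arguments.
Unset Strict Implicit.
Unset Printing Implicit Defensive.

Import Order.TTheory GRing.Theory Num.Theory.
Local Open Scope ring_scope.

(* A polynomial in m commuting variables x_i and d anticommuting variables    *)
(* theta_p is stored as its family of coefficients f S : {mpoly K[m]} on the  *)
(* products theta_S of the theta_p, p \in S, taken in increasing order.       *)
Definition superpoly (K : comNzRingType) (m d : nat) :=
  {ffun {set 'I_d} -> {mpoly K[m]}}.

HB.instance Definition _ (K : comNzRingType) (m d : nat) :=
  GRing.Lmodule.copy (superpoly K m d) {ffun {set 'I_d} -> {mpoly K[m]}}.

(* For disjoint S and T, theta_S theta_T = (-1)^(ninv S T) theta_(S :|: T).   *)
Definition ninv d (S T : {set 'I_d}) : nat :=
  (\sum_(s in S) \sum_(t in T) (t < s))%N.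

Section SuperPolyRing.
Variables (K : comNzRingType) (m d : nat).
Local Notation A := (superpoly K m d).
Implicit Types (f g h : A) (S T U : {set 'I_d}).

Definition superpoly_one : A := [ffun S => (S == set0)%:R].

Definition superpoly_mul f g : A :=
  [ffun U : {set 'I_d} =>
     \sum_(S : {set 'I_d} | S \subset U)
        (-1) ^+ ninv S (U :\: S) * (f S * g (U :\: S))].

Fact ninv0s T : ninv set0 T = 0%N.
Proof. by rewrite /ninv big_set0. Qed.

Fact ninvs0 S : ninv S set0 = 0%N.
Proof. by rewrite /ninv big1 // => s _; rewrite big_set0. Qed.

Fact ninvDl S1 S2 T :
  [disjoint S1 & S2] -> ninv (S1 :|: S2) T = (ninv S1 T + ninv S2 T)%N.
Proof.
move=> dS; rewrite /ninv -bigU //=; apply: eq_bigl => s.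
by rewrite !inE.
Qed.

Fact ninvDr S T1 T2 :
  [disjoint T1 & T2] -> ninv S (T1 :|: T2) = (ninv S T1 + ninv S T2)%N.
Proof.
move=> dT; rewrite /ninv -big_split /=; apply: eq_bigr => s _.
by rewrite -bigU //=; apply: eq_bigl => t; rewrite !inE.
Qed.

Fact superpoly_mulA : associative superpoly_mul.
Proof.
move=> f g h; apply/ffunP=> U; rewrite !ffunE.
under eq_bigr => S sSU do rewrite ffunE !mulr_sumr.
under [RHS]eq_bigr => V sVU do rewrite ffunE mulr_suml mulr_sumr.
rewrite [RHS](exchange_big_dep (fun S => S \subset U)) /=; last first.
  by move=> V S sVU sSV; apply: subset_trans sSV sVU.
apply: eq_bigr => S sSU.
rewrite [RHS](reindex_onto (fun T => S :|: T) (fun V => V :\: S)) /=; last first.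
  move=> V /andP[_ sSV]; apply/setP=> s; rewrite !inE.
  by case: (boolP (s \in S)) => //= /(subsetP sSV).
apply: eq_big => [T|T].
  rewrite subUset sSU subsetUl andbT /= setDUl setDv set0U subsetD.
  by congr (_ && _); apply/setDidPl/eqP.
rewrite subsetD => /andP[sTU dTS].
have dST : [disjoint S & T] by rewrite disjoint_sym.
have -> : (S :|: T) :\: S = T.
  by rewrite setDUl setDv set0U; apply/setDidPl.
have -> : U :\: (S :|: T) = (U :\: S) :\: T by rewrite setDDl.
set W := U :\: S :\: T.
have dTW : [disjoint T & W] by rewrite disjoints_subset /W setCD subsetUr.
have -> : U :\: S = T :|: W.
  rewrite /W; apply/setP=> s; rewrite !inE.
  case: (boolP (s \in T)) => //= sT.
  by rewrite (subsetP sTU) // (disjointFr dTS sT).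
rewrite ninvDr // ninvDl // !exprD; ring.
Qed.

Fact superpoly_mul1 : left_id superpoly_one superpoly_mul.
Proof.
move=> f; apply/ffunP=> U; rewrite ffunE (bigD1 set0) ?sub0set //=.
rewrite big1 => [|S /andP[_ /negPf nS]]; last by rewrite ffunE nS mul0r mulr0.
by rewrite ffunE eqxx setD0 ninv0s addr0 !mul1r.
Qed.

Fact superpoly_mulr1 : right_id superpoly_one superpoly_mul.
Proof.
move=> f; apply/ffunP=> U; rewrite ffunE (bigD1 U) //=.
rewrite big1 => [|S /andP[sSU nS]]; last first.
  rewrite ffunE setD_eq0; case: (boolP (U \subset S)) => [sUS|_]; last by rewrite !mulr0.
  by rewrite eqEsubset sSU sUS in nS.
by rewrite ffunE setDv eqxx ninvs0 addr0 mul1r mulr1.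
Qed.

Fact superpoly_mulDl : left_distributive superpoly_mul +%R.
Proof.
move=> f g h; apply/ffunP=> U; rewrite !ffunE -big_split /=.
by apply: eq_bigr => S _; rewrite ffunE mulrDl mulrDr.
Qed.

Fact superpoly_mulDr : right_distributive superpoly_mul +%R.
Proof.
move=> f g h; apply/ffunP=> U; rewrite !ffunE -big_split /=.
by apply: eq_bigr => S _; rewrite ffunE mulrDr mulrDr.
Qed.

Fact superpoly_oner_neq0 : superpoly_one != 0.
Proof.
by apply/eqP=> /ffunP/(_ set0)/eqP; rewrite !ffunE eqxx oner_eq0.
Qed.

End SuperPolyRing.

HB.instance Definition _ (K : comNzRingType) (m d : nat) :=
  GRing.Zmodule_isNzRing.Build (superpoly K m d)
    (@superpoly_mulA K m d) (@superpoly_mul1 K m d) (@superpoly_mulr1 K m d)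
    (@superpoly_mulDl K m d) (@superpoly_mulDr K m d)
    (@superpoly_oner_neq0 K m d).

Section SuperPolyAlg.
Variables (K : comNzRingType) (m d : nat).
Local Notation A := (superpoly K m d).

Fact superpoly_scaleAl (a : K) (f g : A) : a *: (f * g) = (a *: f) * g.
Proof.
apply/ffunP=> U; rewrite !ffunE scaler_sumr; apply: eq_bigr => S _.
by rewrite ffunE -scalerAl -scalerAr.
Qed.

Fact superpoly_scaleAr (a : K) (f g : A) : a *: (f * g) = f * (a *: g).
Proof.
apply/ffunP=> U; rewrite !ffunE scaler_sumr; apply: eq_bigr => S _.
by rewrite ffunE -!scalerAr.
Qed.

End SuperPolyAlg.

HB.instance Definition _ (K : comNzRingType) (m d : nat) :=
  GRing.Lmodule_isLalgebra.Build K (superpoly K m d)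
    (@superpoly_scaleAl K m d).
HB.instance Definition _ (K : comNzRingType) (m d : nat) :=
  GRing.Lalgebra_isAlgebra.Build K (superpoly K m d)
    (@superpoly_scaleAr K m d).

Section Generators.
Variables (K : comNzRingType) (m d : nat).
Local Notation A := (superpoly K m d).
Implicit Types (i : 'I_m) (p q : 'I_d) (f g : A).

Definition xvar i : A := [ffun S => if S == set0 then 'X_i else 0].
Definition theta p : A := [ffun S => (S == [set p])%:R].

Definition dx i f : A := [ffun S => mderiv i (f S)].

(* Since theta_(p |: S) = (-1)^(ninv [set p] S) theta_p theta_S for p \notin  *)
(* S, this is the left derivation (see dtheta1, dtheta_xvarM, dtheta_thetaM). *)
Definition dtheta p f : A :=
  [ffun S : {set 'I_d} =>
     if p \in S then 0 else (-1) ^+ ninv [set p] S * f (p |: S)].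

Fact xvarME i f (S : {set 'I_d}) : (xvar i * f) S = 'X_i * f S.
Proof.
rewrite ffunE (bigD1 set0) ?sub0set //= big1 => [|T /andP[_ /negPf nT]].
  by rewrite ffunE eqxx setD0 ninv0s addr0 mul1r.
by rewrite ffunE nT mul0r mulr0.
Qed.

Fact thetaME p f (S : {set 'I_d}) :
  (theta p * f) S =
    if p \in S then (-1) ^+ ninv [set p] (S :\ p) * f (S :\ p) else 0.
Proof.
rewrite ffunE; case: ifP => pS.
  rewrite (bigD1 [set p]) ?sub1set //= big1 => [|T /andP[_ /negPf nT]].
    by rewrite ffunE eqxx addr0 mul1r.
  by rewrite ffunE nT mul0r mulr0.
apply: big1 => T sTS; rewrite ffunE; case: eqP => [eT|]; last first.
  by rewrite mul0r mulr0.
by rewrite eT sub1set pS in sTS.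
Qed.

Fact ninv1l p (S : {set 'I_d}) : ninv [set p] S = (\sum_(t in S) (t < p))%N.
Proof. by rewrite /ninv big_set1. Qed.

Fact ninv1U p q (S : {set 'I_d}) :
  q \notin S -> ninv [set p] (q |: S) = ((q < p) + ninv [set p] S)%N.
Proof. by move=> qS; rewrite !ninv1l big_setU1. Qed.

Fact ninv1D p q (S : {set 'I_d}) :
  q \in S -> ninv [set p] S = ((q < p) + ninv [set p] (S :\ q))%N.
Proof. by move=> qS; rewrite !ninv1l (big_setD1 q). Qed.

Fact xvarC i f : xvar i * f = f * xvar i.
Proof.
apply/ffunP=> S; rewrite xvarME ffunE (bigD1 S) //= big1.
  by rewrite ffunE setDv eqxx ninvs0 addr0 mul1r mulrC.
move=> T /andP[sTS nT]; rewrite ffunE setD_eq0; case: ifP => [sST|].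
  by rewrite eqEsubset sTS sST in nT.
by rewrite !mulr0.
Qed.

Fact theta_thetaM p q f : theta p * (theta q * f) = - (theta q * (theta p * f)).
Proof.
apply/ffunP=> S; rewrite [RHS]ffunE !thetaME !inE [q == p]eq_sym.
have [->|npq] /= := eqVneq p q; first by rewrite mulr0 if_same oppr0.
case: ifP => pS; case: ifP => qS; rewrite ?mulr0 ?oppr0 //.
rewrite (@ninv1D p q) ?inE ?qS 1?eq_sym ?npq //.
rewrite (@ninv1D q p (S :\ q)) ?inE ?pS ?npq //.
rewrite !setDDl setUC !mulrA -mulNr; congr (_ * _).
have -> : (q < p)%N = ~~ (p < q)%N by rewrite -leqNgt ltn_neqAle eq_sym npq.
by case: (p < q)%N => /=; rewrite !exprD !expr1 expr0; ring.
Qed.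

Fact thetaC p q : theta p * theta q = - (theta q * theta p).
Proof. by have := theta_thetaM p q 1; rewrite !mulr1. Qed.

Fact dtheta1 p : dtheta p 1 = 0.
Proof.
apply/ffunP=> S; rewrite !ffunE; case: ifP => // _.
by rewrite setU_eq0 -cards_eq0 cards1 /= mulr0.
Qed.

Fact dtheta_xvarM p i f : dtheta p (xvar i * f) = xvar i * dtheta p f.
Proof.
apply/ffunP=> S; rewrite xvarME ffunE [in RHS]ffunE xvarME.
by case: ifP => _; rewrite ?mulr0 // mulrCA.
Qed.

Fact dtheta_thetaM p q f :
  dtheta p (theta q * f) = (p == q)%:R *: f - theta q * dtheta p f.
Proof.
apply/ffunP=> S; rewrite ffunE thetaME [RHS]ffunE [X in _ = _ + X]ffunE thetaME.
rewrite [X in _ = X + _]ffunE [dtheta p f _]ffunE !inE.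
have sgn k (g : {mpoly K[m]}) : (-1) ^+ k * ((-1) ^+ k * g) = g.
  by rewrite mulrA -exprD addnn -mul2n exprM sqrrN expr1n expr1n mul1r.
have [<-|npq] /= := eqVneq p q; rewrite ?eqxx ?scale1r ?scale0r /=.
  case: (boolP (p \in S)) => pS; last by rewrite setU1K // sgn oppr0 addr0.
  by rewrite setD1K // sgn subrr.
rewrite add0r.
case: (boolP (p \in S)) => pS; case: (boolP (q \in S)) => qS;
  rewrite ?mulr0 ?oppr0 //=.
have -> : (p |: S) :\ q = p |: S :\ q.
  by rewrite setDUl (_ : [set p] :\ q = [set p]) //; apply/setDidPl; rewrite disjoints1 inE.
rewrite (@ninv1D p q S) // ninv1U ?inE ?(negPf pS) ?andbF // !mulrA -mulNr.
congr (_ * _).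
have -> : (q < p)%N = ~~ (p < q)%N by rewrite -leqNgt ltn_neqAle eq_sym npq.
by case: (p < q)%N => /=; rewrite !exprD !expr1 expr0; ring.
Qed.


End Generators.

Definition is_basis (K : fieldType) (V : lmodType K) (I : eqType)
    (P : pred I) (b : I -> V) (U : V -> Prop) : Prop :=
  [/\ forall i, P i -> U (b i),
      forall (s : seq I) (a : I -> K), uniq s -> all P s ->
        \sum_(i <- s) a i *: b i = 0 -> forall i, i \in s -> a i = 0
    & forall v, U v -> exists (s : seq I) (a : I -> K),
        all P s /\ v = \sum_(i <- s) a i *: b i].

Definition is_direct_sum (V : zmodType) (W U1 U2 : V -> Prop) : Prop :=
  (forall w, W w <-> exists u1 u2, [/\ U1 u1, U2 u2 & w = u1 + u2]) /\
  (forall v, U1 v -> U2 v -> v = 0).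

Section Osp.
Variables (K : fieldType) (m1 n : nat).

Local Notation dim := ((m1 + m1) + (n + n))%N.
Local Notation Mat := 'M[K]_dim.

Definition oscA := superpoly K (m1 + m1) (n + n).

HB.instance Definition _ := GRing.Algebra.on oscA.

Implicit Types (f g : oscA) (X : Mat) (U W : oscA -> Prop).

Definition osp X : Prop :=
  exists (A B C : 'M[K]_m1) (D E F : 'M[K]_n) (H H1 L L1 : 'M[K]_(m1, n)),
    [/\ B = - B^T, C = - C^T, E = E^T, F = F^T
      & X = block_mx
              (block_mx A B
                        C (- A^T))
              (block_mx H H1
                        L L1)
              (block_mx L1^T H1^T
                        (- L^T) (- H^T))
              (block_mx D E
                        F (- D^T))].

(* Rows and columns: xl i, xr i, tl p, tr p are the matrix indices i, m1 + i, *)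
(* 2 m1 + p and 2 m1 + n + p.                                                 *)
Definition xl (i : 'I_m1) : 'I_dim := lshift (n + n) (lshift m1 i).
Definition xr (i : 'I_m1) : 'I_dim := lshift (n + n) (rshift m1 i).
Definition tl (p : 'I_n) : 'I_dim := rshift (m1 + m1) (lshift n p).
Definition tr (p : 'I_n) : 'I_dim := rshift (m1 + m1) (rshift n p).

Local Notation "''E_' ( i , j )" := (delta_mx i j : Mat)
  (at level 8, format "''E_' ( i ,  j )").

Definition cartan : {vspace Mat} :=
  (\sum_(i < m1) <['E_(xl i, xl i) - 'E_(xr i, xr i)]>
   + \sum_(p < n) <['E_(tl p, tl p) - 'E_(tr p, tr p)]>)%VS.

Definition osp_pos : {vspace Mat} :=
  (\sum_(i < m1) \sum_(j < m1 | (i < j)%N)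
      (<['E_(xl i, xl j) - 'E_(xr j, xr i)]>
       + <['E_(xl i, xr j) - 'E_(xl j, xr i)]>)
   + \sum_(p < n) \sum_(q < n | (p < q)%N)
      <['E_(tl p, tl q) - 'E_(tr q, tr p)]>
   + \sum_(p < n) \sum_(q < n | (p <= q)%N)
      <['E_(tl p, tr q) + 'E_(tl q, tr p)]>
   + \sum_(i < m1) \sum_(q < n)
      (<['E_(xl i, tl q) - 'E_(tr q, xr i)]>
       + <['E_(xl i, tr q) + 'E_(tl q, xr i)]>))%VS.

Definition gen (i : 'I_dim) : oscA :=
  match split i with inl j => xvar K (n + n) j | inr p => theta K (m1 + m1) p end.

Definition dgen (i : 'I_dim) f : oscA :=
  match split i with inl j => dx j f | inr p => dtheta p f end.

Definition act X f : oscA :=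
  \sum_(i < dim) \sum_(j < dim) X i j *: (gen i * dgen j f).

Definition superDelta f : oscA :=
  \sum_(i < m1) dgen (xl i) (dgen (xr i) f)
  + \sum_(p < n) dgen (tl p) (dgen (tr p) f).

Definition eta : oscA :=
  \sum_(i < m1) gen (xl i) * gen (xr i) + \sum_(p < n) gen (tl p) * gen (tr p).

(* The degree is an integer, so that the space is zero in negative degrees.   *)
Definition homogeneous (k : int) f : Prop :=
  forall (S : {set 'I_(n + n)}) (mu : 'X_{1..m1 + m1}),
    mu \in msupp (f S) -> (mdeg mu + #|S|)%N%:Z = k.

Definition harmonic (k : int) f : Prop := homogeneous k f /\ superDelta f = 0.

Definition mulspace (g : oscA) U : oscA -> Prop :=
  fun f => exists2 h, U h & f = g * h.

Definition zerospace : oscA -> Prop := fun f => f = 0.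

Definition submodule U : Prop :=
  [/\ U 0,
      forall (a : K) f g, U f -> U g -> U (a *: f + g)
    & forall X f, osp X -> U f -> U (act X f)].

Definition strict_subspace W U : Prop :=
  (forall f, W f -> U f) /\ (exists2 f, U f & ~ W f).

Definition irreducible_module U : Prop :=
  [/\ submodule U,
      exists2 f, U f & f != 0
    & forall W, submodule W -> (forall f, W f -> U f) ->
        (forall f, W f -> f = 0) \/ (forall f, U f -> W f)].

(* W is a submodule of U and the module U / W is irreducible. *)
Definition irreducible_factor U W : Prop :=
  [/\ submodule U, submodule W, strict_subspace W U
    & forall V, submodule V -> (forall f, W f -> V f) ->
        (forall f, V f -> U f) ->
        (forall f, V f -> W f) \/ (forall f, U f -> V f)].

(* U and the members of s, in decreasing order, form a composition series. *)
Fixpoint composition_series U (s : seq (oscA -> Prop)) : Prop :=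
  if s is W :: s' then irreducible_factor U W /\ composition_series W s'
  else forall f, U f <-> f = 0.

Definition highest_weight_vector (wt : Mat -> K) f : Prop :=
  [/\ f != 0,
      forall H, H \in cartan -> act H f = wt H *: f
    & forall X, X \in osp_pos -> act X f = 0].

Section FirstLast.
Hypothesis m1_gt0 : (0 < m1)%N.

Definition ifirst : 'I_m1 := Ordinal m1_gt0.
Definition ilast : 'I_m1 := rev_ord ifirst.

Definition x1 : oscA := gen (xl ifirst).

(* On the Cartan subalgebra: 1 at E_{1,1} - E_{m1+1,m1+1}, and 0 at the other *)
(* basis elements. For m1 >= 3 this is the first fundamental weight; for      *)
(* m1 = 1, 2 the notation lambda_1 is understood to denote the same weight.   *)
Definition lambda1 (H : Mat) : K := H (xl ifirst) (xl ifirst).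

Local Notation xlexp := ({ffun 'I_(m1 + m1) -> nat}) (only parsing).
Local Notation thexp := ({ffun 'I_(n + n) -> bool}) (only parsing).

Definition basis_index (k : nat) (ab : xlexp * thexp) : bool :=
  (ab.1 (lshift m1 ilast) * ab.1 (rshift m1 ilast) == 0)%N &&
  (\sum_i ab.1 i + \sum_p ab.2 p == k)%N.

(* The sum ranges over r_1, ..., r_{m1-1} : one sets r_{m1} = 0. Terms with   *)
(* r_i > alpha_i vanish, so the r_i may be bounded by the sum of the alpha_i. *)
(* With g the monomial of exponents (alpha, beta), T = d_{x_{m1}} d_{x_{2m1}} *)
(* and T' = superDelta - T, this is \sum_N (- \int\int T')^N g, where         *)
(* \int\int inverts T on monomials; this is where N! comes from. The factor   *)
(* of index j comes from the operator d_{theta_j} d_{theta_{n+j}}, which is   *)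
(* applied only when l_j = 1.                                                 *)
Definition harmonic_elt (ab : xlexp * thexp) : oscA :=
  let alpha := ab.1 in let beta := ab.2 in
  let al i := alpha (lshift m1 i) in let ar i := alpha (rshift m1 i) in
  let bl p := beta (lshift n p) in let br p := beta (rshift n p) in
  \sum_(r : {ffun 'I_m1 -> 'I_(\sum_i alpha i).+1} | r ilast == ord0)
  \sum_(l : {ffun 'I_n -> bool})
    let N := (\sum_(i < m1 | i != ilast) r i + \sum_(j < n) l j)%N in
    ((-1) ^+ N * N`!%:R * (al ilast)`!%:R * (ar ilast)`!%:R
     * (\prod_(i < m1 | i != ilast)
          ((r i)`! * 'C(al i, r i) * 'C(ar i, r i))%N%:R)
     * (\prod_(j < n)
          if l j then (-1) ^+ bl j * (bl j)%:R * (br j)%:R else 1)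
     / ((al ilast + N)`! * (ar ilast + N)`!)%N%:R)
    *: (gen (xl ilast) ^+ (al ilast + N) * gen (xr ilast) ^+ (ar ilast + N)
        * (\prod_(i < m1 | i != ilast)
             (gen (xl i) ^+ (al i - r i) * gen (xr i) ^+ (ar i - r i)))
        * (\prod_(j < n)
             (gen (tl j) ^+ (bl j - l j) * gen (tr j) ^+ (br j - l j)))).

End FirstLast.
End Osp.

(* Main.v *)
(* With c = n - m1 + 1, the operators Delta and eta span together with the    *)
(* Euler operator a copy of sl2 commuting with osp, and for g of degree d     *)
(*   Delta (eta^s g) = eta^s Delta g + s (d + s - c) eta^(s-1) g.             *)
(* As eta is not a zero divisor, H_k meets eta A_(k-2) only when the scalar   *)
(* vanishes for d = k - 2s, that is for s = k - c with c < k <= 2c, and then  *)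
(* in eta^(k-c) H_(2c-k); otherwise eta A_(k-2) is a complement of H_k.       *)
(*                                                                            *)
(* Let l(f) be the coefficient of x_1^k. A submodule on which l is not zero   *)
(* contains x_1^k, the only monomial of its weight. A submodule V on which l  *)
(* vanishes lies in eta A_(k-2). For m1 > 1, this is because an element of V  *)
(* vanishes with all its derivatives along osp at the point e_1 of the        *)
(* irreducible cone eta = 0. For k <= c, the derivatives of the elements of V *)
(* span a submodule of H_(k-1) on which l vanishes as well, and V = 0 by      *)
(* induction on k. Finally x_1^k generates H_k: the orthogonal of the         *)
(* submodule it generates, for a contravariant form under which Delta is the  *)
(* adjoint of eta, is a submodule on which l vanishes, so it is contained in  *)
(* eta A_(k-2), which is orthogonal to H_k.                                   *)
(*                                                                            *)
(* A harmonic element is determined by its monomials in which x_(m1) or       *)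
(* x_(2 m1) is missing, and the stated element has only one of these.         *)

From HB Require Import structures.
From mathcomp Require Import all_boot all_order all_algebra.
From mathcomp.multinomials Require Import mpoly.
From mathcomp Require Import reals boolp.
From mathcomp.real_closed Require Import complex.
From mathcomp Require Import ring zify.
Require Import Defs.

Set Implicit Arguments.
Unset Strict Implicit.
Unset Printing Implicit Defensive.

Import Order.TTheory GRing.Theory Num.Theory.
Local Open Scope ring_scope.

(** * Commutation rules *)

(** Put c = n - m1 + 1. The operators eta, Delta and [euler] satisfy sl2 relations ([Delta_eta],
    [Delta_etaX]), in which c enters through the superdimension. The matrices of osp are exactly the
    superskew ones, so they commute with eta ([act_eta]) and, by adjunction, with Delta
    ([act_Delta]). As eta is not a zero divisor ([eta_inj]), a harmonic multiple of eta can be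
    divided by eta again and again while the sl2 scalar is nonzero. Outside the critical range this
    descent runs into negative degree; the same scalars make Delta eta surjective, and the direct
    sum follows ([harmonic_direct_sum]). For c < k <= 2c the descent stops at eta^(k-c) times a
    harmonic element ([harmonic_eta_crit]).

    Irreducibility rests on [submodule_dichotomy], for m1 > 1 or k <= c: a submodule V of H_k
    consists of multiples of eta or is all of H_k. The functional [ell], the coefficient of x_1^k,
    decides. If it is nonzero somewhere on V, a weight projection puts x_1^k in V ([submodule_x1]).
    If it vanishes on V, then V lies in eta A: for m1 > 1 by differentiating along the cone eta = 0
    at its point e_1 ([submodule_eta]), for k <= c by induction through first derivatives
    ([submodule_harmonic_eq0]). The same vanishing argument, applied to the orthogonal of a
    submodule containing x_1^k, shows that x_1^k generates H_k ([perp_eta], [double_perp],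
    [x1_generates]). Together with the descent this gives the irreducible H_k outside the critical
    range and, for m1 > 1, the irreducible quotient H_k / W inside it. W itself is a copy of
    H_(2c-k) under multiplication by eta^(k-c), and 2c - k < c ([irreducible_critical]).

    For the basis, solving Delta f = 0 for the monomials divisible by x_(m1) x_(2 m1) shows that the
    other monomials determine f ([harmonic_uniq]). The explicit sums are harmonic by telescoping
    ([Delta_harmonic_sum]), and each has a single monomial of the determining kind
    ([coef_harmonic_elt]). *)

Section Rules.
Variables (K : fieldType) (m1 n : nat).
Local Notation dim := ((m1 + m1) + (n + n))%N.
Local Notation A := (oscA K m1 n).
Local Notation gen := (@gen K m1 n).
Local Notation dgen := (@dgen K m1 n).
Implicit Types (f g h : A) (y z w : 'I_dim).

Definition odd_index y := (m1 + m1 <= y)%N.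
(** The Koszul sign of exchanging the variables, or the derivations, of indices y and z. *)
Definition ssign y z : K := (-1) ^+ (odd_index y && odd_index z).

Lemma ssignC y z : ssign y z = ssign z y.
Proof. by rewrite /ssign andbC. Qed.

Lemma ssign_even y z : ~~ odd_index y -> ssign y z = 1.
Proof. by rewrite /ssign => /negPf ->. Qed.

Lemma ssign_odd y z w : odd_index z = odd_index w -> ssign y z = ssign y w.
Proof. by rewrite /ssign => ->. Qed.

Lemma ssignMM y z : ssign y z * ssign y z = 1.
Proof. by rewrite /ssign -expr2 sqrr_sign. Qed.

Lemma index_case (P : 'I_dim -> Prop) :
  (forall i, P (lshift (n + n) i)) -> (forall p, P (rshift (m1 + m1) p)) ->
  forall y, P y.
Proof. by move=> Pl Pr y; case: (split_ordP y) => z ->. Qed.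

Lemma gen_lshift i : gen (lshift (n + n) i) = xvar K (n + n) i.
Proof.
by rewrite /Defs.gen; case: split_ordP => j /eqP; rewrite ?eq_lshift ?eq_lrshift // => /eqP ->.
Qed.

Lemma gen_rshift p : gen (rshift (m1 + m1) p) = theta K (m1 + m1) p.
Proof.
by rewrite /Defs.gen; case: split_ordP => j /eqP; rewrite ?eq_rshift ?eq_rlshift // => /eqP ->.
Qed.

Lemma dgen_lshift i f : dgen (lshift (n + n) i) f = dx i f.
Proof.
by rewrite /Defs.dgen; case: split_ordP => j /eqP; rewrite ?eq_lshift ?eq_lrshift // => /eqP ->.
Qed.

Lemma dgen_rshift p f : dgen (rshift (m1 + m1) p) f = dtheta p f.
Proof.
by rewrite /Defs.dgen; case: split_ordP => j /eqP; rewrite ?eq_rshift ?eq_rlshift // => /eqP ->.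
Qed.

Lemma odd_lshift i : odd_index (lshift (n + n) i) = false.
Proof. by rewrite /odd_index /= leqNgt ltn_ord. Qed.

Lemma odd_rshift p : odd_index (rshift (m1 + m1) p) = true.
Proof. by rewrite /odd_index /= leq_addr. Qed.

Lemma oscDE f g S : (f + g : A) S = f S + g S.
Proof. exact: ffunE. Qed.

Lemma oscNE f S : (- f : A) S = - f S.
Proof. exact: ffunE. Qed.

Lemma oscZE (a : K) f S : (a *: f : A) S = a *: f S.
Proof. exact: ffunE. Qed.

Lemma dx_linear i : linear (@dx K (m1 + m1) (n + n) i).
Proof. by move=> a f g; apply/ffunP => S; rewrite !ffunE linearP. Qed.

Lemma dtheta_linear p : linear (@dtheta K (m1 + m1) (n + n) p).
Proof.
move=> a f g; apply/ffunP => S; rewrite !ffunE; case: ifP => _.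
  by rewrite scaler0 addr0.
by rewrite mulrDr scalerAr.
Qed.

Lemma dgen_linear y : linear (dgen y).
Proof.
move=> a f g; elim/index_case: y => j; rewrite ?dgen_lshift ?dgen_rshift.
  exact: dx_linear.
exact: dtheta_linear.
Qed.

HB.instance Definition _ y := GRing.isLinear.Build K A A *:%R (dgen y) (dgen_linear y).

Lemma mderiv_sign i k (p : {mpoly K[m1 + m1]}) :
  mderiv i ((-1) ^+ k * p) = (-1) ^+ k * mderiv i p.
Proof. by rewrite -signr_odd; case: (odd k); rewrite ?mulN1r ?mul1r ?raddfN. Qed.

Lemma gen_gen y z f : gen y * (gen z * f) = ssign y z *: (gen z * (gen y * f)).
Proof.
rewrite /ssign; elim/index_case: y => i; elim/index_case: z => j;
  rewrite ?gen_lshift ?gen_rshift ?odd_lshift ?odd_rshift /= ?scale1r ?scaleN1r;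
  last (exact: theta_thetaM); by rewrite !mulrA xvarC.
Qed.

(** The canonical relations of the Weyl-Clifford algebra. Together with [gen_gen] and [dgen_dgen]
    they let the operator identities below be derived formally, without coefficients. *)
Lemma dgen_gen y z f :
  dgen y (gen z * f) = (y == z)%:R *: f + ssign y z *: (gen z * dgen y f).
Proof.
rewrite /ssign; elim/index_case: y => i; elim/index_case: z => j;
  rewrite ?gen_lshift ?gen_rshift ?odd_lshift ?odd_rshift
     ?dgen_lshift ?dgen_rshift /= ?scale1r ?scaleN1r.
- rewrite eq_lshift; apply/ffunP => S; rewrite ffunE oscDE oscZE !xvarME ffunE mderivM mderivX.
  rewrite mnm1E eq_sym; case: eqP => [->|_]; last by rewrite !scale0r mul0r.
  by rewrite -{1}[U_(j)%MM]add0m addmK mpolyX0 !scale1r mul1r.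
- rewrite eq_lrshift scale0r add0r; apply/ffunP => S.
  rewrite ffunE !thetaME.
  case: ifP => _; last by rewrite raddf0.
  by rewrite ffunE mderiv_sign.
- by rewrite eq_rlshift scale0r add0r dtheta_xvarM.
- by rewrite eq_rshift dtheta_thetaM.
Qed.

Lemma dgen_dgen y z f : dgen y (dgen z f) = ssign y z *: dgen z (dgen y f).
Proof.
rewrite /ssign; elim/index_case: y => i; elim/index_case: z => j;
  rewrite ?odd_lshift ?odd_rshift
     ?dgen_lshift ?dgen_rshift /= ?scale1r ?scaleN1r; apply/ffunP => S; rewrite !ffunE.
- by rewrite mderiv_comm.
- case: ifP => _; first by rewrite raddf0.
  by rewrite mderiv_sign.
- case: ifP => _; first by rewrite raddf0.
  by rewrite mderiv_sign.
- have [->|nij] := eqVneq i j.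
    by case: ifP => jS; rewrite ?oppr0 // !inE eqxx /= mulr0 oppr0.
  rewrite !inE (negPf nij) eq_sym (negPf nij) /=.
  case: (boolP (i \in S)) => iS; case: (boolP (j \in S)) => jS; rewrite ?mulr0 ?oppr0 //.
  rewrite !ninv1U // !(setUCA [set i]) !mulrA -mulNr; congr (_ * _).
  have -> : (i < j)%N = ~~ (j < i)%N by rewrite -leqNgt ltn_neqAle nij.
  by case: (j < i)%N => /=; rewrite !exprD !expr1 expr0; ring.
Qed.

End Rules.

(* [congr] would first try to unify the summands up to conversion. *)
Lemma congrD (V : nmodType) (a b c d : V) : a = c -> b = d -> a + b = c + d.
Proof. by move=> -> ->. Qed.

(** * The pairing of the variables by eta, and the commutator of Delta and eta *)

Section Form.
Variables (K : fieldType) (m1 n : nat).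
Local Notation dim := ((m1 + m1) + (n + n))%N.
Local Notation A := (oscA K m1 n).
Local Notation gen := (@gen K m1 n).
Local Notation dgen := (@dgen K m1 n).
Local Notation eta := (@Defs.eta K m1 n).
Local Notation Delta := (@Defs.superDelta K m1 n).
Local Notation xl := (@Defs.xl m1 n).
Local Notation xr := (@Defs.xr m1 n).
Local Notation tl := (@Defs.tl m1 n).
Local Notation tr := (@Defs.tr m1 n).
Implicit Types (f g h : A) (y z : 'I_dim) (i j : 'I_m1) (p q : 'I_n).

Lemma index_case4 (P : 'I_dim -> Prop) :
  (forall i, P (xl i)) -> (forall i, P (xr i)) ->
  (forall p, P (tl p)) -> (forall p, P (tr p)) -> forall y, P y.
Proof.
move=> Pxl Pxr Ptl Ptr; elim/index_case => j; case: (split_ordP j) => i ->.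
- exact: Pxl.
- exact: Pxr.
- exact: Ptl.
- exact: Ptr.
Qed.

Lemma sum_index4 (V : nmodType) (F : 'I_dim -> V) :
  \sum_y F y = (\sum_i F (xl i) + \sum_i F (xr i))
               + (\sum_p F (tl p) + \sum_p F (tr p)).
Proof. by rewrite big_split_ord /= !big_split_ord. Qed.

Lemma odd_xl i : odd_index (xl i) = false. Proof. exact: odd_lshift. Qed.
Lemma odd_xr i : odd_index (xr i) = false. Proof. exact: odd_lshift. Qed.
Lemma odd_tl p : odd_index (tl p) = true. Proof. exact: odd_rshift. Qed.
Lemma odd_tr p : odd_index (tr p) = true. Proof. exact: odd_rshift. Qed.
Definition oddE := (odd_xl, odd_xr, odd_tl, odd_tr).

Lemma eq_xlxl i j : (xl i == xl j) = (i == j).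
Proof. by rewrite /Defs.xl !eq_lshift. Qed.
Lemma eq_xrxr i j : (xr i == xr j) = (i == j).
Proof. by rewrite /Defs.xr eq_lshift eq_rshift. Qed.
Lemma eq_xlxr i j : (xl i == xr j) = false.
Proof. by rewrite /Defs.xr eq_lshift eq_lrshift. Qed.
Lemma eq_xrxl i j : (xr i == xl j) = false.
Proof. by rewrite eq_sym eq_xlxr. Qed.
Lemma eq_tltl p q : (tl p == tl q) = (p == q).
Proof. by rewrite /Defs.tl eq_rshift eq_lshift. Qed.
Lemma eq_trtr p q : (tr p == tr q) = (p == q).
Proof. by rewrite /Defs.tr !eq_rshift. Qed.
Lemma eq_tltr p q : (tl p == tr q) = false.
Proof. by rewrite /Defs.tr eq_rshift eq_lrshift. Qed.
Lemma eq_trtl p q : (tr p == tl q) = false.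
Proof. by rewrite eq_sym eq_tltr. Qed.
Lemma eq_xltl i p : (xl i == tl p) = false. Proof. exact: eq_lrshift. Qed.
Lemma eq_xltr i p : (xl i == tr p) = false. Proof. exact: eq_lrshift. Qed.
Lemma eq_xrtl i p : (xr i == tl p) = false. Proof. exact: eq_lrshift. Qed.
Lemma eq_xrtr i p : (xr i == tr p) = false. Proof. exact: eq_lrshift. Qed.
Lemma eq_tlxl p i : (tl p == xl i) = false. Proof. exact: eq_rlshift. Qed.
Lemma eq_trxl p i : (tr p == xl i) = false. Proof. exact: eq_rlshift. Qed.
Lemma eq_tlxr p i : (tl p == xr i) = false. Proof. exact: eq_rlshift. Qed.
Lemma eq_trxr p i : (tr p == xr i) = false. Proof. exact: eq_rlshift. Qed.
Definition indexE := (eq_xlxl, eq_xrxr, eq_xlxr, eq_xrxl, eq_tltl, eq_trtr,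
  eq_tltr, eq_trtl, eq_xltl, eq_xltr, eq_xrtl, eq_xrtr, eq_tlxl, eq_trxl,
  eq_tlxr, eq_trxr).

(** The partner of y in the quadratic element eta. With the sign [dsign], the derivative of eta in
    direction y is [dsign y] times the variable of index [dual y] (see [dgen_eta]). *)
Definition dual y : 'I_dim :=
  match split y with
  | inl z => match split z with inl i => xr i | inr i => xl i end
  | inr z => match split z with inl p => tr p | inr p => tl p end
  end.

Definition dsign y : K :=
  match split y with
  | inl _ => 1
  | inr z => match split z with inl _ => 1 | inr _ => -1 end
  end.

Lemma split_l m m' (i : 'I_m) : split (lshift m' i) = inl i.
Proof. exact: (unsplitK (inl i)). Qed.
Lemma split_r m m' (i : 'I_m') : split (rshift m i) = inr i.
Proof. exact: (unsplitK (inr i)). Qed.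
Definition splitE := (split_l, split_r).

Lemma dual_xl i : dual (xl i) = xr i. Proof. by rewrite /dual !splitE. Qed.
Lemma dual_xr i : dual (xr i) = xl i. Proof. by rewrite /dual !splitE. Qed.
Lemma dual_tl p : dual (tl p) = tr p. Proof. by rewrite /dual !splitE. Qed.
Lemma dual_tr p : dual (tr p) = tl p. Proof. by rewrite /dual !splitE. Qed.
Definition dualE := (dual_xl, dual_xr, dual_tl, dual_tr).

Lemma dsign_xl i : dsign (xl i) = 1.
Proof. by rewrite /dsign !splitE. Qed.
Lemma dsign_xr i : dsign (xr i) = 1.
Proof. by rewrite /dsign !splitE. Qed.
Lemma dsign_tl p : dsign (tl p) = 1.
Proof. by rewrite /dsign !splitE. Qed.
Lemma dsign_tr p : dsign (tr p) = -1.
Proof. by rewrite /dsign !splitE. Qed.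
Definition dsignE := (dsign_xl, dsign_xr, dsign_tl, dsign_tr).

Lemma dualK : involutive dual.
Proof. by elim/index_case4 => ?; rewrite !dualE. Qed.

Lemma odd_dual y : odd_index (dual y) = odd_index y.
Proof. by elim/index_case4: y => ?; rewrite !dualE !oddE. Qed.

Lemma dsign_dual y : dsign (dual y) = dsign y * (-1) ^+ odd_index y.
Proof.
by elim/index_case4: y => ?; rewrite !dualE !dsignE !oddE ?mulr1 ?expr1 ?mulrNN ?mul1r.
Qed.

Lemma etaM f :
  eta * f = \sum_i gen (xl i) * (gen (xr i) * f) + \sum_p gen (tl p) * (gen (tr p) * f).
Proof.
by rewrite /Defs.eta mulrDl !mulr_suml; congr (_ + _); apply: eq_bigr => i _; rewrite mulrA.
Qed.

Lemma gen2_gen y z z' f : odd_index z = odd_index z' ->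
  gen y * (gen z * (gen z' * f)) = gen z * (gen z' * (gen y * f)).
Proof.
move=> e; rewrite gen_gen [gen y * (gen z' * f)]gen_gen -scalerAr scalerA.
by rewrite (_ : ssign K y z = ssign K y z') ?ssignMM ?scale1r // /ssign e.
Qed.

Lemma gen_eta y f : gen y * (eta * f) = eta * (gen y * f).
Proof.
rewrite !etaM mulrDr !mulr_sumr.
by apply: congrD; apply: eq_bigr => i _; apply: gen2_gen; rewrite !oddE.
Qed.


Lemma dgen_gen2 y z z' f : odd_index z = odd_index z' ->
  dgen y (gen z * (gen z' * f)) =
    (y == z)%:R *: (gen z' * f) + (ssign K y z * (y == z')%:R) *: (gen z * f)
    + gen z * (gen z' * dgen y f).
Proof.
move=> e; rewrite dgen_gen [dgen y (gen z' * f)]dgen_gen mulrDr scalerDr.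
rewrite -!scalerAr !scalerA addrA; congr (_ + _).
by rewrite (_ : ssign K y z = ssign K y z') ?ssignMM ?scale1r // /ssign e.
Qed.

Lemma sum_delta (V : lmodType K) N (i : 'I_N) (F : 'I_N -> V) :
  \sum_j (i == j)%:R *: F j = F i.
Proof.
rewrite (bigD1 i) //= eqxx scale1r big1 ?addr0 // => j.
by rewrite eq_sym => /negPf ->; rewrite scale0r.
Qed.

Lemma dgen_eta y f :
  dgen y (eta * f) = eta * dgen y f + dsign y *: (gen (dual y) * f).
Proof.
rewrite !etaM linearD !linear_sum /=.
under eq_bigr => i _ do rewrite dgen_gen2 ?oddE //.
under [X in _ + X = _]eq_bigr => i _ do rewrite dgen_gen2 ?oddE //.
rewrite !big_split /= addrACA [RHS]addrC; congr (_ + _).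
elim/index_case4: y => k; rewrite dualE dsignE.
all: under eq_bigr => i _ do rewrite !indexE ?scale0r.
all: under [X in _ + X + _]eq_bigr => i _ do rewrite !indexE ?mulr0 ?scale0r.
all: under [X in _ + _ + (X + _)]eq_bigr => i _ do rewrite !indexE ?scale0r.
all: under [X in _ + _ + (_ + X)]eq_bigr => i _ do rewrite !indexE ?mulr0 ?scale0r.
all: rewrite ?[\sum_i 0]big1_eq ?add0r ?addr0 ?scale1r.
- exact: sum_delta.
- under eq_bigr => i _ do rewrite /ssign !oddE mul1r.
  exact: sum_delta.
- exact: sum_delta.
- under eq_bigr => i _ do rewrite /ssign !oddE mulN1r scaleNr -scalerN.
  by rewrite sum_delta scaleN1r.
Qed.

Definition euler f := \sum_y gen y * dgen y f.

Lemma Delta_linear : linear Delta.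
Proof.
move=> a f g; rewrite /superDelta scalerDr !scaler_sumr addrACA -!big_split /=.
by congr (_ + _); apply: eq_bigr => i _; rewrite !linearP.
Qed.

HB.instance Definition _ :=
  GRing.isLinear.Build K A A *:%R Delta Delta_linear.

(** Each pair of variables contributes its two terms of the Euler operator and a constant: +1 for a
    commuting pair, -1 for an anticommuting one. Hence the half superdimension m1 - n. *)
Lemma Delta_eta f :
  Delta (eta * f) = eta * Delta f + euler f + (m1%:R - n%:R) *: f.
Proof.
have -> : (m1%:R - n%:R : K) *: f = \sum_(i < m1) f - \sum_(p < n) f.
  by rewrite scalerBl !scaler_nat !sumr_const !card_ord.
rewrite /superDelta.
under eq_bigr => i _ do
  rewrite dgen_eta dualE dsignE scale1r linearD /= dgen_eta dualE dsignE scale1r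
   dgen_gen eqxx scale1r ssign_even ?oddE // scale1r.
under [X in _ + X = _]eq_bigr => i _ do
  rewrite dgen_eta dualE dsignE linearD linearZ /= dgen_eta dualE dsignE scale1r
   dgen_gen eqxx scale1r /ssign ?oddE !scaleN1r opprD opprK.
rewrite mulrDr !mulr_sumr /euler sum_index4 -sumrN !big_split /=.
set a1 := \sum_(i < m1) _; set a2 := \sum_(i < m1) _; set a3 := \sum_(i < m1) _.
set a4 := \sum_(i < m1) _; set b1 := \sum_(i < n) _; set b2 := \sum_(i < n) _.
set b3 := \sum_(i < n) _; set b4 := \sum_(i < n) _.
by rewrite (AC ((2*2)*(2*2)) ((1*5)*((4*2)*(8*6))*(3*7))).
Qed.

End Form.

(** * The action of osp *)

Section Act.
Variables (K : numFieldType) (m1 n : nat).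
Local Notation dim := ((m1 + m1) + (n + n))%N.
Local Notation A := (oscA K m1 n).
Local Notation gen := (@Defs.gen K m1 n).
Local Notation dgen := (@Defs.dgen K m1 n).
Local Notation eta := (@Defs.eta K m1 n).
Local Notation xl := (@Defs.xl m1 n).
Local Notation xr := (@Defs.xr m1 n).
Local Notation tl := (@Defs.tl m1 n).
Local Notation tr := (@Defs.tr m1 n).
Local Notation act := (@Defs.act K m1 n).
Local Notation dsign := (@dsign K m1 n).
Implicit Types (f g h : A) (y z w : 'I_dim) (i j : 'I_m1) (p q : 'I_n).
Implicit Types (X Y : 'M[K]_dim).

(** The coefficients of the commutator of X with eta, written as a quadratic expression in the
    variables. In these terms the block conditions defining osp become the single condition
    [osp_skew]. *)
Definition osp_form X y w : K := X y (dual w) * dsign (dual w).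

Definition osp_skew X :=
  forall y w, osp_form X w y = - (ssign K y w * osp_form X y w).

Lemma osp_skew_osp X : osp X -> osp_skew X.
Proof.
case=> [A0 [B [C [D [E [F [H [H1 [L [L1 [eB eC eE eF ->]]]]]]]]]]] y w.
  have hB i j : B i j = - B j i by rewrite {1}eB !mxE.
  have hC i j : C i j = - C j i by rewrite {1}eC !mxE.
  have hE p q : E p q = E q p by rewrite {1}eE !mxE.
  have hF p q : F p q = F q p by rewrite {1}eF !mxE.
  rewrite /osp_form /ssign.
  elim/index_case4: y => i; elim/index_case4: w => j; rewrite !dualE !dsignE !oddE /=.
  all: rewrite /Defs.xl /Defs.xr /Defs.tl /Defs.tr.
  all: rewrite ?block_mxEul ?block_mxEur ?block_mxEdl ?block_mxEdr.
  all: rewrite ?block_mxEul ?block_mxEur ?block_mxEdl ?block_mxEdr ?mxE.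
  all: try rewrite (hB i j); try rewrite (hC i j); try rewrite (hE i j); try rewrite (hF i j); ring.
Qed.

Lemma osp_of_skew X : osp_skew X -> osp X.
Proof.
move=> sk.
have e y w : X w y * dsign y = - (ssign K (dual y) w * (X (dual y) (dual w) * dsign (dual w))).
  by have := sk (dual y) w; rewrite /osp_form dualK.
have simp := (@dualE m1 n, @dsignE K m1 n, @oddE m1 n, mulrN1, mulN1r, mulr1, mul1r, @opprK K, expr0, expr1).
exists (ulsubmx (ulsubmx X)), (ursubmx (ulsubmx X)), (dlsubmx (ulsubmx X)).
exists (ulsubmx (drsubmx X)), (ursubmx (drsubmx X)), (dlsubmx (drsubmx X)).
exists (lsubmx (usubmx (ursubmx X))), (rsubmx (usubmx (ursubmx X))).
exists (lsubmx (dsubmx (ursubmx X))), (rsubmx (dsubmx (ursubmx X))).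
split.
- apply/matrixP => i j; rewrite !mxE.
  by have := e (xr j) (xl i);
    rewrite /ssign !simp /= ?simp.
- apply/matrixP => i j; rewrite !mxE.
  by have := e (xl j) (xr i);
    rewrite /ssign !simp /= ?simp.
- apply/matrixP => i j; rewrite !mxE.
  by apply: oppr_inj; have := e (tr j) (tl i);
    rewrite /ssign !simp /= ?simp.
- apply/matrixP => i j; rewrite !mxE.
  by have := e (tl j) (tr i);
    rewrite /ssign !simp /= ?simp.
rewrite -{1}[X]submxK; congr block_mx.
- rewrite -{1}[ulsubmx X]submxK; congr block_mx; apply/matrixP => i j; rewrite !mxE.
  by have := e (xr j) (xr i);
    rewrite /ssign !simp /= ?simp.
- rewrite -{1}[ursubmx X]vsubmxK -{1}[usubmx _]hsubmxK -{1}[dsubmx _]hsubmxK.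
  by apply/matrixP => i j; rewrite !mxE; case: split => k; rewrite !mxE; case: split => l; rewrite !mxE.
- apply/matrixP => i j; rewrite !mxE; case: (split_ordP i) => k ->; case: (split_ordP j) => l ->;
  rewrite ?split_l ?split_r ?mxE ?split_l ?split_r ?mxE.
  + by have := e (xl l) (tl k);
    rewrite /ssign !simp /= ?simp.
  + by have := e (xr l) (tl k);
    rewrite /ssign !simp /= ?simp.
  + by have := e (xl l) (tr k);
    rewrite /ssign !simp /= ?simp.
  + by have := e (xr l) (tr k);
    rewrite /ssign !simp /= ?simp.
- rewrite -{1}[drsubmx X]submxK; congr block_mx; apply/matrixP => i j; rewrite !mxE.
  by have := e (tr j) (tr i);
    rewrite /ssign !simp /= ?simp => <-; rewrite opprK.
Qed.

Lemma act_linear X : linear (act X).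
Proof.
move=> a f g; rewrite /Defs.act scaler_sumr -big_split; apply: eq_bigr => y _ /=.
rewrite scaler_sumr -big_split; apply: eq_bigr => z _ /=.
by rewrite linearP mulrDr scalerDr -scalerAr !scalerA mulrC.
Qed.

HB.instance Definition _ X := GRing.isLinear.Build K A A *:%R (act X) (act_linear X).

Definition actr f X := act X f.

Lemma actr_linear f : linear (actr f).
Proof.
move=> a X Y; rewrite /actr /Defs.act scaler_sumr -big_split; apply: eq_bigr => y _ /=.
rewrite scaler_sumr -big_split; apply: eq_bigr => z _ /=.
by rewrite !mxE scalerDl scalerA.
Qed.

HB.instance Definition _ f :=
  GRing.isLinear.Build K 'M[K]_dim A *:%R (actr f) (actr_linear f).

Lemma act_delta y z f : act (delta_mx y z) f = gen y * dgen z f.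
Proof.
rewrite /Defs.act (bigD1 y) //= (bigD1 z) //= big1 ?addr0.
  rewrite big1 ?addr0 => [|w /negPf nw]; first by rewrite mxE !eqxx scale1r.
  by apply: big1 => v _; rewrite mxE nw scale0r.
by move=> w /negPf nw; rewrite mxE nw andbF scale0r.
Qed.

(** The commutator is the sum S of [osp_form X y w] times the product of the variables y and w. The
    coefficients are superskew and the products supersymmetric, so exchanging y and w gives S =
    -S. *)
Lemma act_eta X f : osp X -> act X (eta * f) = eta * act X f.
Proof.
move=> /osp_skew_osp sk; rewrite /Defs.act.
under eq_bigr => y _ do (under eq_bigr => z _ do
  rewrite dgen_eta mulrDr gen_eta scalerDr scalerAr; rewrite big_split /= -mulr_sumr).
rewrite big_split /= -mulr_sumr; apply/eqP; rewrite addrC -subr_eq0 addrK; apply/eqP.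
set S := (X in X = 0).
have eS : S = \sum_y \sum_w osp_form X y w *: (gen y * (gen w * f)).
  apply: eq_bigr => y _; rewrite (reindex_inj (inv_inj (@dualK m1 n))) /=.
  by apply: eq_bigr => w _; rewrite /osp_form dualK -scalerAr scalerA.
suff : S + S = 0.
  rewrite -mulr2n -scaler_nat => /eqP; rewrite scaler_eq0 pnatr_eq0 /=.
  by move/eqP.
have eS' := eS; rewrite exchange_big in eS'.
rewrite {1}eS eS' -big_split big1 //= => y _.
rewrite -big_split big1 //= => w _.
by rewrite [gen w * (gen y * f)]gen_gen scalerA (sk y w) mulNr mulrAC ssignC ssignMM mul1r scaleNr ?subrr ?addNr.
Qed.

End Act.

(** * Coefficients and degrees *)

Section Coefficients.
Variables (K : numFieldType) (m1 n : nat).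
Local Notation dim := ((m1 + m1) + (n + n))%N.
Local Notation A := (oscA K m1 n).
Local Notation gen := (@Defs.gen K m1 n).
Local Notation dgen := (@Defs.dgen K m1 n).
Local Notation eta := (@Defs.eta K m1 n).
Local Notation Delta := (@Defs.superDelta K m1 n).
Local Notation xl := (@Defs.xl m1 n).
Local Notation xr := (@Defs.xr m1 n).
Local Notation tl := (@Defs.tl m1 n).
Local Notation tr := (@Defs.tr m1 n).
Local Notation act := (@Defs.act K m1 n).
Local Notation homogeneous := (@Defs.homogeneous K m1 n).
Implicit Types (f g h : A) (y z w : 'I_dim) (p q : 'I_n) (S : {set 'I_(n + n)}).
Implicit Types (mu : 'X_{1.. m1 + m1}) (k d : int).

Lemma mcoeff_XM i (P : {mpoly K[m1 + m1]}) mu :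
  ('X_i * P)@_mu = if (0 < mu i)%N then P@_(mu - U_(i)) else 0.
Proof.
case: ifP => h.
  have le : (U_(i) <= mu)%MM.
    by apply/mnm_lepP => j; rewrite mnm1E; case: eqP => // <-.
  by rewrite mulrC -{1}(submK le) addmC mcoeffMX.
apply: memN_msupp_eq0; rewrite mulrC (perm_mem (msuppMX _ _)).
by apply/mapP => -[nu _ e]; rewrite e mnmDE mnm1E eqxx in h.
Qed.

Lemma coef_genx i f S mu :
  ((gen (lshift _ i) * f : A) S)@_mu
  = if (0 < mu i)%N then (f S)@_(mu - U_(i)) else 0.
Proof. by rewrite gen_lshift xvarME mcoeff_XM. Qed.

Lemma coef_dgenx i f S mu :
  ((dgen (lshift _ i) f : A) S)@_mu = (mu i).+1%:R * (f S)@_(mu + U_(i)).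
Proof. by rewrite dgen_lshift ffunE mcoeff_mderiv mulr_natl. Qed.

Lemma coef_gentheta j f S :
  (gen (rshift _ j) * f : A) S
  = if j \in S then (-1) ^+ ninv [set j] (S :\ j) * f (S :\ j) else 0.
Proof. by rewrite gen_rshift thetaME. Qed.

Lemma coef_dgentheta j f S :
  (dgen (rshift _ j) f : A) S
  = if j \in S then 0 else (-1) ^+ ninv [set j] S * f (j |: S).
Proof. by rewrite dgen_rshift ffunE. Qed.

Lemma mcoeff_signM e (P : {mpoly K[m1 + m1]}) mu :
  ((-1) ^+ e * P)@_mu = (-1) ^+ e * P@_mu.
Proof.
by rewrite -signr_odd -[in RHS]signr_odd; case: (odd e); rewrite ?mulN1r ?mul1r ?mcoeffN.
Qed.

Lemma oscP f g : (forall S mu, (f S)@_mu = (g S)@_mu) -> f = g.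
Proof. by move=> e; apply/ffunP => S; apply/mpolyP => mu. Qed.

Lemma osc0E S : (0 : A) S = 0.
Proof. exact: ffunE. Qed.

Lemma osc_sumE (I : Type) (r : seq I) (P : pred I) (F : I -> A) S :
  (\sum_(i <- r | P i) F i : A) S = \sum_(i <- r | P i) F i S.
Proof.
by apply: (big_morph (fun f : A => f S)); [move=> f g; apply: oscDE | apply: osc0E].
Qed.

Lemma homogeneousP k f :
  homogeneous k f <-> forall S mu, (f S)@_mu != 0 -> (mdeg mu + #|S|)%N%:Z = k.
Proof.
by split => h S mu; [rewrite -mcoeff_msupp | rewrite mcoeff_msupp]; apply: h.
Qed.

Lemma homogeneous0 k : homogeneous k 0.
Proof. by apply/homogeneousP => S mu; rewrite osc0E mcoeff0 eqxx. Qed.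

Lemma homogeneousD k f g : homogeneous k f -> homogeneous k g -> homogeneous k (f + g).
Proof.
move=> /homogeneousP hf /homogeneousP hg; apply/homogeneousP => S mu.
rewrite oscDE mcoeffD; case: (eqVneq (f S)@_mu 0) => [->|/hf //].
by rewrite add0r; apply: hg.
Qed.

Lemma homogeneousZ k a f : homogeneous k f -> homogeneous k (a *: f).
Proof.
move=> /homogeneousP hf; apply/homogeneousP => S mu.
by rewrite oscZE mcoeffZ mulf_eq0 => /norP[_]; apply: hf.
Qed.

Lemma homogeneousB k f g : homogeneous k f -> homogeneous k g -> homogeneous k (f - g).
Proof. by move=> hf hg; rewrite -scaleN1r; apply/homogeneousD/homogeneousZ. Qed.

Lemma homogeneous_sum k (I : Type) (r : seq I) (P : pred I) (F : I -> A) :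
  (forall i, P i -> homogeneous k (F i)) -> homogeneous k (\sum_(i <- r | P i) F i).
Proof.
move=> hF; apply: (big_ind (homogeneous k)) => //; first exact: homogeneous0.
by move=> f g; apply: homogeneousD.
Qed.

Lemma homogeneous_gen k y f : homogeneous k f -> homogeneous (k + 1) (gen y * f).
Proof.
move=> /homogeneousP hf; apply/homogeneousP => S mu.
elim/index_case: y => i; rewrite ?coef_genx ?coef_gentheta.
  case: ifP => [mui /hf <-|_]; last by rewrite eqxx.
  have le : (U_(i) <= mu)%MM.
    by apply/mnm_lepP => j; rewrite mnm1E; case: eqP => // <-.
  by rewrite -{1}(submK le) mdegD mdeg1; lia.
case: ifP => [iS|_]; last by rewrite mcoeff0 eqxx.
rewrite mcoeff_signM mulf_eq0 => /norP[_ /hf <-].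
by rewrite (cardsD1 i S) iS add1n addnS -addn1 PoszD.
Qed.

Lemma homogeneous_dgen k y f : homogeneous k f -> homogeneous (k - 1) (dgen y f).
Proof.
move=> /homogeneousP hf; apply/homogeneousP => S mu.
elim/index_case: y => i; rewrite ?coef_dgenx ?coef_dgentheta.
  by rewrite mulf_eq0 => /norP[_ /hf <-]; rewrite mdegD mdeg1; lia.
case: ifP => [_|iS]; first by rewrite mcoeff0 eqxx.
rewrite mcoeff_signM mulf_eq0 => /norP[_ /hf <-].
by rewrite cardsU1 iS add1n addnS -addn1 [X in _ = X - 1]PoszD addrK.
Qed.

Lemma homogeneous_eq k d f : k = d -> homogeneous k f -> homogeneous d f.
Proof. by move=> ->. Qed.

Lemma homogeneous_act k X f : homogeneous k f -> homogeneous k (act X f).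
Proof.
move=> hf; apply: homogeneous_sum => y _; apply: homogeneous_sum => z _.
apply/homogeneousZ; apply: (@homogeneous_eq (k - 1 + 1)); first by lia.
by apply/homogeneous_gen/homogeneous_dgen.
Qed.

Lemma homogeneous_eta k f : homogeneous k f -> homogeneous (k + 2) (eta * f).
Proof.
move=> hf; rewrite etaM; apply: (@homogeneous_eq (k + 1 + 1)); first by lia.
by apply: homogeneousD; apply: homogeneous_sum => i _; apply/homogeneous_gen/homogeneous_gen.
Qed.

Lemma homogeneous_etaX s k f : homogeneous k f -> homogeneous (k + s%:Z * 2) (eta ^+ s * f).
Proof.
move=> hf; elim: s => [|s IHs]; first by rewrite expr0 mul1r mul0r addr0.
rewrite exprS -mulrA; apply: (@homogeneous_eq (k + s%:Z * 2 + 2)); first by lia.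
exact: homogeneous_eta.
Qed.

Lemma homogeneous_Delta k f : homogeneous k f -> homogeneous (k - 2) (Delta f).
Proof.
move=> hf; apply: (@homogeneous_eq (k - 1 - 1)); first by lia.
by apply: homogeneousD; apply: homogeneous_sum => i _; apply/homogeneous_dgen/homogeneous_dgen.
Qed.

Lemma homogeneous_lt0 k f : k < 0 -> homogeneous k f -> f = 0.
Proof.
move=> k0 /homogeneousP hf; apply: oscP => S mu; rewrite osc0E mcoeff0.
by apply/eqP/negP => /negP /hf e; move: k0; rewrite -e; lia.
Qed.

Lemma homogeneous1 : homogeneous 0 1.
Proof.
apply/homogeneousP => S mu; rewrite ffunE; case: (eqVneq S set0) => [->|_]; last first.
  by rewrite mcoeff0 eqxx.
by rewrite mcoeff1 pnatr_eq0 eqb0 negbK cards0 => /eqP ->; rewrite mdeg0.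
Qed.

Lemma coef_gen_dgen y f S mu :
  ((gen y * dgen y f : A) S)@_mu =
  match split y with inl i => mu i | inr p => nat_of_bool (p \in S) end%:R * (f S)@_mu.
Proof.
elim/index_case: y => i; rewrite splitE ?coef_genx ?coef_gentheta.
  rewrite coef_dgenx; case: ifP => h.
    have le : (U_(i) <= mu)%MM.
      by apply/mnm_lepP => j; rewrite mnm1E; case: eqP => // <-.
    by rewrite submK // mnmBE mnm1E eqxx subn1 prednK.
  by move: h; case: (mu i) => // _; rewrite mul0r.
case: ifP => h; rewrite ?mul0r ?mcoeff0 // mul1r coef_dgentheta !inE eqxx /=.
by rewrite mulrA -expr2 sqrr_sign mul1r setD1K.
Qed.

Lemma coef_euler f S mu : (euler f S)@_mu = (mdeg mu + #|S|)%N%:R * (f S)@_mu.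
Proof.
rewrite /euler osc_sumE raddf_sum /=; under eq_bigr => y _ do rewrite coef_gen_dgen.
rewrite -mulr_suml big_split_ord /= natrD mdegE -sum1_card !natr_sum.
congr ((_ + _) * _); first by apply: eq_bigr => i _; rewrite splitE.
rewrite [RHS]big_mkcond /=; apply: eq_bigr => i _; rewrite splitE.
by case: (i \in S).
Qed.

Lemma euler_homogeneous k f : homogeneous k f -> euler f = k%:~R *: f.
Proof.
move=> /homogeneousP hf; apply: oscP => S mu; rewrite oscZE mcoeffZ coef_euler.
have [->|nz] := eqVneq (f S)@_mu 0; first by rewrite !mulr0.
by rewrite -(hf _ _ nz) pmulrn.
Qed.

Lemma homogeneous_of_euler k f : euler f = k%:~R *: f -> homogeneous k f.
Proof.
move=> e; apply/homogeneousP => S mu nz; have := coef_euler f S mu.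
rewrite e oscZE mcoeffZ => /(mulIf nz)/eqP; rewrite [X in _ == X]pmulrn eqr_int.
by move=> /eqP ->.
Qed.

Lemma euler_eta f : euler (eta * f) = eta * euler f + 2%:R *: (eta * f).
Proof.
rewrite /euler; under eq_bigr => y _ do rewrite dgen_eta mulrDr gen_eta.
rewrite big_split -mulr_sumr /=; congr (_ + _); rewrite sum_index4 etaM.
rewrite scaler_nat mulrnDl !mulr2n; apply: congrD; apply: congrD; apply: eq_bigr => i _.
- by rewrite dualE dsignE scale1r.
- by rewrite dualE dsignE scale1r gen_gen ssign_even ?oddE // scale1r.
- by rewrite dualE dsignE scale1r.
- by rewrite dualE dsignE scaleN1r mulrN gen_gen /ssign !oddE scaleN1r.
Qed.

(** Moving Delta past the s + 1 factors eta one at a time produces the scalars k + 2j + m1 - n for j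
    = 0, ..., s, an arithmetic progression with the stated sum. *)
Lemma Delta_etaX s k f : homogeneous k f ->
  Delta (eta ^+ s.+1 * f) = eta ^+ s.+1 * Delta f
    + (s.+1%:R * (k%:~R + s%:R + m1%:R - n%:R)) *: (eta ^+ s * f).
Proof.
move=> hf; elim: s => [|s IHs].
  rewrite expr1 expr0 mul1r Delta_eta (euler_homogeneous hf) -addrA -scalerDl.
  by congr (_ + _ *: _); ring.
rewrite exprS -mulrA Delta_eta IHs (euler_homogeneous (@homogeneous_etaX s.+1 _ _ hf)).
rewrite mulrDr mulrA -exprS -scalerAr mulrA -exprS -!addrA; congr (_ + _).
rewrite -!scalerDl; congr (_ *: _).
by rewrite rmorphD rmorphM /= -pmulrn -!natr1; ring.
Qed.

Lemma card_setD1_lt (j : 'I_(n + n)) S : j \in S -> (#|S :\ j| < #|S|)%N.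
Proof. by move=> jS; rewrite (cardsD1 j S) jS. Qed.

(** Induction on the size of S: in the coefficient at theta_S, the theta pairs only involve
    coefficients of f at smaller sets, which vanish already. What remains is a nonzero polynomial
    times [f S] in an integral domain. The predicate P serves twice: for eta itself, and for eta
    with x_1 set to 0. *)
Lemma partial_eta_inj (P : pred 'I_m1) (i0 : 'I_m1) f : P i0 ->
  \sum_(i | P i) gen (xl i) * (gen (xr i) * f) + \sum_p gen (tl p) * (gen (tr p) * f) = 0 ->
  f = 0.
Proof.
move=> Pi0 e0; apply/ffunP => S; rewrite osc0E.
have [N] := ubnP #|S|; elim: N S => // N IHN S /ltnSE leS.
have /ffunP /(_ S) := e0; rewrite oscDE osc0E !osc_sumE addrC big1 ?add0r => [|p _].
  under eq_bigr => i _ do rewrite /Defs.xl /Defs.xr !gen_lshift !xvarME mulrA.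
  rewrite -mulr_suml => /eqP; rewrite mulf_eq0 => /orP[|/eqP //].
  move/eqP/mpolyP/(_ (U_(lshift m1 i0) + U_(rshift m1 i0))%MM)/eqP.
  rewrite raddf_sum mcoeff0 (bigD1 i0) //= -mpolyXD mcoeffX eqxx big1 ?addr0 ?oner_eq0 //.
  move=> i /andP[_ ni]; rewrite -mpolyXD mcoeffX; case: eqP => // /mnmP /(_ (lshift m1 i0)).
  rewrite !mnmDE !mnm1E !eq_lshift !eq_rlshift (negPf ni) eqxx /=.
  by [].
rewrite /Defs.tl /Defs.tr coef_gentheta; case: ifP => // pS; rewrite coef_gentheta; case: ifP => [qS|]; last by rewrite mulr0.
rewrite IHN ?mulr0 //; apply: leq_trans leS.
by apply: leq_ltn_trans (card_setD1_lt pS); apply/subset_leq_card/subD1set.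
Qed.

Hypothesis m1_gt0 : (0 < m1)%N.

Lemma eta_inj f : eta * f = 0 -> f = 0.
Proof. by rewrite etaM; apply: (@partial_eta_inj predT (ifirst m1_gt0)). Qed.

Lemma etaX_inj s f : eta ^+ s * f = 0 -> f = 0.
Proof.
elim: s => [|s IHs]; first by rewrite mul1r.
by rewrite exprS -mulrA => /eta_inj.
Qed.

Lemma homogeneous_etaK k f : homogeneous k (eta * f) -> homogeneous (k - 2) f.
Proof.
move=> /euler_homogeneous; rewrite euler_eta => e; apply/homogeneous_of_euler.
apply/eqP; rewrite -subr_eq0; apply/eqP/eta_inj; rewrite mulrBr -scalerAr.
apply/eqP; rewrite subr_eq0 rmorphB scalerBl -e addrK //.
Qed.

(** Obtained by cancelling eta^s. If the scalar is nonzero, g is again a multiple of eta; if it is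
    zero, g is harmonic. These are the two outcomes of the descent. *)
Lemma harmonic_etaX s k g : homogeneous k g -> Delta (eta ^+ s.+1 * g) = 0 ->
  eta * Delta g = - (s.+1%:R * (k%:~R + s%:R + m1%:R - n%:R)) *: g.
Proof.
move=> hg /eqP; rewrite (Delta_etaX _ hg) exprSr -mulrA scalerAr -mulrDr => /eqP /etaX_inj /eqP.
by rewrite addr_eq0 => /eqP ->; rewrite scaleNr.
Qed.

Definition monom S mu : A := [ffun T => if T == S then 'X_[mu] else 0].

Lemma coef_monom S mu T nu :
  (monom S mu T)@_nu = ((T == S) && (mu == nu))%:R.
Proof. by rewrite ffunE; case: (T == S); rewrite ?mcoeffX ?mcoeff0. Qed.

Lemma monom0 : monom set0 0%MM = 1.
Proof. by apply/ffunP => S; rewrite !ffunE; case: (S == set0); rewrite ?mpolyX0. Qed.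

Lemma genx_monom i S mu : gen (lshift _ i) * monom S mu = monom S (U_(i) + mu).
Proof.
apply/ffunP => T; rewrite gen_lshift xvarME !ffunE mpolyXD.
by case: (T == S); rewrite ?mulr0.
Qed.

Lemma gentheta_monom j S mu : j \notin S ->
  gen (rshift _ j) * monom S mu = (-1) ^+ ninv [set j] S *: monom (j |: S) mu.
Proof.
move=> jS; apply: oscP => T nu; rewrite coef_gentheta oscZE mcoeffZ coef_monom.
case: ifP => jT; last first.
  rewrite mcoeff0; case: eqP => [eT|_]; last by rewrite mulr0.
  by rewrite eT !inE eqxx in jT.
rewrite mcoeff_signM coef_monom.
have -> : (T == j |: S) = (T :\ j == S).
  by apply/eqP/eqP => [->|<-]; rewrite ?setU1K ?setD1K.
by case: eqP => [->|_] //=; rewrite !mulr0.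
Qed.

Lemma osc_sum_monom f :
  f = \sum_S \sum_(mu <- msupp (f S)) (f S)@_mu *: monom S mu.
Proof.
apply/ffunP => T; rewrite osc_sumE (bigD1 T) //= [X in _ + X]big1 ?addr0 => [|S /negPf nS].
  rewrite osc_sumE {1}[f T]mpolyE; apply: eq_bigr => mu _.
  by rewrite oscZE ffunE eqxx.
rewrite osc_sumE big1 // => mu _.
by rewrite oscZE ffunE eq_sym nS scaler0.
Qed.

Lemma osc_ind (Q : A -> Prop) :
  Q 0 -> (forall a f g, Q f -> Q g -> Q (a *: f + g)) -> Q 1 ->
  (forall y f, Q f -> Q (gen y * f)) -> forall f, Q f.
Proof.
move=> Q0 QD Q1 Qg f.
have QZ a g : Q g -> Q (a *: g) by move=> Qh; rewrite -[_ *: _]addr0; apply: QD.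
have Qx N : forall mu, (mdeg mu <= N)%N -> Q (monom set0 mu).
  elim: N => [|N IHN] mu hmu.
    by move: hmu; rewrite leqn0 mdeg_eq0 => /eqP ->; rewrite monom0.
  have [->|] := eqVneq mu 0%MM; first by rewrite monom0.
  rewrite -mdeg_eq0 mdegE sum_nat_eq0 negb_forall => /existsP[i /=]; rewrite -lt0n => hi.
  have le : (U_(i) <= mu)%MM.
    by apply/mnm_lepP => j; rewrite mnm1E; case: eqP => // <-.
  rewrite -(submK le) addmC -genx_monom; apply/Qg/IHN; move: hmu.
  by rewrite -{1}(submK le) mdegD mdeg1 addn1.
have QS N : forall S mu, (#|S| <= N)%N -> Q (monom S mu).
  elim: N => [|N IHN] S mu hS.
    by move: hS; rewrite leqn0 cards_eq0 => /eqP ->; apply: Qx (leqnn _).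
  have [->|[j jS]] := set_0Vmem S; first exact: Qx (leqnn _).
  have := @gentheta_monom j (S :\ j) mu; rewrite setD1K // !inE eqxx => /(_ isT) e.
  have -> : monom S mu = (-1) ^+ ninv [set j] (S :\ j) *: (gen (rshift (m1 + m1) j) * monom (S :\ j) mu).
    by rewrite e scalerA -expr2 sqrr_sign scale1r.
  by apply/QZ/Qg/IHN; rewrite -ltnS; apply: leq_trans hS; apply: card_setD1_lt.
rewrite (osc_sum_monom f); apply: big_ind => //.
  by move=> g h Qg' Qh; rewrite -[g]scale1r; apply: QD.
move=> S _; apply: big_ind => //.
  by move=> g h Qg' Qh; rewrite -[g]scale1r; apply: QD.
by move=> mu _; apply/QZ/QS/leqnn.
Qed.

End Coefficients.

(** * Harmonic elements and multiples of eta *)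

Section Decomposition.
Variables (K : numFieldType) (m1 n : nat).
Local Notation A := (oscA K m1 n).
Local Notation eta := (@Defs.eta K m1 n).
Local Notation Delta := (@Defs.superDelta K m1 n).
Local Notation homogeneous := (@Defs.homogeneous K m1 n).
Local Notation harmonic := (@Defs.harmonic K m1 n).
Local Notation c := (n%:Z - m1%:Z + 1).
Hypothesis m1_gt0 : (0 < m1)%N.
Implicit Types (f g u : A) (k : int) (s : nat).

Lemma Delta_etaX_coef k s :
  (k - 2 * s.+1%:Z)%:~R + s%:R + m1%:R - n%:R = (k - s.+1%:Z - c)%:~R :> K.
Proof.
have e (a : nat) : a%:R = a%:Z%:~R :> K by [].
by rewrite !e -!rmorphD -rmorphB; congr (_%:~R); lia.
Qed.

Lemma harmonic_eta_dvd k s g :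
  homogeneous (k - 2 * s.+1%:Z) g -> Delta (eta ^+ s.+1 * g) = 0 ->
  k - s.+1%:Z - c != 0 ->
  exists2 g', homogeneous (k - 2 * s.+2%:Z) g' & g = eta * g'.
Proof.
move=> hg hD nz; have := harmonic_etaX m1_gt0 hg hD; rewrite Delta_etaX_coef scaleNr => e.
set a := (s.+1%:R * _) in e.
have a0 : a != 0 by rewrite mulf_neq0 ?pnatr_eq0 // intr_eq0.
exists (- a^-1 *: Delta g).
  apply: homogeneousZ; apply: homogeneous_eq (homogeneous_Delta hg); lia.
by rewrite -scalerAr e scaleNr scalerN opprK scalerA mulVf // scale1r.
Qed.

(** If k <= c then k - s - 1 < c. If k > 2c, the degree bound 2(s + 1) <= k gives k - s - 1 >= k/2 >
    c. *)
Lemma noncritical k s : (2 * c < k) || (k <= c) ->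
  0 <= k - 2 * s.+1%:Z -> k - s.+1%:Z - c != 0.
Proof. by case/orP => h1 h2; apply/eqP; lia. Qed.

Lemma harmonic_eta_eq0 k f : (2 * c < k) || (k <= c) ->
  harmonic k f -> mulspace eta (homogeneous (k - 2)) f -> f = 0.
Proof.
move=> hk [_ Df] [g0 hg0 ef].
have H s : exists2 g, homogeneous (k - 2 * s.+1%:Z) g & f = eta ^+ s.+1 * g.
  elim: s => [|s [g hg e]]; first by exists g0; rewrite ?expr1 // mulr1.
  have [neg|pos] := ltrP (k - 2 * s.+1%:Z) 0.
    exists 0; first exact: homogeneous0.
    by rewrite e (homogeneous_lt0 neg hg) !mulr0.
  have [|g' hg' e'] := @harmonic_eta_dvd k s g hg _ (noncritical hk pos).
    by rewrite -e.
  by exists g' => //; rewrite e e' mulrA -exprSr.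
(* After [|k| + 1] divisions the cofactor has negative degree, so it is 0. *)
have [g hg ->] := H `|k|%N; rewrite (homogeneous_lt0 _ hg) ?mulr0 //; lia.
Qed.

(** The same descent, stopped at the exponent k - c, where the scalar vanishes: there it yields eta
    Delta g = 0, and g is harmonic because eta can be cancelled. *)
Lemma harmonic_eta_crit k f : c < k -> harmonic k f ->
  mulspace eta (homogeneous (k - 2)) f ->
  mulspace (eta ^+ `|k - c|%N) (harmonic (2 * c - k)) f.
Proof.
move=> hk [_ Df] [g0 hg0 ef].
have H s : (s < `|k - c|)%N ->
    exists2 g, homogeneous (k - 2 * s.+1%:Z) g & f = eta ^+ s.+1 * g.
  elim: s => [|s IHs] hs; first by exists g0; rewrite ?expr1 // mulr1.
  have [g hg e] := IHs (ltnW hs).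
  have [||g' hg' e'] := @harmonic_eta_dvd k s g hg.
  - by rewrite -e.
  - by apply/eqP; lia.
  by exists g' => //; rewrite e e' mulrA -exprSr.
have [|g hg ef'] := H `|k - c|.-1; first by lia.
have es : `|k - c|.-1.+1 = `|k - c|%N by lia.
exists g; last by rewrite -es.
split; first by apply: homogeneous_eq hg; lia.
apply: (eta_inj m1_gt0).
rewrite ef' in Df; rewrite (harmonic_etaX m1_gt0 hg Df) Delta_etaX_coef.
by rewrite (_ : k - _ - _ = 0) ?mulr0 ?oppr0 ?scale0r //; lia.
Qed.

Lemma harmonic_etaX_crit k g : c < k -> harmonic (2 * c - k) g ->
  harmonic k (eta ^+ `|k - c|%N * g).
Proof.
move=> hk [hg Dg]; split; first by apply: homogeneous_eq (@homogeneous_etaX _ _ _ `|k - c|%N _ _ hg); lia.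
have es : `|k - c|.-1.+1 = `|k - c|%N by lia.
rewrite -es (Delta_etaX _ hg) Dg mulr0 add0r.
have -> : 2 * c - k = k - 2 * (`|k - c|.-1.+1)%:Z by lia.
by rewrite Delta_etaX_coef (_ : k - _ - _ = 0) ?mulr0 ?scale0r //; lia.
Qed.

(** Proved for Delta (eta^(s+1) g) = eta^s u, by induction on a bound for the degree of u. The trial
    solution g = u leaves the error eta^(s+1) Delta u, which has the same shape with s + 1 and a
    smaller degree; it is removed by induction, and the nonzero scalar is divided out. *)
Lemma Delta_eta_surj k u : (2 * c < k) || (k <= c) -> homogeneous (k - 2) u ->
  exists2 g, homogeneous (k - 2) g & Delta (eta * g) = u.
Proof.
move=> hk hu.
have H N : forall s u, k - 2 * s.+1%:Z < N%:Z -> homogeneous (k - 2 * s.+1%:Z) u ->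
    exists2 g, homogeneous (k - 2 * s.+1%:Z) g & Delta (eta ^+ s.+1 * g) = eta ^+ s * u.
  elim: N => [|N IHN] s v hN hv.
    exists 0; first exact: homogeneous0.
    by rewrite (homogeneous_lt0 hN hv) !mulr0 linear0.
  have [neg|pos] := ltrP (k - 2 * s.+1%:Z) 0.
    exists 0; first exact: homogeneous0.
    by rewrite (homogeneous_lt0 neg hv) !mulr0 linear0.
  have [||g hg eg] := IHN s.+1 (Delta v); first by lia.
    by apply: homogeneous_eq (homogeneous_Delta hv); lia.
  have := noncritical hk pos; rewrite -(intr_eq0 K) -Delta_etaX_coef => nz.
  set a := s.+1%:R * ((k - 2 * s.+1%:Z)%:~R + s%:R + m1%:R - n%:R) : K.
  have a0 : a != 0 by rewrite mulf_neq0 // pnatr_eq0.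
  exists (a^-1 *: (v - eta * g)).
    apply/homogeneousZ/homogeneousB => //.
    by apply: homogeneous_eq (homogeneous_eta hg); lia.
  rewrite -scalerAr mulrBr mulrA -exprSr linearZ linearB /= (Delta_etaX _ hv) eg.
  by rewrite addrC addKr scalerA mulVf // scale1r.
have [||g hg e] := H `|k|.+1 0%N u; first by lia.
  by rewrite mulr1.
by exists g; [rewrite mulr1 in hg | rewrite expr1 expr0 mul1r in e].
Qed.

Lemma harmonic_direct_sum k : (2 * c < k) || (k <= c) ->
  is_direct_sum (homogeneous k) (harmonic k) (mulspace eta (homogeneous (k - 2))).
Proof.
move=> hk; split; last by move=> v; apply: harmonic_eta_eq0.
move=> w; split=> [hw|[u1 [u2 [[hu1 _] [g hg ->] ->]]]]; last first.
  by apply/homogeneousD => //; apply: homogeneous_eq (homogeneous_eta hg); lia.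
have [g hg e] := Delta_eta_surj hk (homogeneous_Delta hw).
exists (w - eta * g), (eta * g); split.
- split; last by rewrite linearB /= e subrr.
  by apply/homogeneousB => //; apply: homogeneous_eq (homogeneous_eta hg); lia.
- by exists g.
- by rewrite subrK.
Qed.

End Decomposition.

(** * The contravariant form *)

Section MpolyPairing.
Variables (K : numFieldType) (N : nat).
Implicit Types (p q : {mpoly K[N]}) (mu nu : 'X_{1..N}).

Definition mfact mu := (\prod_(i < N) (mu i)`!)%N.

(** The Fischer pairing: monomials are orthogonal, with square the product of the factorials of the
    exponents. This normalisation makes multiplication by a variable adjoint to its derivation. *)
Definition mpair q p := \sum_(mu <- msupp q) p@_mu * ((mfact mu)%:R * q@_mu).

Lemma mfact_neq0 mu : (mfact mu)%:R != 0 :> K.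
Proof.
rewrite pnatr_eq0 -lt0n /mfact; apply: prodn_gt0 => i; exact: fact_gt0.
Qed.

Lemma mfactD1 i mu : mfact (U_(i) + mu) = ((mu i).+1 * mfact mu)%N.
Proof.
rewrite /mfact (bigD1 i) //= [in RHS](bigD1 i) //= mulnA; congr (_ * _)%N.
  by rewrite mnmDE mnm1E eqxx factS.
by apply: eq_bigr => j /negPf nj; rewrite mnmDE mnm1E eq_sym nj.
Qed.

Lemma mpair_linear q : linear_for *%R (mpair q).
Proof.
move=> a p1 p2; rewrite /mpair mulr_sumr -big_split; apply: eq_bigr => mu _ /=.
by rewrite mcoeffD mcoeffZ; ring.
Qed.

HB.instance Definition _ q :=
  GRing.isLinear.Build K {mpoly K[N]} K *%R (mpair q) (mpair_linear q).

Lemma mpair_X mu q : mpair q 'X_[mu] = (mfact mu)%:R * q@_mu.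
Proof.
rewrite /mpair; case: (boolP (mu \in msupp q)) => h.
  rewrite (bigD1_seq mu) ?msupp_uniq //= mcoeffX eqxx mul1r big1 ?addr0 // => nu.
  by rewrite mcoeffX eq_sym => /negPf ->; rewrite mul0r.
rewrite (memN_msupp_eq0 h) mulr0 big1_seq // => nu /andP[_ hnu].
by rewrite mcoeffX; case: eqP h => [->|_]; rewrite ?hnu // mul0r.
Qed.

Lemma mpairC p q : mpair p q = mpair q p.
Proof.
rewrite {2}(mpolyE p) linear_sum /=; apply: eq_bigr => mu _.
by rewrite linearZ /= mpair_X; ring.
Qed.

Lemma mpair_mulX i p q : mpair ('X_i * p) q = mpair p (mderiv i q).
Proof.
rewrite mpairC [RHS]mpairC (mpolyE p) mulr_sumr !linear_sum /=.
apply: eq_bigr => mu _; rewrite -scalerAr !linearZ /=.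
by rewrite -mpolyXD !mpair_X mfactD1 mcoeff_mderiv addmC natrM -mulr_natl; ring.
Qed.

End MpolyPairing.

(** * The contravariant form on superpolynomials and its adjoints *)

Section Contravariant.
Variables (K : numClosedFieldType) (m1 n : nat).
Local Notation dim := ((m1 + m1) + (n + n))%N.
Local Notation A := (oscA K m1 n).
Local Notation gen := (@Defs.gen K m1 n).
Local Notation dgen := (@Defs.dgen K m1 n).
Local Notation eta := (@Defs.eta K m1 n).
Local Notation Delta := (@Defs.superDelta K m1 n).
Local Notation act := (@Defs.act K m1 n).
Local Notation dsign := (@dsign K m1 n).
Local Notation monom := (@monom K m1 n).
Implicit Types (f g h : A) (y z w : 'I_dim) (k : int).
Implicit Types (X Y : 'M[K]_dim) (S : {set 'I_(n + n)}) (mu : 'X_{1.. m1 + m1}).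

(* The powers of i turn the transpose, which does not preserve osp, into the  *)
(* supertranspose, which does.                                                *)
Definition form f g : K := \sum_(S : {set 'I_(n + n)}) 'i ^+ #|S| * mpair (f S) (g S).

Lemma formC f g : form f g = form g f.
Proof. by apply: eq_bigr => S _; rewrite mpairC. Qed.

Lemma form_linear g : linear_for *%R (form g).
Proof.
move=> a f1 f2; rewrite /form mulr_sumr -big_split; apply: eq_bigr => S _ /=.
by rewrite oscDE oscZE linearP /=; ring.
Qed.

HB.instance Definition _ g :=
  GRing.isLinear.Build K A K *%R (form g) (form_linear g).

Lemma formDl f f' g : form (f + f') g = form f g + form f' g.
Proof. by rewrite formC linearD -!(formC g). Qed.

Lemma formZl a f g : form (a *: f) g = a * form f g.
Proof. by rewrite formC linearZ -(formC g). Qed.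

Lemma form0l g : form 0 g = 0.
Proof. by rewrite formC linear0. Qed.

Lemma form_suml (I : Type) (r : seq I) (P : pred I) (F : I -> A) g :
  form (\sum_(i <- r | P i) F i) g = \sum_(i <- r | P i) form (F i) g.
Proof. by rewrite formC linear_sum; apply: eq_bigr => i _; rewrite formC. Qed.

Lemma mpair_sign e (p q : {mpoly K[m1 + m1]}) :
  mpair ((-1) ^+ e * p) q = (-1) ^+ e * mpair p q.
Proof.
rewrite -signr_odd -[in RHS]signr_odd; case: (odd e); rewrite ?mul1r // !mulN1r.
by rewrite mpairC linearN mpairC.
Qed.

Lemma mpair0l (q : {mpoly K[m1 + m1]}) : mpair 0 q = 0.
Proof. by rewrite mpairC linear0. Qed.

Lemma form_gen y f g : form (gen y * f) g = 'i ^+ odd_index y * form f (dgen y g).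
Proof.
elim/index_case: y => i; rewrite /form mulr_sumr.
  rewrite odd_lshift; apply: eq_bigr => S _.
  by rewrite mul1r gen_lshift xvarME dgen_lshift ffunE mpair_mulX.
rewrite odd_rshift (bigID (fun S => i \in S)) /= [X in _ + X]big1 ?addr0; last first.
  by move=> S /negPf iS; rewrite coef_gentheta iS mpair0l mulr0.
rewrite [RHS](bigID (fun S => i \in S)) /= [X in _ = X + _]big1 ?add0r; last first.
  by move=> S iS; rewrite coef_dgentheta iS mpairC mpair0l !mulr0.
rewrite (reindex_onto (fun S => i |: S) (fun S => S :\ i)) /=; last first.
  by move=> S iS; rewrite setD1K.
apply: eq_big => [S|S].
  rewrite !inE eqxx /=; apply/eqP/idP => [<-|iS]; first by rewrite !inE eqxx.
  by rewrite setU1K.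
rewrite !inE eqxx /= => /eqP eS; have iS : i \notin S by rewrite -eS !inE eqxx.
rewrite coef_gentheta !inE eqxx /= eS coef_dgentheta (negPf iS) cardsU1 iS exprD.
by rewrite mpair_sign [mpair _ (_ * _)]mpairC mpair_sign [mpair _ (f S)]mpairC; ring.
Qed.

Lemma form_dgen y f g : form (dgen y f) g = 'i ^- odd_index y * form f (gen y * g).
Proof.
rewrite [form f _]formC form_gen mulrA mulVf ?mul1r 1?formC //.
by rewrite expf_neq0 // neq0Ci.
Qed.

Lemma form_gen_dgen y z f g : form (gen y * dgen z f) g =
  'i ^+ odd_index y / 'i ^+ odd_index z * form f (gen z * dgen y g).
Proof. by rewrite form_gen form_dgen mulrA. Qed.

Definition mxadj X : 'M[K]_dim :=
  \matrix_(z, y) ('i ^+ odd_index y / 'i ^+ odd_index z * X y z).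

Lemma form_act X f g : form (act X f) g = form f (act (mxadj X) g).
Proof.
rewrite /Defs.act form_suml linear_sum /=.
under eq_bigr => y _ do rewrite form_suml.
under [RHS]eq_bigr => y _ do rewrite linear_sum /=.
rewrite exchange_big; apply: eq_bigr => z _; apply: eq_bigr => y _ /=.
by rewrite formZl linearZ /= form_gen_dgen mxE; ring.
Qed.

Lemma dsign_sqr y : dsign y * dsign y = 1.
Proof. by elim/index_case4: y => i; rewrite dsignE ?mulr1 ?mulrNN ?mulr1. Qed.

(** On the two odd blocks the extra factors of [mxadj] are 'i and -'i. Their relative sign is that
    of the supertranspose, and it restores the superskewness in each of the four parity cases. *)
Lemma osp_mxadj X : osp X -> osp (mxadj X).
Proof.
move=> /osp_skew_osp sk; apply: osp_of_skew => y w; rewrite /osp_form !mxE.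
have := sk (dual y) (dual w); rewrite /osp_form !dualK /ssign !odd_dual => e.
have {}e : X (dual w) y =
    - ((-1) ^+ (odd_index y && odd_index w) * (X (dual y) w * dsign w)) * dsign y.
  by rewrite -e -mulrA dsign_sqr mulr1.
rewrite e !dsign_dual.
have nz : 'i != 0 :> K := neq0Ci K.
have iV : 'i^-1 = - 'i :> K by apply: (mulIf nz); rewrite mulVf // mulNr -expr2 sqrCi opprK.
have := dsign_sqr w; case: (odd_index y); case: (odd_index w) => /= hw;
  rewrite ?expr0 ?expr1 ?invr1 ?divr1 ?divff ?mul1r ?mulr1 ?iV //;
  rewrite -[LHS]mulr1 -[X in _ * X = _]hw; ring.
Qed.

Lemma form_Delta f g : form (Delta f) g = form f (eta * g).
Proof.
rewrite /superDelta formDl !form_suml etaM linearD /= !linear_sum /=; congr (_ + _).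
  apply: eq_bigr => i _; rewrite !form_dgen !oddE expr0 !invr1 !mul1r.
  by rewrite gen_gen /ssign !oddE scale1r.
(* Two odd derivations contribute 'i^-2 = -1, which cancels the sign of reordering the two
   thetas. *)
apply: eq_bigr => p _; rewrite !form_dgen !oddE expr1 mulrA -invfM -expr2 sqrCi.
by rewrite gen_gen /ssign !oddE scaleN1r -scaleN1r linearZ /= mulKf // oppr_eq0 oner_eq0.
Qed.

Lemma form_monom f S mu :
  form (monom S mu) f = 'i ^+ #|S| * ((mfact mu)%:R * (f S)@_mu).
Proof.
rewrite /form (bigD1 S) //= big1 ?addr0 => [|T /negPf nT].
  by rewrite ffunE eqxx mpairC mpair_X.
by rewrite ffunE nT mpair0l mulr0.
Qed.

Lemma form_monom_eq0 f S mu : form (monom S mu) f = 0 -> (f S)@_mu = 0.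
Proof.
rewrite form_monom => /eqP; rewrite !mulf_eq0 expf_eq0 (negPf (neq0Ci K)) andbF.
by rewrite (negPf (mfact_neq0 _ _)) => /eqP.
Qed.

Lemma form_nondegenerate f : (forall g, form f g = 0) -> f = 0.
Proof.
move=> h; apply: oscP => S mu; rewrite osc0E mcoeff0; apply: form_monom_eq0.
by rewrite formC h.
Qed.

(** This is the adjoint of [act_eta]: Delta is adjoint to eta, osp is stable under adjunction, and
    the form is nondegenerate. *)
Lemma act_Delta X f : osp X -> act X (Delta f) = Delta (act X f).
Proof.
move=> oX; apply/eqP; rewrite -subr_eq0; apply/eqP; apply: form_nondegenerate => g.
rewrite formDl -scaleN1r formZl form_act !form_Delta form_act act_eta ?mulN1r ?subrr //.
exact: osp_mxadj.
Qed.

End Contravariant.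

(** * The vector x_1^k *)

Section HighestWeight.
Variables (K : numFieldType) (m1 n : nat).
Hypothesis m1_gt0 : (0 < m1)%N.
Local Notation dim := ((m1 + m1) + (n + n))%N.
Local Notation A := (oscA K m1 n).
Local Notation gen := (@Defs.gen K m1 n).
Local Notation dgen := (@Defs.dgen K m1 n).
Local Notation eta := (@Defs.eta K m1 n).
Local Notation xl := (@Defs.xl m1 n).
Local Notation xr := (@Defs.xr m1 n).
Local Notation act := (@Defs.act K m1 n).
Local Notation homogeneous := (@Defs.homogeneous K m1 n).
Local Notation harmonic := (@Defs.harmonic K m1 n).
Local Notation submodule := (@Defs.submodule K m1 n).
Local Notation dsign := (@dsign K m1 n).
Local Notation i1 := (ifirst m1_gt0).
Local Notation e1 := (xl i1).
Local Notation r1 := (xr i1).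
Local Notation x1 := (@Defs.x1 K m1 n m1_gt0).
Implicit Types (f g h v : A) (y z w : 'I_dim) (V : A -> Prop).
Implicit Types (S : {set 'I_(n + n)}) (mu : 'X_{1.. m1 + m1}).

(** On elements of degree k this is evaluation at the point e_1, where x_1 = 1 and all other
    variables are 0. *)
Definition ell k f := (f set0)@_(U_(lshift m1 i1) *+ k).

Lemma ell_linear k : linear_for *%R (ell k).
Proof. by move=> a f g; rewrite /ell oscDE oscZE mcoeffD mcoeffZ. Qed.

HB.instance Definition _ k :=
  GRing.isLinear.Build K A K *%R (ell k) (ell_linear k).

Lemma ell0E f : ell 0 f = (f set0)@_0.
Proof. by rewrite /ell mulm0n. Qed.

Lemma ell_gen_e1 k f : ell k.+1 (gen e1 * f) = ell k f.
Proof.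
rewrite /ell coef_genx mulmSr mnmDE mnm1E eqxx addn1 /=; congr (_@_ _).
by rewrite addmK.
Qed.

Lemma ell0_gen_e1 f : ell 0 (gen e1 * f) = 0.
Proof. by rewrite /ell coef_genx mnm0E. Qed.

Lemma ell_gen k y f : y != e1 -> ell k (gen y * f) = 0.
Proof.
elim/index_case: y => i ny; rewrite /ell; last by rewrite coef_gentheta inE mcoeff0.
rewrite coef_genx mulmnE mnm1E; case: eqP => [e|]; last by rewrite mul0n.
by rewrite -e eqxx in ny.
Qed.

Lemma ell_dgen_e1 k f : ell k (dgen e1 f) = k.+1%:R * ell k.+1 f.
Proof. by rewrite /ell coef_dgenx mulmnE mnm1E eqxx mul1n -mulmSr. Qed.

Lemma ell_eta k f : ell k (eta * f) = 0.
Proof.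
rewrite etaM linearD !linear_sum /= big1 ?add0r => [|i _].
  by apply: big1 => p _; apply: ell_gen; rewrite indexE.
by rewrite gen_gen ssign_even ?oddE // scale1r ell_gen // indexE.
Qed.

Lemma ell_homogeneous k (d : int) f : homogeneous d f -> k%:Z != d -> ell k f = 0.
Proof.
move=> /homogeneousP hf /eqP nk; apply/eqP/negPn/negP => /hf.
by rewrite cards0 mdegMn mdeg1 mul1n addn0.
Qed.

(** These matrices act as x_1 d_y minus a multiple of the derivation d_(r1) along the partner of
    x_1. At e_1 they give the tangent directions of the cone eta = 0. For y = e1 the matrix is the
    first basis element of the Cartan subalgebra. *)
Definition osp_elt y : 'M[K]_dim :=
  delta_mx e1 y - dsign y *: delta_mx (dual y) r1.

Lemma osp_osp_elt y : osp (osp_elt y).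
Proof.
apply: osp_of_skew => v w; rewrite /osp_form !mxE.
have eL u : (dual u == y) = (u == dual y) by rewrite (can2_eq (@dualK _ _) (@dualK _ _)).
have eR u : (dual u == r1) = (u == e1).
  by rewrite (can2_eq (@dualK _ _) (@dualK _ _)) dualE.
rewrite !eL !eR !mulrBl.
have t1 b u : (b && (u == dual y))%:R * dsign (dual u) = (b && (u == dual y))%:R * dsign y.
  by case: eqP => [->|_]; [rewrite dualK | rewrite andbF !mul0r].
have t2 b u : dsign y * (b && (u == e1))%:R * dsign (dual u) = (b && (u == e1))%:R * dsign y.
  case: eqP => [->|_]; last by rewrite andbF !(mulr0, mul0r).
  by rewrite dualE dsign_xr mulr1 mulrC.
have t3 b : ssign K v w * ((v == e1) && b)%:R = ((v == e1) && b)%:R.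
  by case: eqP => [->|_]; [rewrite ssign_even ?oddE ?mul1r | rewrite mulr0].
have t4 b : ssign K v w * ((w == e1) && b)%:R = ((w == e1) && b)%:R.
  by case: eqP => [->|_]; [rewrite ssignC ssign_even ?oddE ?mul1r | rewrite mulr0].
rewrite !t1 !t2 mulrBr !mulrA t3 [(v == dual y) && _]andbC t4 opprB.
by rewrite [(w == dual y) && _]andbC.
Qed.

Lemma act_osp_elt y f :
  act (osp_elt y) f = gen e1 * dgen y f - dsign y *: (gen (dual y) * dgen r1 f).
Proof.
rewrite -/(actr f (osp_elt y)) linearB linearZ /= /actr !act_delta //.
Qed.

Lemma x1E : x1 = gen e1. Proof. by []. Qed.

Lemma gen_x1X y k f : gen y * (x1 ^+ k * f) = x1 ^+ k * (gen y * f).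
Proof.
elim: k => [|k IHk]; first by rewrite !mul1r.
by rewrite exprS -!mulrA x1E gen_gen ssignC ssign_even ?oddE // scale1r IHk.
Qed.

Lemma eta_x1X k f : eta * (x1 ^+ k * f) = x1 ^+ k * (eta * f).
Proof.
elim: k => [|k IHk]; first by rewrite !mul1r.
by rewrite exprS -!mulrA x1E -gen_eta IHk.
Qed.

Lemma dgen_x1X y k f : y != e1 -> dgen y (x1 ^+ k * f) = x1 ^+ k * dgen y f.
Proof.
move=> ny; elim: k => [|k IHk]; first by rewrite !mul1r.
rewrite exprS -!mulrA x1E dgen_gen (negPf ny) scale0r add0r IHk.
by rewrite ssignC ssign_even ?oddE // scale1r.
Qed.

Lemma dgen1 y : dgen y 1 = 0.
Proof.
apply: oscP => S mu; rewrite osc0E mcoeff0.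
elim/index_case: y => i; rewrite ?coef_dgenx ?dgen_rshift ?dtheta1 ?osc0E ?mcoeff0 //.
rewrite ffunE; case: eqP => _; rewrite ?mcoeff0 ?mulr0 //.
by rewrite mcoeff1 mnmD_eq0 mnm1_eq0 andbF mulr0.
Qed.

Lemma dgen_x1 y k : y != e1 -> dgen y (x1 ^+ k) = 0.
Proof. by move=> ny; rewrite -[x1 ^+ k]mulr1 dgen_x1X // dgen1 mulr0. Qed.

Lemma dgen_e1_x1 k : dgen e1 (x1 ^+ k) = k%:R *: x1 ^+ k.-1.
Proof.
elim: k => [|k IHk]; first by rewrite dgen1 scale0r.
rewrite exprS {1}x1E dgen_gen eqxx scale1r IHk ssign_even ?oddE // scale1r -scalerAr.
case: k {IHk} => [|k]; first by rewrite scale0r addr0 scale1r.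
by rewrite -exprS -[in RHS]nat1r scalerDl scale1r.
Qed.

Lemma act_x1 X k : act X (x1 ^+ k) = k%:R *: \sum_y X y e1 *: (gen y * x1 ^+ k.-1).
Proof.
rewrite /Defs.act scaler_sumr; apply: eq_bigr => y _.
rewrite (bigD1 e1) //= big1 ?addr0 => [|z nz]; last by rewrite dgen_x1 // mulr0 scaler0.
by rewrite dgen_e1_x1 -scalerAr !scalerA mulrC.
Qed.

Lemma homogeneous_x1 k : homogeneous k%:Z (x1 ^+ k).
Proof.
elim: k => [|k IHk]; first exact: homogeneous1.
by rewrite exprS -addn1 PoszD; apply: homogeneous_gen.
Qed.

Lemma harmonic_x1 k : harmonic k%:Z (x1 ^+ k).
Proof.
split; first exact: homogeneous_x1.
rewrite /superDelta !big1 ?addr0 // => i _; rewrite [dgen _ (x1 ^+ k)]dgen_x1 ?linear0 ?indexE //.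
Qed.

Lemma x1XE k : x1 ^+ k = [ffun S => if S == set0 then 'X_[U_(lshift m1 i1) *+ k] else 0].
Proof.
elim: k => [|k IHk]; apply/ffunP => S.
  by rewrite !ffunE mulm0n mpolyX0; case: eqP.
rewrite exprS {1}x1E gen_lshift xvarME IHk !ffunE mulmS mpolyXD.
by case: eqP; rewrite ?mulr0.
Qed.

Lemma ell_x1 k : ell k (x1 ^+ k) = 1.
Proof. by rewrite /ell x1XE ffunE eqxx mcoeffX eqxx. Qed.

Lemma x1X_neq0 k : x1 ^+ k != 0.
Proof.
apply/eqP => e; have := ell_x1 k; rewrite e linear0 => /esym/eqP.
by rewrite oner_eq0.
Qed.

Lemma cartan_col y H : H \in cartan K m1 n -> y != e1 -> H y e1 = 0.
Proof.
move=> hH ny.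
(* The condition is the kernel of a linear map, so it need only be tested on the spanning
   vectors. *)
suff : H \in lker (linfun (row' e1 \o col e1 : 'M[K]_dim -> 'cV[K]_dim.-1)).
  rewrite memv_ker lfunE /= => /eqP/matrixP.
  have [j ->] : {j | y = lift e1 j} by case: (unliftP e1 y) ny => [j ->|->]; [exists j|rewrite eqxx].
  by move/(_ j ord0); rewrite !mxE.
apply: subvP hH; rewrite subv_add; apply/andP.
split; apply/subv_sumP => i _; rewrite -memvE memv_ker lfunE /=; apply/eqP/matrixP => j l; rewrite !mxE.
  case: (eqVneq e1 (xl i)) => [<-|_]; last by rewrite indexE !andbF subrr.
  by rewrite [lift _ _ == e1]eq_sym (negPf (neq_lift _ _)) indexE andbF subrr.
by rewrite !indexE !andbF subrr.
Qed.

Lemma osp_pos_col X y : X \in osp_pos K m1 n -> X y e1 = 0.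
Proof.
move=> hX; suff : X \in lker (linfun (col e1 : 'M[K]_dim -> 'cV[K]_dim)).
  by rewrite memv_ker lfunE /= => /eqP/matrixP/(_ y ord0); rewrite !mxE.
have nlt (i j : 'I_m1) : (i < j)%N -> (i1 == j) = false.
  by case: eqP => // <-.
apply: subvP hX; rewrite !subv_add -!andbA; apply/and4P.
split; apply/subv_sumP => i _; apply/subv_sumP => j hij; rewrite ?subv_add -?memvE ?memv_ker ?lfunE /=.
- by apply/andP; split; apply/eqP/matrixP => a b; rewrite !mxE !indexE ?(nlt _ _ hij) !andbF subrr.
- by apply/eqP/matrixP => a b; rewrite !mxE !indexE !andbF subrr.
- by apply/eqP/matrixP => a b; rewrite !mxE !indexE !andbF addr0.
by apply/andP; split; apply/eqP/matrixP => a b; rewrite !mxE !indexE !andbF ?subrr ?addr0.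
Qed.

Lemma highest_weight_x1 k :
  highest_weight_vector (fun X : 'M[K]_dim => k%:R * lambda1 m1_gt0 X) (x1 ^+ k).
Proof.
split; first exact: x1X_neq0.
- move=> H hH; rewrite act_x1 -scalerA.
  rewrite (bigD1 e1) //= big1 ?addr0 => [|y ny]; last by rewrite cartan_col // scale0r.
  case: k => [|k]; first by rewrite !scale0r.
  by rewrite -exprS.
- move=> X hX; rewrite act_x1 big1 ?scaler0 // => y _.
  by rewrite osp_pos_col // scale0r.
Qed.

Definition weight_shift (a : int) f := act (osp_elt e1) f - a%:~R *: f.

Lemma coef_weight_shift a f S mu :
  ((weight_shift a f : A) S)@_mu =
  ((mu (lshift m1 i1))%:Z - (mu (rshift m1 i1))%:Z - a)%:~R * (f S)@_mu.
Proof.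
rewrite /weight_shift act_osp_elt dualE dsignE scale1r !oscDE !oscNE oscZE.
rewrite !mcoeffB mcoeffZ !coef_gen_dgen !splitE -!mulrBl; congr (_ * _).
by rewrite !rmorphB.
Qed.

Lemma coef_weight_shifts (s : seq int) f S mu :
  ((foldr weight_shift f s : A) S)@_mu =
  (\prod_(a <- s) ((mu (lshift m1 i1))%:Z - (mu (rshift m1 i1))%:Z - a)%:~R) * (f S)@_mu.
Proof.
elim: s => [|a s IHs] /=; first by rewrite big_nil mul1r.
by rewrite coef_weight_shift IHs big_cons mulrA.
Qed.

(** Let h be [osp_elt e1]. On monomials of degree k its eigenvalues lie between -k and k, and k is
    attained only by x_1^k. The product of the operators h - a over the other possible values a
    therefore maps v to a nonzero multiple of x_1^k. *)
Lemma submodule_x1 k V : submodule V -> (forall f, V f -> homogeneous k%:Z f) ->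
  (exists2 v, V v & ell k v != 0) -> V (x1 ^+ k).
Proof.
move=> [V0 VD Vact] Vk [v Vv lv].
(* The values -k, ..., k - 1, that is, all possible weights except k. *)
pose s := [seq j%:Z - k%:Z | j <- iota 0 (2 * k)].
have VZ a f : V f -> V (a *: f) by move=> Vf; rewrite -[_ *: _]addr0; apply: VD.
have Vs : V (foldr weight_shift v s).
  elim: s => //= a s IHs; rewrite /weight_shift addrC -scaleNr; apply: VD => //.
  exact/Vact/IHs/osp_osp_elt.
pose C : K := \prod_(a <- s) (k%:Z - a)%:~R.
have C0 : C != 0.
  rewrite prodf_seq_neq0; apply/allP => a /mapP[j]; rewrite mem_iota intr_eq0 => hj ->.
  by apply/eqP; lia.
suff e : foldr weight_shift v s = (C * ell k v) *: x1 ^+ k.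
  rewrite e in Vs; have := VZ (C * ell k v)^-1 _ Vs.
  by rewrite scalerA mulVf ?scale1r // mulf_neq0.
apply: oscP => S mu; rewrite coef_weight_shifts oscZE mcoeffZ x1XE ffunE.
have /homogeneousP hv := Vk _ Vv.
have [z|nz] := eqVneq (v S)@_mu 0.
  rewrite z mulr0; case: (eqVneq S set0) z => [->|_]; last by rewrite mcoeff0 mulr0.
  rewrite mcoeffX; case: eqP => [<-|_]; last by rewrite mulr0.
  by rewrite -/(ell k v) => ->; rewrite mulr0 mul0r.
have [/eqP] := hv _ _ nz; rewrite mdegE (bigD1 (lshift m1 i1)) //=.
rewrite (bigD1 (rshift m1 i1)) /=; last by rewrite eq_rlshift.
set a := mu (lshift m1 i1); set b := mu (rshift m1 i1); set c := \sum_(i < _ | _) _ => /eqP ek.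
have [ak|nak] := eqVneq (a%:Z - b%:Z) k%:Z; last first.
  rewrite (big_rem (a%:Z - b%:Z)) /=; last first.
    apply/mapP; exists (a + k - b)%N; last by lia.
    by rewrite mem_iota; move/eqP: nak; lia.
  rewrite subrr !mul0r; case: (eqVneq S set0) => [_|_]; last by rewrite mcoeff0 mulr0.
  rewrite mcoeffX; case: eqP => [e|_]; last by rewrite mulr0.
  move/eqP: nak; rewrite /a /b -e !mulmnE !mnm1E eqxx eq_lrshift /=; lia.
rewrite ak -/C -!mulrA; congr (_ * _).
have [b0 c0 S0'] : [/\ b = 0%N, c = 0%N & #|S| = 0%N].
  by move: ek ak; clearbody a b c; move: #|S| => t ek ak; split; lia.
have S0 : S = set0 by apply/eqP; rewrite -cards_eq0 S0'.
have mue : mu = (U_(lshift m1 i1) *+ k)%MM.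
  apply/mnmP => j; rewrite mulmnE mnm1E; case: eqP => [<-|/eqP nj].
    by rewrite mul1n -/a; move: ak; rewrite b0; lia.
  rewrite mul0n; have [->|nj'] := eqVneq j (rshift m1 i1); first by rewrite -/b b0.
  move: c0; rewrite /c => /eqP; rewrite sum_nat_eq0 => /forallP /(_ j).
  by rewrite eq_sym nj nj' => /eqP.
by rewrite S0 eqxx mue mcoeffX eqxx mulr1.
Qed.

End HighestWeight.

(** * Submodules not containing x_1^k *)

Section ConeCase.
Variables (K : numFieldType) (m1 n : nat).
Hypothesis m1_gt0 : (0 < m1)%N.
Local Notation dim := ((m1 + m1) + (n + n))%N.
Local Notation A := (oscA K m1 n).
Local Notation gen := (@Defs.gen K m1 n).
Local Notation dgen := (@Defs.dgen K m1 n).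
Local Notation eta := (@Defs.eta K m1 n).
Local Notation xl := (@Defs.xl m1 n).
Local Notation xr := (@Defs.xr m1 n).
Local Notation tl := (@Defs.tl m1 n).
Local Notation tr := (@Defs.tr m1 n).
Local Notation act := (@Defs.act K m1 n).
Local Notation homogeneous := (@Defs.homogeneous K m1 n).
Local Notation submodule := (@Defs.submodule K m1 n).
Local Notation i1 := (ifirst m1_gt0).
Local Notation e1 := (xl i1).
Local Notation r1 := (xr i1).
Local Notation x1 := (@Defs.x1 K m1 n m1_gt0).
Local Notation ell := (@ell K m1 n m1_gt0).
Local Notation osp_elt := (@osp_elt K m1 n m1_gt0).
Implicit Types (f g h v r : A) (y z w : 'I_dim) (V : A -> Prop).
Implicit Types (S : {set 'I_(n + n)}) (mu : 'X_{1.. m1 + m1}).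

Definition eta_rest f : A :=
  \sum_(i | i != i1) gen (xl i) * (gen (xr i) * f) + \sum_p gen (tl p) * (gen (tr p) * f).

Lemma eta_split f : eta * f = gen e1 * (gen r1 * f) + eta_rest f.
Proof. by rewrite etaM (bigD1 i1) //= addrA. Qed.

Lemma dgen_r1_gen y f : y != r1 -> dgen r1 f = 0 -> dgen r1 (gen y * f) = 0.
Proof.
by move=> ny e; rewrite dgen_gen eq_sym (negPf ny) e mulr0 scaler0 scale0r addr0.
Qed.

Lemma dgen_r1_eta_rest f : dgen r1 f = 0 -> dgen r1 (eta_rest f) = 0.
Proof.
move=> e; rewrite /eta_rest linearD !linear_sum /= !big1 ?addr0 // => i ni.
  by rewrite !dgen_r1_gen // indexE.
by rewrite !dgen_r1_gen // !indexE.
Qed.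

(* After inverting x_1, the quotient by eta is freely generated by the        *)
(* variables other than the partner of x_1.                                   *)
Lemma eta_normal_form f :
  exists N r g, [/\ x1 ^+ N * f = r + eta * g & dgen r1 r = 0].
Proof.
elim/(@osc_ind K m1 n): f => [|a f g [N [r [h [e d]]]] [N' [r' [h' [e' d']]]]||y f [N [r [g [e d]]]]].
- by exists 0%N, 0, 0; rewrite !mulr0 addr0 linear0.
- exists (N + N')%N, (a *: (x1 ^+ N' * r) + x1 ^+ N * r'), (a *: (x1 ^+ N' * h) + x1 ^+ N * h').
  split; last by rewrite linearD linearZ /= !dgen_x1X ?indexE // d d' !mulr0 scaler0 addr0.
  rewrite mulrDr -scalerAr {1}addnC !exprD -!mulrA e e'.
  rewrite [in RHS]mulrDr -!scalerAr !eta_x1X !mulrDr scalerDr.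
  by rewrite addrACA.
- by exists 0%N, 1, 0; rewrite mulr0 mulr1 addr0 expr0 dgen1.
have [->|ny] := eqVneq y r1.
  exists N.+1, (- eta_rest r), (r + gen r1 * (gen e1 * g)); split.
    rewrite -gen_x1X exprS -[x1 * _ * f]mulrA e [x1 * _]mulrDr mulrDr.
    rewrite mulrDr [eta * r]eta_split gen_gen ssign_even ?oddE // scale1r.
    by rewrite [RHS]addrA [- _ + _]addrC addrK x1E !gen_eta.
  by rewrite linearN /= dgen_r1_eta_rest // oppr0.
exists N, (gen y * r), (gen y * g); split; last exact: dgen_r1_gen.
by rewrite -gen_x1X e mulrDr gen_eta.
Qed.

(** In characteristic 0, an element killed by all derivations other than that of x_1 is a polynomial
    in x_1 alone. *)
Lemma dgen_all_eq0 f : (forall y, y != e1 -> dgen y f = 0) -> (forall k, ell k f = 0) -> f = 0.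
Proof.
move=> hd hl; apply: oscP => S mu; rewrite osc0E mcoeff0.
have [S0|[p pS]] := set_0Vmem S; last first.
  have /ffunP /(_ (S :\ p)) := hd (rshift _ p) (negbT (eq_rlshift _ _)).
  rewrite coef_dgentheta !inE eqxx /= setD1K // osc0E => /mpolyP /(_ mu) /eqP.
  by rewrite mcoeff_signM mcoeff0 mulf_eq0 signr_eq0 => /eqP.
have [e|] := eqVneq mu (U_(lshift m1 i1) *+ mu (lshift m1 i1))%MM.
  by rewrite e S0; apply: hl.
move=> ne; have [j nj hj] : exists2 j, j != lshift m1 i1 & (0 < mu j)%N.
  apply/exists_inP; apply: contraR ne; rewrite negb_exists => /forallP h.
  apply/eqP/mnmP => j; rewrite mulmnE mnm1E; case: eqP => [<-|/eqP nj]; first by rewrite mul1n.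
  by have := h j; rewrite eq_sym nj /= lt0n negbK => /eqP.
have le : (U_(j) <= mu)%MM.
  by apply/mnm_lepP => j'; rewrite mnm1E; case: eqP => // <-.
have nj' : lshift (n + n) j != e1 by rewrite eq_lshift.
have /ffunP /(_ S) := hd _ nj'.
rewrite osc0E => /mpolyP /(_ (mu - U_(j))%MM) /eqP.
by rewrite coef_dgenx mcoeff0 submK // mulf_eq0 pnatr_eq0 => /eqP.
Qed.

Definition degree_lt d f := forall S mu, (f S)@_mu != 0 -> (mdeg mu + #|S| < d)%N.

Lemma degree_lt_dgen d y f : degree_lt d.+1 f -> degree_lt d (dgen y f).
Proof.
move=> hf S mu; elim/index_case: y => i; rewrite ?coef_dgenx ?coef_dgentheta.
  by rewrite mulf_eq0 => /norP[_ /hf]; rewrite mdegD mdeg1 addn1 addSn ltnS.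
case: ifP => iS; first by rewrite mcoeff0 eqxx.
rewrite mcoeff_signM mulf_eq0 => /norP[_ /hf].
by rewrite cardsU1 iS add1n addnS ltnS.
Qed.

Lemma degree_lt_ex f : exists d, degree_lt d f.
Proof.
exists ((\max_S msize (f S)) + (n + n).+1)%N => S mu nz.
rewrite -addSn; apply: leq_add; last by apply: leqW; rewrite -[X in (_ <= X)%N]card_ord max_card.
apply: leq_trans (leq_bigmax S); apply: msize_mdeg_lt.
by rewrite mcoeff_msupp.
Qed.

Lemma act_osp_elt_eta y f : act (osp_elt y) (eta * f) = eta * act (osp_elt y) f.
Proof. by apply: act_eta; apply: osp_osp_elt. Qed.

Lemma act_osp_elt_x1X y k f : y != e1 -> y != r1 ->
  act (osp_elt y) (x1 ^+ k * f) = x1 ^+ k * act (osp_elt y) f.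
Proof.
move=> ny nr; rewrite !act_osp_elt !dgen_x1X ?indexE // !gen_x1X.
by rewrite scalerAr -mulrBr.
Qed.

Lemma ell_x1X k N f : ell (k + N) (x1 ^+ N * f) = ell k f.
Proof.
elim: N => [|N IHN]; first by rewrite addn0 mul1r.
by rewrite exprS -mulrA x1E addnS ell_gen_e1 IHN.
Qed.

Lemma ell_x1X_lt k N f : (k < N)%N -> ell k (x1 ^+ N * f) = 0.
Proof.
elim: N k => // N IHN [|k] hk; rewrite exprS -mulrA x1E; first exact: ell0_gen_e1.
by rewrite ell_gen_e1 IHN.
Qed.

Section Submodule.
Variables (V : A -> Prop) (k : nat).
Hypotheses (Vsub : submodule V) (Vk : forall f, V f -> homogeneous k%:Z f).
Hypothesis V_ell : forall f, V f -> ell k f = 0.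

Lemma ell_submodule_eq0 j f : V f -> ell j f = 0.
Proof.
move=> Vf; have [->|nj] := eqVneq j k; first exact: V_ell.
exact: ell_homogeneous (Vk Vf) nj.
Qed.

(** Induction on the degree of r. Applying [osp_elt y] to the equation keeps its shape, with v
    replaced by an element of V, t by t + 1 and r by d_y r, because r does not involve the partner
    of x_1. So these derivatives of r vanish by induction. The coefficients of r on the powers of
    x_1 also vanish: [ell] kills multiples of eta and elements of V. *)
Lemma normal_form_eq0 r v N t g : V v -> x1 ^+ N * v = x1 ^+ t * r + eta * g ->
  dgen r1 r = 0 -> r = 0.
Proof.
have [d] := degree_lt_ex r.
elim: d => [|d IHd] in r v t g * => hd Vv e dr.
  apply: oscP => S mu; rewrite osc0E mcoeff0; apply/eqP/negPn/negP => /hd.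
  by rewrite ltn0.
apply: dgen_all_eq0 => [y ny|j].
  have [->//|nr] := eqVneq y r1.
  apply: (IHd _ (act (osp_elt y) v) t.+1 (act (osp_elt y) g)).
  - exact: degree_lt_dgen.
  - by case: Vsub => _ _; apply => //; apply: osp_osp_elt.
  - rewrite -act_osp_elt_x1X // e linearD /= act_osp_elt_eta act_osp_elt_x1X //.
    by rewrite [act _ r]act_osp_elt dr mulr0 scaler0 subr0 exprSr -mulrA.
  - by rewrite dgen_dgen dr linear0 scaler0.
have := congr1 (ell (j + t)) e; rewrite linearD /= ell_eta addr0 ell_x1X => <-.
have [lt|le] := ltnP (j + t) N; first exact: ell_x1X_lt.
by rewrite -(subnK le) ell_x1X ell_submodule_eq0.
Qed.

Lemma submodule_x1X_eta v : V v -> exists N g, x1 ^+ N * v = eta * g.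
Proof.
move=> Vv; have [N [r [g [e dr]]]] := eta_normal_form v; exists N, g.
rewrite e (@normal_form_eq0 r v N 0 g) ?add0r //.
by rewrite mul1r.
Qed.

End Submodule.

Definition mpoly_at0 (i : 'I_(m1 + m1)) (P : {mpoly K[m1 + m1]}) : {mpoly K[m1 + m1]} :=
  \sum_(mu <- msupp P | mu i == 0%N) P@_mu *: 'X_[mu].

Lemma mcoeff_at0 i P mu : (mpoly_at0 i P)@_mu = if mu i == 0%N then P@_mu else 0.
Proof.
rewrite /mpoly_at0 big_mkcond raddf_sum /=.
under eq_bigr => nu _ do rewrite (fun_if (mcoeff mu)) mcoeffZ mcoeffX mcoeff0.
case: (boolP (mu \in msupp P)) => h; last first.
  rewrite (memN_msupp_eq0 h) if_same big1_seq // => nu /andP[_ hnu].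
  by case: (nu =P mu) h => [<-|_ _]; rewrite ?hnu ?mulr0 ?if_same.
rewrite (bigD1_seq mu) ?msupp_uniq //= eqxx mulr1 big1 ?addr0 // => nu /negPf ->.
by rewrite mulr0 if_same.
Qed.

(** The substitution x_1 = 0, whose kernel is the ideal generated by x_1 ([at0_eq0]). *)
Definition at0 f : A := [ffun S => mpoly_at0 (lshift m1 i1) (f S)].

Lemma coef_at0 f S mu :
  (at0 f S)@_mu = if mu (lshift m1 i1) == 0%N then (f S)@_mu else 0.
Proof. by rewrite ffunE mcoeff_at0. Qed.

Lemma at0_linear : linear at0.
Proof.
move=> a f g; apply: oscP => S mu; rewrite !(coef_at0, oscDE, oscZE, mcoeffD, mcoeffZ).
by case: ifP; rewrite ?mulr0 ?addr0.
Qed.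

HB.instance Definition _ := GRing.isLinear.Build K A A *:%R at0 at0_linear.

Lemma at0_gen y f : y != e1 -> at0 (gen y * f) = gen y * at0 f.
Proof.
move=> ny; apply: oscP => S mu; rewrite coef_at0; elim/index_case: y ny => i ny.
  rewrite !coef_genx coef_at0 mnmBE mnm1E.
  have -> : (i == lshift m1 i1) = false.
    by apply: contraNF ny => /eqP ->.
  by rewrite subn0; case: ifP => //; rewrite if_same.
rewrite !coef_gentheta; case: ifP; case: ifP => h h'; rewrite ?mcoeff0 // !mcoeff_signM coef_at0 h' ?mulr0 //.
Qed.

Lemma at0_gen_e1 f : at0 (gen e1 * f) = 0.
Proof.
apply: oscP => S mu; rewrite coef_at0 coef_genx osc0E mcoeff0.
by case: eqP => // ->.
Qed.

Lemma at0_eq0 f : at0 f = 0 -> exists g, f = gen e1 * g.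
Proof.
move=> e; pose g : A := [ffun S => \sum_(mu <- msupp (f S)) (f S)@_mu *: 'X_[mu - U_(lshift m1 i1)]].
exists g; apply/ffunP => S; rewrite gen_lshift xvarME ffunE mulr_sumr {1}[f S]mpolyE.
apply: eq_big_seq => mu hmu; rewrite -scalerAr -mpolyXD addmC submK //.
have := congr1 (fun h : A => (h S)@_mu) e.
rewrite coef_at0 osc0E mcoeff0; case: ifP => [_ /eqP|hi _].
  by rewrite mcoeff_eq0 hmu.
by apply/mnm_lepP => j'; rewrite mnm1E; case: eqP => // <-; rewrite lt0n hi.
Qed.

Hypothesis m1_gt1 : (1 < m1)%N.

(** Modulo x_1, eta becomes [eta_rest], which for m1 > 1 still contains a commuting pair and so is
    not a zero divisor. Hence g is divisible by x_1, and x_1 cancels. For m1 = 1 only the nilpotent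
    theta part would remain. *)
Lemma x1_eta_regular f g : x1 * f = eta * g -> exists g', f = eta * g'.
Proof.
rewrite x1E => e; have := congr1 at0 e; rewrite at0_gen_e1 eta_split linearD /= at0_gen_e1 add0r.
rewrite /eta_rest linearD !linear_sum /= => e0.
have g0 : at0 g = 0.
  apply: (@partial_eta_inj K m1 n [pred i | i != i1] (Ordinal m1_gt1)) => //.
  rewrite [RHS]e0; apply: congrD; apply: eq_bigr => i ni.
    by rewrite !at0_gen // !indexE.
  by rewrite !at0_gen // !indexE.
have [g' eg] := at0_eq0 g0; exists g'; apply/eqP; rewrite -subr_eq0; apply/eqP.
have : gen e1 * (f - eta * g') = 0 by rewrite mulrBr e eg gen_eta subrr.
move=> h; apply: oscP => S mu.
have := congr1 (fun h : A => (h S)@_(mu + U_(lshift m1 i1))) h.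
by rewrite coef_genx mnmDE mnm1E eqxx addn1 addmK !osc0E !mcoeff0.
Qed.

Lemma x1X_eta_regular N f g : x1 ^+ N * f = eta * g -> exists g', f = eta * g'.
Proof.
elim: N g => [|N IHN] g; first by rewrite mul1r => ->; exists g.
by rewrite exprS -mulrA => /x1_eta_regular[g' /IHN].
Qed.

Lemma submodule_eta k V : submodule V -> (forall f, V f -> homogeneous k%:Z f) ->
  (forall f, V f -> ell k f = 0) ->
  forall f, V f -> mulspace eta (homogeneous (k%:Z - 2)) f.
Proof.
move=> Vsub Vk Vell f Vf; have [N [g e]] := submodule_x1X_eta Vsub Vk Vell Vf.
have [g' eg] := x1X_eta_regular e; exists g' => //.
by apply: (homogeneous_etaK m1_gt0); rewrite -eg; apply: Vk.
Qed.

End ConeCase.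

(** * Submodules of H_k for k <= c, by induction through first derivatives *)

Section LowDegree.
Variables (K : numFieldType) (m1 n : nat).
Hypothesis m1_gt0 : (0 < m1)%N.
Hypothesis n_gt0 : (0 < n)%N.
Local Notation dim := ((m1 + m1) + (n + n))%N.
Local Notation A := (oscA K m1 n).
Local Notation gen := (@Defs.gen K m1 n).
Local Notation dgen := (@Defs.dgen K m1 n).
Local Notation Delta := (@Defs.superDelta K m1 n).
Local Notation xl := (@Defs.xl m1 n).
Local Notation xr := (@Defs.xr m1 n).
Local Notation tl := (@Defs.tl m1 n).
Local Notation tr := (@Defs.tr m1 n).
Local Notation act := (@Defs.act K m1 n).
Local Notation homogeneous := (@Defs.homogeneous K m1 n).
Local Notation harmonic := (@Defs.harmonic K m1 n).
Local Notation submodule := (@Defs.submodule K m1 n).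
Local Notation dsign := (@dsign K m1 n).
Local Notation ssign := (@ssign K m1 n).
Local Notation i1 := (ifirst m1_gt0).
Local Notation e1 := (xl i1).
Local Notation r1 := (xr i1).
Local Notation ell := (@ell K m1 n m1_gt0).
Local Notation osp_elt := (@osp_elt K m1 n m1_gt0).
Local Notation c := (n%:Z - m1%:Z + 1).
Implicit Types (f g h v : A) (y z w : 'I_dim) (V : A -> Prop) (X : 'M[K]_dim).

(** Passing an odd derivation through X changes the sign of the odd blocks of X; for even y nothing
    changes. *)
Definition mxtwist y X : 'M[K]_dim := \matrix_(a, b) (ssign y a * ssign y b * X a b).

Lemma osp_mxtwist y X : osp X -> osp (mxtwist y X).
Proof.
move=> /osp_skew_osp sk; apply: osp_of_skew => a b; rewrite /osp_form !mxE.
have sd z : ssign y (dual z) = ssign y z by apply: ssign_odd; rewrite odd_dual.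
rewrite !sd -[_ * X b (dual a) * _]mulrA -[_ * X a (dual b) * _]mulrA.
by rewrite -!/(osp_form X _ _) (sk a b); ring.
Qed.

Lemma act_dgen X y v : act X (dgen y v) =
  dgen y (act (mxtwist y X) v) - \sum_z (ssign y y * ssign y z * X y z) *: dgen z v.
Proof.
apply/esym/eqP; rewrite subr_eq; apply/eqP.
rewrite /Defs.act !linear_sum /=.
under eq_bigr => a _ do rewrite linear_sum /=.
rewrite -[\sum_z (_ * _) *: _](@sum_delta K A _ y (fun a => \sum_z (ssign y a * ssign y z * X a z) *: dgen z v)).
rewrite -big_split; apply: eq_bigr => a _ /=.
rewrite scaler_sumr -big_split; apply: eq_bigr => b _ /=.
rewrite linearZ /= mxE dgen_gen dgen_dgen -scalerAr !scalerA scalerDr addrC.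
rewrite !scalerA; apply: congrD; first by rewrite mulrC.
have -> // : ssign y a * ssign y b * X a b * (ssign y a * ssign y b) = X a b.
transitivity ((ssign y a * ssign y a) * (ssign y b * ssign y b) * X a b); first by ring.
by rewrite !ssignMM !mul1r.
Qed.

Lemma Delta_dgen y f : Delta (dgen y f) = dgen y (Delta f).
Proof.
have comm z w g : odd_index z = odd_index w ->
    dgen z (dgen w (dgen y g)) = dgen y (dgen z (dgen w g)).
  move=> e; rewrite [dgen w _]dgen_dgen linearZ /= dgen_dgen scalerA.
  by rewrite [ssign w y]ssignC [ssign z y]ssignC (ssign_odd _ _ e) ssignMM scale1r.
rewrite /superDelta linearD !linear_sum /=; apply: congrD; apply: eq_bigr => i _.
  by rewrite comm // !oddE.
by rewrite comm // !oddE.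
Qed.

Section Derivatives.
Variables (V : A -> Prop) (k : nat).
Hypotheses (Vsub : submodule V) (Vharm : forall f, V f -> harmonic k.+1%:Z f).
Hypothesis V_ell : forall f, V f -> ell k.+1 f = 0.

Definition derivatives : A -> Prop :=
  fun f => exists2 v_ : 'I_dim -> A, forall y, V (v_ y) & f = \sum_y dgen y (v_ y).

Lemma submoduleD f g : V f -> V g -> V (f + g).
Proof. by case: Vsub => _ VD _ Vf Vg; rewrite -[f]scale1r; apply: VD. Qed.

Lemma submoduleZ a f : V f -> V (a *: f).
Proof. by case: Vsub => V0 VD _ Vf; rewrite -[_ *: _]addr0; apply: VD. Qed.

Lemma submodule_sum (I : finType) (F : I -> A) : (forall i, V (F i)) -> V (\sum_i F i).
Proof.
move=> VF; apply: (big_ind V) => //; first by case: Vsub.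
by move=> f g; apply: submoduleD.
Qed.

Lemma submodule_act X f : osp X -> V f -> V (act X f).
Proof. by case: Vsub => _ _; apply. Qed.

Lemma submodule_derivatives : submodule derivatives.
Proof.
split.
- exists (fun _ => 0); first by case: Vsub.
  by rewrite big1 // => y _; rewrite linear0.
- move=> a _ _ [v Vv ->] [w Vw ->]; exists (fun y => a *: v y + w y).
    by move=> y; apply/submoduleD/Vw/submoduleZ/Vv.
  by rewrite scaler_sumr -big_split; apply: eq_bigr => y _; rewrite linearP.
move=> X _ oX [v Vv ->]; rewrite linear_sum /=.
exists (fun z => act (mxtwist z X) (v z) - \sum_y (ssign y y * ssign y z * X y z) *: v y).
  move=> z; apply: submoduleD; first by apply: submodule_act => //; apply: osp_mxtwist.
  by rewrite -scaleN1r; apply/submoduleZ/submodule_sum => y; apply: submoduleZ.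
under eq_bigr => y _ do rewrite act_dgen.
under [RHS]eq_bigr => y _ do rewrite linearB /=.
rewrite !sumrB; apply: congrD => //; congr (- _); rewrite exchange_big.
by apply: eq_bigr => z _ /=; rewrite linear_sum; apply: eq_bigr => y _; rewrite linearZ.
Qed.

Lemma harmonic_derivatives f : derivatives f -> harmonic k%:Z f.
Proof.
case=> v Vv ->; split.
  apply: homogeneous_sum => y _; apply: (@homogeneous_eq _ _ _ (k.+1%:Z - 1)); first by lia.
  by apply: homogeneous_dgen; case: (Vharm (Vv y)).
by rewrite linear_sum big1 //= => y _; rewrite Delta_dgen; case: (Vharm (Vv y)) => _ ->; rewrite linear0.
Qed.

(** Apply [V_ell] to the action of [osp_elt y] on v: its first term is x_1 d_y v, and [ell] ignores
    the second, a multiple of a variable other than x_1. *)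
Lemma ell_dgen_generic y v : V v -> y != e1 -> y != r1 -> ell k (dgen y v) = 0.
Proof.
move=> Vv ny nr; have := V_ell (submodule_act (osp_osp_elt K m1_gt0 y) Vv).
rewrite act_osp_elt linearB linearZ /= ell_gen_e1 ell_gen ?mulr0 ?subr0 //.
by rewrite (can2_eq (@dualK _ _) (@dualK _ _)) dualE.
Qed.

(** This is [ell_dgen_generic] in direction [dual y] for the action of [osp_elt y] on v. The
    derivation hits the variable [dual y] in the second term, which produces the right-hand side. *)
Lemma ell_dgen2 y v : V v -> y != e1 -> y != r1 ->
  ell k (gen e1 * dgen (dual y) (dgen y v)) = dsign y * ell k (dgen r1 v).
Proof.
move=> Vv ny nr.
have dy : dual y != e1 by rewrite (can2_eq (@dualK _ _) (@dualK _ _)) dualE.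
have dr : dual y != r1 by rewrite (can2_eq (@dualK _ _) (@dualK _ _)) dualE.
have := ell_dgen_generic (submodule_act (osp_osp_elt K m1_gt0 y) Vv) dy dr.
rewrite act_osp_elt linearB linearZ /= !dgen_gen (negPf dy) eqxx scale0r add0r scale1r.
rewrite ssignC ssign_even ?oddE // scale1r linearB linearZ linearD linearZ /=.
rewrite [ell k (gen (dual y) * _)]ell_gen // !mulr0 addr0 => /eqP.
by rewrite subr_eq0 => /eqP.
Qed.

(** By [ell_dgen2], each pair of variables other than the first contributes plus or minus the same
    number x = ell k (d_(r1) v) to the coefficient of x_1^(k-1) in Delta v, and the first pair
    contributes k x. Since Delta v = 0, this gives (k + m1 - 1 - n) x = 0, and the scalar is
    negative when k + 1 <= c. *)
Lemma ell_dgen_r1 v : k.+1%:Z <= c -> V v -> ell k (dgen r1 v) = 0.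
Proof.
move=> hk Vv; have [_ D0] := Vharm Vv; move: hk (fun y => @ell_dgen2 y v Vv).
case: k => [|j] hk h.
  (* For k = 0 there is no power of x_1 to lower; one theta suffices, since a multiple of x_1 has
     constant term 0. *)
  have := h (tl (Ordinal n_gt0)); rewrite !indexE ell0_gen_e1 dsignE mul1r => -> //.
have hx i : i != i1 -> ell j (dgen (xl i) (dgen (xr i) v)) = ell j.+1 (dgen r1 v).
  move=> ni; have := h (xr i); rewrite !indexE dualE dsignE ell_gen_e1 mul1r; apply => //.
have ht p : ell j (dgen (tl p) (dgen (tr p) v)) = - ell j.+1 (dgen r1 v).
  have := h (tr p); rewrite !indexE dualE dsignE ell_gen_e1 mulN1r; apply => //.
have := congr1 (ell j) D0.
rewrite linear0 /superDelta linearD !linear_sum /= (bigD1 i1) //= ell_dgen_e1.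
under eq_bigr => i ni do rewrite hx //.
under [X in _ + X]eq_bigr => p _ do rewrite ht.
rewrite sumr_const [X in _ + X]sumr_const card_ord.
have -> : #|[pred i : 'I_m1 | i != i1]| = m1.-1.
  by have := cardC1 i1; rewrite card_ord => <-; apply: eq_card => i; rewrite !inE.
set x := ell j.+1 _ => e.
have : (j.+1%:Z + m1.-1%:Z - n%:Z)%:~R * x = 0.
  rewrite -[RHS]e rmorphB rmorphD /= -!pmulrn -mulr_natl -[X in _ = _ + X]mulr_natl.
  by ring.
move/eqP; rewrite mulf_eq0 intr_eq0 => /orP[/eqP|/eqP //]; lia.
Qed.

Lemma ell_derivatives f : k.+1%:Z <= c -> derivatives f -> ell k f = 0.
Proof.
move=> hk [v Vv ->]; rewrite linear_sum big1 //= => y _.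
have [->|ny] := eqVneq y e1; first by rewrite ell_dgen_e1 V_ell ?mulr0.
have [->|nr] := eqVneq y r1; first exact: ell_dgen_r1.
exact: ell_dgen_generic.
Qed.

End Derivatives.

Lemma submodule_harmonic_eq0 k V : k%:Z <= c -> submodule V ->
  (forall f, V f -> harmonic k%:Z f) -> (forall f, V f -> ell k f = 0) ->
  forall f, V f -> f = 0.
Proof.
elim: k V => [|k IHk] V hk Vsub Vharm Vell f Vf.
  have [/homogeneousP hf _] := Vharm _ Vf; apply: oscP => S mu; rewrite osc0E mcoeff0.
  apply/eqP/negPn/negP => nz; have := hf _ _ nz; case=> /eqP.
  rewrite addn_eq0 mdeg_eq0 cards_eq0 => /andP[/eqP emu /eqP eS].
  by have := Vell _ Vf; rewrite ell0E -emu -eS => /eqP; rewrite (negPf nz).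
have hk' : k%:Z <= c by lia.
have d0 y : dgen y f = 0.
  apply: (IHk (derivatives V)) => //.
  - exact: submodule_derivatives.
  - exact: harmonic_derivatives.
  - by move=> w; apply: ell_derivatives.
  exists (fun z => (y == z)%:R *: f); first by move=> z; apply: submoduleZ.
  by rewrite (bigD1 y) //= eqxx scale1r big1 ?addr0 // => z; rewrite eq_sym => /negPf ->; rewrite scale0r linear0.
(* All derivatives of f vanish, so Euler's identity gives (k + 1) f = 0. *)
have [hf _] := Vharm _ Vf; have := euler_homogeneous hf.
rewrite /euler big1 => [/esym/eqP|y _]; last by rewrite d0 mulr0.
by rewrite scaler_eq0 intr_eq0 => /eqP.
Qed.

End LowDegree.

(** U is only a predicate, so a matrix M of maximal rank with row space inside U is chosen
    classically. Maximality makes U the row space of M, and some column of [cokermx M] does not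
    annihilate x. *)
Lemma subspace_functional (K : fieldType) N (U : 'rV[K]_N -> Prop) x :
  U 0 -> (forall a u v, U u -> U v -> U (a *: u + v)) -> ~ U x ->
  exists2 u : 'cV[K]_N, forall v, U v -> v *m u = 0 & x *m u != 0.
Proof.
move=> U0 UD nUx.
pose P r := `[< exists2 M : 'M[K]_N, \rank M = r & forall v, (v <= M)%MS -> U v >].
have exP : exists r, P r.
  by exists 0%N; apply/asboolP; exists 0; rewrite ?mxrank0 // => v; rewrite submx0 => /eqP ->.
have ubP r : P r -> (r <= N)%N by move=> /asboolP[M <- _]; apply: rank_leq_row.
case: (ex_maxnP exP ubP) => r /asboolP[M rM MU] maxr.
have UM v : U v -> (v <= M)%MS.
  move=> Uv; apply: contraT => nvM.
  have : P (\rank (M + v)%MS).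
    apply/asboolP; exists (M + v)%MS => // w /sub_addsmxP[[a b] /= ->].
    rewrite -[a *m M]scale1r addrC [b]mx11_scalar mul_scalar_mx.
    by apply: UD => //; rewrite scale1r; apply/MU/submxMl.
  move=> /maxr; rewrite leqNgt -rM => /negP[].
  rewrite ltn_neqAle mxrankS ?addsmxSl // andbT.
  apply: contra nvM => /eqP e; apply: submx_trans (addsmxSr M v) _.
  by have := mxrank_leqif_sup (addsmxSl M v) => /leqifP; rewrite e ltnn; case: ifP.
have : x *m cokermx M != 0 by rewrite -submxE; apply/negP => /MU.
case/matrix0Pn => i [j hij].
have e v : v *m col j (cokermx M) = col j (v *m cokermx M).
  by apply/matrixP => a b; rewrite !mxE; apply: eq_bigr => l _; rewrite mxE.
exists (col j (cokermx M)) => [v /UM|].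
  by rewrite submxE e => /eqP ->; apply/matrixP => a b; rewrite !mxE.
rewrite e; apply: contraNneq hij => /matrixP/(_ i ord0).
by rewrite !mxE => ->.
Qed.

(** * Orthogonal submodules, irreducibility and the composition series *)

Section Irreducibility.
Variables (K : numClosedFieldType) (m1 n : nat).
Hypotheses (m1_gt0 : (0 < m1)%N) (n_gt0 : (0 < n)%N).
Local Notation dim := ((m1 + m1) + (n + n))%N.
Local Notation A := (oscA K m1 n).
Local Notation eta := (@Defs.eta K m1 n).
Local Notation Delta := (@Defs.superDelta K m1 n).
Local Notation act := (@Defs.act K m1 n).
Local Notation homogeneous := (@Defs.homogeneous K m1 n).
Local Notation harmonic := (@Defs.harmonic K m1 n).
Local Notation submodule := (@Defs.submodule K m1 n).
Local Notation monom := (@monom K m1 n).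
Local Notation x1 := (@Defs.x1 K m1 n m1_gt0).
Local Notation ell := (@ell K m1 n m1_gt0).
Local Notation form := (@form K m1 n).
Local Notation c := (n%:Z - m1%:Z + 1).
Implicit Types (f g h v : A) (V : A -> Prop) (X : 'M[K]_dim) (k : nat).
Implicit Types (S : {set 'I_(n + n)}) (mu : 'X_{1.. m1 + m1}).

Definition perp k V : A -> Prop :=
  fun g => homogeneous k%:Z g /\ forall v, V v -> form v g = 0.

Lemma homogeneous_monom k S mu : (mdeg mu + #|S|)%N = k -> homogeneous k%:Z (monom S mu).
Proof.
move=> e; apply/homogeneousP => T nu; rewrite coef_monom pnatr_eq0 eqb0 negbK.
by move=> /andP[/eqP -> /eqP <-]; rewrite e.
Qed.

(** Degree k is finite-dimensional. In monomial coordinates, a functional that vanishes on V but not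
    at f is represented, through the form, by an element g of degree k. *)
Lemma double_perp k V f :
  V 0 -> (forall a u v, V u -> V v -> V (a *: u + v)) ->
  (forall v, V v -> homogeneous k%:Z v) -> homogeneous k%:Z f ->
  (forall g, perp k V g -> form f g = 0) -> V f.
Proof.
move=> V0 VD Vk hf orth; have [//|nVf] := EM (V f); exfalso.
pose N := #|{: {set 'I_(n + n)} * bmultinom (m1 + m1) k.+1}|.
pose ix (j : 'I_N) : {set 'I_(n + n)} * bmultinom (m1 + m1) k.+1 := enum_val j.
pose phi (v : A) : 'rV[K]_N := \row_j (v (ix j).1)@_(ix j).2.
have phiP a u v : phi (a *: u + v) = a *: phi u + phi v.
  by apply/rowP => j; rewrite !mxE oscDE oscZE mcoeffD mcoeffZ.
have phi_inj u v : homogeneous k%:Z u -> homogeneous k%:Z v -> phi u = phi v -> u = v.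
  move=> hu hv e; apply/eqP; rewrite -subr_eq0; apply/eqP/oscP => S mu; rewrite osc0E mcoeff0.
  have /homogeneousP huv := homogeneousB hu hv.
  have [//|nz] := eqVneq ((u - v : A) S)@_mu 0; have [deg] := huv _ _ nz.
  have lt : (mdeg mu < k.+1)%N by rewrite ltnS -deg leq_addr.
  have := congr1 (fun M : 'rV_N => M ord0 (enum_rank (S, BMultinom lt))) e.
  by rewrite !mxE /ix enum_rankK /= oscDE oscNE mcoeffB => ->; rewrite subrr.
have [|| |u uV uf] := @subspace_functional K N (fun w => exists2 v, V v & w = phi v) (phi f).
- by exists 0 => //; apply/rowP => j; rewrite !mxE osc0E mcoeff0.
- move=> a _ _ [v Vv ->] [w Vw ->]; exists (a *: v + w); last by rewrite phiP.
  exact: VD.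
- move=> [v Vv /(phi_inj _ _ hf (Vk _ Vv)) e]; apply: nVf; by rewrite e.
(* The value of the form on a monomial paired with itself; dividing by it turns the functional u
   into the element g. *)
pose wt (j : 'I_N) : K := 'i ^+ #|(ix j).1| * (mfact (ix j).2)%:R.
have wt0 j : wt j != 0.
  by rewrite mulf_neq0 ?mfact_neq0 // expf_neq0 // neq0Ci.
pose deg (j : 'I_N) := (mdeg (ix j).2 + #|(ix j).1|)%N.
pose g := \sum_(j | deg j == k) (u j ord0 / wt j) *: monom (ix j).1 (ix j).2.
have formg v : homogeneous k%:Z v -> form v g = (phi v *m u) ord0 ord0.
  move=> /homogeneousP hv; rewrite linear_sum !mxE [RHS](bigID (fun j => deg j == k)) /=.
  rewrite [X in _ + X]big1 ?addr0 => [|j /eqP nj].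
    apply: eq_bigr => j _; rewrite linearZ /= formC form_monom mxE.
    by rewrite ['i ^+ _ * _]mulrA -/(wt j) mulrA divfK // mulrC.
  rewrite mxE; have [->|nz] := eqVneq (v (ix j).1)@_(ix j).2 0.
    by rewrite mul0r.
  by case: nj; have [] := hv _ _ nz.
case/eqP: uf; apply/matrixP => a b; rewrite !ord1 [RHS]mxE -formg // orth //; split.
  by apply: homogeneous_sum => j /eqP hj; apply/homogeneousZ/homogeneous_monom.
move=> v Vv; rewrite formg; last exact: Vk.
by rewrite uV ?mxE //; exists v.
Qed.

Lemma submodule_perp k V : submodule V -> submodule (perp k V).
Proof.
move=> [V0 VD Vact]; split.
- split; first exact: homogeneous0.
  by move=> v _; rewrite linear0.
- move=> a f g [hf pf] [hg pg]; split; first exact/homogeneousD/hg/homogeneousZ.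
  by move=> v Vv; rewrite linearP /= pf // pg // mulr0 addr0.
move=> X f oX [hf pf]; split; first exact: homogeneous_act.
move=> v Vv; rewrite formC form_act formC; apply: pf.
exact/Vact/Vv/osp_mxadj.
Qed.

Lemma submodule_eta_of_ell k V : (1 < m1)%N || (k%:Z <= c) -> submodule V ->
  (forall f, V f -> harmonic k%:Z f) -> (forall f, V f -> ell k f = 0) ->
  forall f, V f -> mulspace eta (homogeneous (k%:Z - 2)) f.
Proof.
case/orP => hk Vsub Vh Vell f Vf.
  by apply: (submodule_eta (m1_gt0 := m1_gt0) hk Vsub _ Vell Vf) => g /Vh[].
rewrite (submodule_harmonic_eq0 n_gt0 hk Vsub Vh Vell Vf); exists 0; last by rewrite mulr0.
exact: homogeneous0.
Qed.

(** The orthogonal of V is a submodule by contravariance, and orthogonality to x_1^k says that [ell]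
    vanishes on it. For m1 > 1 this is enough. For k <= c the vanishing result concerns harmonic
    elements only: write g = h + eta g'. The second term is orthogonal to the harmonic V, hence so
    is h, and h = 0. *)
Lemma perp_eta k V g : (1 < m1)%N || (k%:Z <= c) -> submodule V ->
  (forall f, V f -> harmonic k%:Z f) -> V (x1 ^+ k) -> perp k V g ->
  mulspace eta (homogeneous (k%:Z - 2)) g.
Proof.
move=> hk Vsub Vh Vx pg; have Psub := submodule_perp k Vsub.
have Pell f : perp k V f -> ell k f = 0.
  move=> [hf /(_ _ Vx)].
  have -> : x1 ^+ k = monom set0 (U_(lshift m1 (ifirst m1_gt0)) *+ k)%MM by rewrite x1XE.
  exact: form_monom_eq0.
case/orP: hk => hk.
  by apply: (submodule_eta (m1_gt0 := m1_gt0) hk Psub _ Pell pg) => f [].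
have nc : (2 * c < k%:Z) || (k%:Z <= c) by rewrite hk orbT.
have [/(_ g) [/(_ pg.1)[h [_ [[hh Dh] [g' hg' ->] eg]]] _] _] := @harmonic_direct_sum K m1 n m1_gt0 _ nc.
suff h0 : h = 0 by exists g' => //; rewrite eg h0 add0r.
have Ph : perp k V h.
  split=> // v Vv; have := pg.2 v Vv; rewrite eg linearD /= -form_Delta.
  by case: (Vh _ Vv) => _ ->; rewrite form0l addr0.
apply: (@submodule_harmonic_eq0 K m1 n m1_gt0 n_gt0 k (fun f => perp k V f /\ harmonic k%:Z f)) => //.
- split.
  + by split; [case: Psub | split; [exact: homogeneous0 | rewrite linear0]].
  + move=> a f f' [Pf [hf Df]] [Pf' [hf' Df']]; split; first by case: Psub => _ PD _; apply: PD.
    split; first exact/homogeneousD/hf'/homogeneousZ.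
    by rewrite linearP /= Df Df' scaler0 addr0.
  + move=> X f oX [Pf [hf Df]]; split; first by case: Psub => _ _; apply.
    split; first exact: homogeneous_act.
    by rewrite -act_Delta // Df linear0.
- by move=> f [].
- by move=> f [/Pell].
Qed.

Lemma x1_generates k V : (1 < m1)%N || (k%:Z <= c) -> submodule V ->
  (forall f, V f -> harmonic k%:Z f) -> V (x1 ^+ k) ->
  forall f, harmonic k%:Z f -> V f.
Proof.
move=> hk Vsub Vh Vx f [hf Df]; have [V0 VD _] := Vsub.
apply: (@double_perp k V) => // [v /Vh[] //|g pg].
by have [g' _ ->] := perp_eta hk Vsub Vh Vx pg; rewrite -form_Delta Df form0l.
Qed.

Lemma submodule_dichotomy k V : (1 < m1)%N || (k%:Z <= c) -> submodule V ->
  (forall f, V f -> harmonic k%:Z f) ->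
  (forall f, V f -> mulspace eta (homogeneous (k%:Z - 2)) f) \/
  (forall f, harmonic k%:Z f -> V f).
Proof.
move=> hk Vsub Vh; have [ex|nex] := EM (exists2 v, V v & ell k v != 0).
  right; apply: x1_generates => //.
  by apply: (submodule_x1 Vsub _ ex) => f /Vh[].
left; apply: submodule_eta_of_ell => // f Vf.
by apply/eqP/negPn/negP => nz; apply: nex; exists f.
Qed.

Lemma submodule_harmonic (k : int) : submodule (harmonic k).
Proof.
split.
- by split; [exact: homogeneous0 | rewrite linear0].
- move=> a f g [hf Df] [hg Dg]; split; first exact/homogeneousD/hg/homogeneousZ.
  by rewrite linearP /= Df Dg scaler0 addr0.
move=> X f oX [hf Df]; split; first exact: homogeneous_act.
by rewrite -act_Delta // Df linear0.
Qed.

Lemma irreducible_harmonic k : (1 < m1)%N || (k%:Z <= c) ->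
  (2 * c < k%:Z) || (k%:Z <= c) -> irreducible_module (harmonic k%:Z).
Proof.
move=> hk nc; split; first exact: submodule_harmonic.
  by exists (x1 ^+ k); [exact: harmonic_x1 | exact: x1X_neq0].
move=> V Vsub Vh; have [Ve|] := submodule_dichotomy hk Vsub Vh; last by right.
by left=> f Vf; apply: (harmonic_eta_eq0 m1_gt0 nc (Vh _ Vf)); apply: Ve.
Qed.

Lemma act_etaX X s f : osp X -> act X (eta ^+ s * f) = eta ^+ s * act X f.
Proof.
move=> oX; elim: s => [|s IHs]; first by rewrite !mul1r.
by rewrite exprS -[eta * _ * f]mulrA (act_eta _ oX) IHs mulrA.
Qed.

Lemma submodule_mulspace s V : submodule V -> submodule (mulspace (eta ^+ s) V).
Proof.
move=> [V0 VD Vact]; split.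
- by exists 0; rewrite ?mulr0.
- move=> a _ _ [f Vf ->] [g Vg ->]; exists (a *: f + g); first exact: VD.
  by rewrite mulrDr scalerAr.
move=> X _ oX [f Vf ->]; exists (act X f); first exact: Vact.
by rewrite act_etaX.
Qed.

Section Critical.
Variable k : nat.
Hypothesis hk : c < k%:Z <= 2 * c.
Local Notation W := (mulspace (eta ^+ `|k%:Z - c|%N) (harmonic (2 * c - k%:Z))).

Lemma critical_harmonic f : W f -> harmonic k%:Z f.
Proof. by move=> [g hg ->]; apply: harmonic_etaX_crit => //; case/andP: hk. Qed.

Lemma critical_strict : strict_subspace W (harmonic k%:Z).
Proof.
split; first exact: critical_harmonic.
exists (x1 ^+ k); first exact: harmonic_x1.
(* Elements of W are multiples of eta, as k - c > 0, so [ell] vanishes on them, while its value at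
   x_1^k is 1. *)
move=> [g _ e]; have := ell_x1 K n m1_gt0 k; rewrite e.
have -> : `|k%:Z - c|%N = `|k%:Z - c|%N.-1.+1 by case/andP: hk => h1 _; lia.
by rewrite exprS -mulrA ell_eta => /esym/eqP; rewrite oner_eq0.
Qed.

Lemma critical_of_eta f : harmonic k%:Z f -> mulspace eta (homogeneous (k%:Z - 2)) f -> W f.
Proof. by case/andP: hk => hk1 _; apply: harmonic_eta_crit. Qed.

Lemma submodule_critical : submodule W.
Proof. exact/submodule_mulspace/submodule_harmonic. Qed.

(** Multiplication by eta^(k-c) is injective and commutes with osp, so submodules of W pull back to
    submodules of H_(2c-k). That module is irreducible for every m1, because 2c - k < c. *)
Lemma irreducible_critical : irreducible_module W.
Proof.
have [d ed] : exists d : nat, 2 * c - k%:Z = d%:Z.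
  by exists (absz (2 * c - k%:Z)%R); case/andP: hk; lia.
have dc : d%:Z <= c by case/andP: hk; lia.
have dcs : (1 < m1)%N || (d%:Z <= c) by rewrite dc orbT.
have dcn : (2 * c < d%:Z) || (d%:Z <= c) by rewrite dc orbT.
have [Hsub [h0 hh0 nz0] Hirr] := irreducible_harmonic dcs dcn.
split; first exact: submodule_critical.
  exists (eta ^+ `|k%:Z - c|%N * h0); first by exists h0 => //; rewrite ed.
  by apply: contraNneq nz0 => /(etaX_inj m1_gt0) ->.
move=> V Vsub VW; have [V0 VD Vact] := Vsub.
pose U f := harmonic d%:Z f /\ V (eta ^+ `|k%:Z - c|%N * f).
have Usub : submodule U.
  have [H0 HD Hact] := Hsub; split.
  - by split; rewrite ?mulr0.
  - move=> a f g [hf Vf] [hg Vg]; split; first exact: HD.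
    by rewrite mulrDr -scalerAr; apply: VD.
  move=> X f oX [hf Vf]; split; first exact: Hact.
  by rewrite -act_etaX //; apply: Vact.
have [||U0|UH] := Hirr U => //; first by move=> f [].
- left=> f Vf; have [g] := VW _ Vf; rewrite ed => hg e; rewrite e.
  by rewrite (U0 g) ?mulr0 //; split=> //; rewrite -e.
- by right=> f [g]; rewrite ed => /UH[_ Vg] ->.
Qed.

Lemma harmonic_factor : (1 < m1)%N -> irreducible_factor (harmonic k%:Z) W.
Proof.
move=> m1_gt1; split.
- exact: submodule_harmonic.
- exact: submodule_critical.
- exact: critical_strict.
move=> V Vsub WV Vh; have [Ve|] := @submodule_dichotomy k V (introT orP (or_introl m1_gt1)) Vsub Vh; last by right.
by left=> f Vf; apply: critical_of_eta; [exact: Vh | exact: Ve].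
Qed.

Lemma critical_factor : irreducible_factor W (@zerospace K m1 n).
Proof.
have [Wsub [f Wf nz] Wirr] := irreducible_critical.
split=> //.
- split=> //; first by move=> a f' g -> ->; rewrite scaler0 addr0.
  by move=> X f' _ ->; rewrite /zerospace linear0.
- split; last by exists f => // /eqP; apply/negP.
  by move=> _ ->; case: Wsub.
by move=> V Vsub _ VW; apply: Wirr.
Qed.

End Critical.

End Irreducibility.

(** * The basis *)

Section XMonomials.
Variables (K : numFieldType) (m1 n : nat).
Local Notation dim := ((m1 + m1) + (n + n))%N.
Local Notation A := (oscA K m1 n).
Local Notation gen := (@Defs.gen K m1 n).
Local Notation dgen := (@Defs.dgen K m1 n).
Local Notation homogeneous := (@Defs.homogeneous K m1 n).
Local Notation monom := (@monom K m1 n).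
Implicit Types (f g h v : A) (y z : 'I_dim).
Implicit Types (S : {set 'I_(n + n)}) (mu nu : 'X_{1.. m1 + m1}).

Definition xmonom mu : A := monom set0 mu.

Lemma xmonomM mu f S : (xmonom mu * f : A) S = 'X_[mu] * f S.
Proof.
rewrite ffunE (bigD1 set0) ?sub0set //= big1 => [|T /andP[_ /negPf nT]].
  by rewrite ffunE eqxx setD0 ninv0s addr0 mul1r.
by rewrite ffunE nT mul0r mulr0.
Qed.

Lemma xmonom_monom mu S nu : xmonom mu * monom S nu = monom S (mu + nu).
Proof.
by apply/ffunP => T; rewrite xmonomM !ffunE mpolyXD; case: ifP; rewrite ?mulr0.
Qed.

Lemma xmonomD mu nu : xmonom mu * xmonom nu = xmonom (mu + nu).
Proof. exact: xmonom_monom. Qed.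

Lemma xmonom0 : xmonom 0%MM = 1.
Proof. exact: monom0. Qed.

Lemma gen_exp_xmonom i k : gen (lshift _ i) ^+ k = xmonom (U_(i) *+ k).
Proof.
elim: k => [|k IHk]; first by rewrite mulm0n xmonom0.
by rewrite exprS IHk genx_monom mulmS.
Qed.

Lemma xmonom_sum (I : Type) (r : seq I) (P : pred I) (F : I -> 'X_{1.. m1 + m1}) :
  \prod_(i <- r | P i) xmonom (F i) = xmonom (\sum_(i <- r | P i) F i)%MM.
Proof.
by apply/esym; apply: (big_morph xmonom _ xmonom0) => mu nu; rewrite xmonomD.
Qed.

Lemma coef_xmonomM mu f S nu :
  ((xmonom mu * f : A) S)@_nu = if (mu <= nu)%MM then (f S)@_(nu - mu) else 0.
Proof.
rewrite xmonomM mulrC; case: ifP => h.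
  by rewrite -{1}(submK h) addmC mcoeffMX.
apply: memN_msupp_eq0; rewrite (perm_mem (msuppMX _ _)).
apply/mapP => -[rho _ e]; move/negP: h; apply.
by apply/mnm_lepP => i; rewrite e mnmDE leq_addr.
Qed.

Lemma dgentheta_xmonomM p mu f :
  dgen (rshift _ p) (xmonom mu * f) = xmonom mu * dgen (rshift _ p) f.
Proof.
apply/ffunP => S; rewrite coef_dgentheta !xmonomM coef_dgentheta.
by case: ifP; rewrite ?mulr0 // mulrCA.
Qed.

Lemma dgenx_xmonomM i mu f : dgen (lshift _ i) f = 0 ->
  dgen (lshift _ i) (xmonom mu * f) = (mu i)%:R *: (xmonom (mu - U_(i))%MM * f).
Proof.
rewrite !dgen_lshift => e; apply/ffunP => S; rewrite oscZE ffunE !xmonomM mderivM mderivX.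
have /ffunP /(_ S) := e; rewrite ffunE osc0E => ->.
by rewrite mulr0 addr0 scalerAl.
Qed.

Lemma homogeneous_xmonomM k mu f : homogeneous k f -> homogeneous (k + (mdeg mu)%:Z) (xmonom mu * f).
Proof.
move=> /homogeneousP hf; apply/homogeneousP => S nu; rewrite coef_xmonomM.
case: ifP => [h /hf <-|_]; last by rewrite eqxx.
by rewrite -{1}(submK h) mdegD -PoszD addnAC.
Qed.

End XMonomials.

(** * Products of thetas, pair by pair, and their derivatives *)

Section ThetaProducts.
Variables (K : numFieldType) (m1 n : nat).
Local Notation dim := ((m1 + m1) + (n + n))%N.
Local Notation A := (oscA K m1 n).
Local Notation gen := (@Defs.gen K m1 n).
Local Notation dgen := (@Defs.dgen K m1 n).
Local Notation homogeneous := (@Defs.homogeneous K m1 n).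
Local Notation monom := (@monom K m1 n).
Local Notation tl := (@Defs.tl m1 n).
Local Notation tr := (@Defs.tr m1 n).
Variable beta : {ffun 'I_(n + n) -> bool}.
Local Notation bl p := (beta (lshift n p)).
Local Notation br p := (beta (rshift n p)).
Implicit Types (f g h v : A) (y z : 'I_dim) (j : 'I_n) (l : 'I_n -> bool) (s : seq 'I_n).

(** For e true, the scalar that the two derivations of pair j produce on its theta factor; the sign
    comes from moving the inner derivation past theta_j. *)
Definition tcoef j (e : bool) : K :=
  if e then (-1) ^+ bl j * (bl j)%:R * (br j)%:R else 1.

Definition tpair j (e : bool) : A :=
  gen (tl j) ^+ (bl j - e) * gen (tr j) ^+ (br j - e).

Definition tprod s l : A := \prod_(j <- s) tpair j (l j).

Definition tterm s l : A := \prod_(j <- s) (tcoef j (l j) *: tpair j (l j)).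

Lemma ttermE s l : tterm s l = (\prod_(j <- s) tcoef j (l j)) *: tprod s l.
Proof. exact: scaler_prod. Qed.

Lemma expr_bool_ind (Q : A -> Prop) (x : A) (b e : bool) f :
  Q f -> (Q f -> Q (x * f)) -> Q (x ^+ (b - e) * f).
Proof. by case: b; case: e => /= Qf Qx; rewrite ?mul1r ?expr1 //; apply: Qx. Qed.

Lemma tpair_ind (Q : A -> Prop) j e f :
  (forall f, Q f -> Q (gen (tl j) * f)) -> (forall f, Q f -> Q (gen (tr j) * f)) ->
  Q f -> Q (tpair j e * f).
Proof.
by move=> Ql Qr Qf; rewrite /tpair -mulrA; apply: expr_bool_ind => [|/Ql //]; apply: expr_bool_ind => // /Qr.
Qed.

Lemma dgenx_tprod i s l : dgen (lshift _ i) (tprod s l) = 0.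
Proof.
elim: s => [|j s IHs]; first by rewrite /tprod big_nil dgen1.
rewrite /tprod big_cons.
apply: (tpair_ind (Q := fun f => dgen (lshift (n + n) i) f = 0)) => // f e.
  by rewrite dgen_gen eq_lrshift e scale0r mulr0 scaler0 addr0.
by rewrite dgen_gen eq_lrshift e scale0r mulr0 scaler0 addr0.
Qed.

Lemma dgent_tprod j s l : j \notin s ->
  dgen (tl j) (tprod s l) = 0 /\ dgen (tr j) (tprod s l) = 0.
Proof.
elim: s => [|i s IHs]; first by rewrite /tprod big_nil !dgen1.
rewrite inE negb_or /tprod big_cons => /andP[nij /IHs IH].
apply: (tpair_ind (Q := fun f => dgen (tl j) f = 0 /\ dgen (tr j) f = 0)) => // f [e1 e2].
  by rewrite !dgen_gen !indexE (negPf nij) e1 e2 !scale0r !mulr0 !scaler0 addr0.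
by rewrite !dgen_gen !indexE (negPf nij) e1 e2 !scale0r !mulr0 !scaler0 addr0.
Qed.

Lemma dpair_tpair i j e f : j != i ->
  dgen (tl j) (dgen (tr j) (tpair i e * f)) = tpair i e * dgen (tl j) (dgen (tr j) f).
Proof.
move=> nij.
have H z h : z != tl j -> z != tr j -> odd_index z ->
    dgen (tl j) (dgen (tr j) (gen z * h)) = gen z * dgen (tl j) (dgen (tr j) h).
  move=> n1 n2 oz; have sg w : odd_index w -> ssign K w z = -1 by rewrite /ssign oz => ->.
  rewrite dgen_gen eq_sym (negPf n2) scale0r add0r linearZ /= dgen_gen.
  by rewrite eq_sym (negPf n1) scale0r add0r scalerA !sg ?oddE // mulrNN mulr1 scale1r.
have Hp z b h : z != tl j -> z != tr j -> odd_index z ->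
    dgen (tl j) (dgen (tr j) (gen z ^+ (b : bool) * h)) = gen z ^+ b * dgen (tl j) (dgen (tr j) h).
  by move=> n1 n2 oz; case: b; rewrite ?mul1r // !expr1; apply: H.
rewrite /tpair -!mulrA.
have -> : (bl i - e)%N = (bl i && ~~ e) by case: (bl i); case: e.
have -> : (br i - e)%N = (br i && ~~ e) by case: (br i); case: e.
by rewrite !Hp // ?indexE ?oddE // eq_sym.
Qed.

Lemma dpair_tpair_same j e f : dgen (tl j) f = 0 -> dgen (tr j) f = 0 ->
  dgen (tl j) (dgen (tr j) (tcoef j e *: tpair j e * f)) =
  if e then 0 else tcoef j true *: tpair j true * f.
Proof.
move=> el er; rewrite /tcoef /tpair -!scalerAl !linearZ /=.
have dtr b : dgen (tr j) (gen (tr j) ^+ (b : bool) * f) = b%:R *: f.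
  case: b; rewrite ?mul1r ?er ?scale0r // expr1 dgen_gen eqxx er mulr0 scaler0 addr0.
  by [].
have dtl b h : dgen (tr j) (gen (tl j) ^+ (b : bool) * h) = (-1) ^+ b *: (gen (tl j) ^+ b * dgen (tr j) h).
  case: b; rewrite ?mul1r ?scale1r // !expr1 dgen_gen indexE scale0r add0r.
  by rewrite /ssign !oddE.
have dtl' b : dgen (tl j) (gen (tl j) ^+ (b : bool) * f) = b%:R *: f.
  by case: b; rewrite ?mul1r ?el ?scale0r // expr1 dgen_gen eqxx el mulr0 scaler0 addr0.
have H (b b' : bool) : dgen (tl j) (dgen (tr j) (gen (tl j) ^+ b * gen (tr j) ^+ b' * f)) =
    ((-1) ^+ b * b%:R * b'%:R) *: f.
  by rewrite -mulrA dtl dtr -scalerAr !linearZ /= dtl' scalerA scalerA mulrAC.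
case: e.
  have -> : (bl j - true)%N = (bl j && false) by case: (bl j).
  have -> : (br j - true)%N = (br j && false) by case: (br j).
  by rewrite H !andbF mulr0 scale0r scaler0.
rewrite !subn0 H scale1r.
by case: (bl j); case: (br j); rewrite /= ?(mulr0, mul0r) ?scale0r // !expr0 !mul1r.
Qed.

Lemma tterm_cons j s l : tterm (j :: s) l = tcoef j (l j) *: tpair j (l j) * tterm s l.
Proof. by rewrite /tterm big_cons. Qed.

Lemma dgent_tterm j s l : j \notin s ->
  dgen (tl j) (tterm s l) = 0 /\ dgen (tr j) (tterm s l) = 0.
Proof.
by move=> js; rewrite ttermE !linearZ /=; have [-> ->] := dgent_tprod l js; rewrite scaler0.
Qed.

Lemma dpair_tterm j s l : uniq s -> j \in s ->
  dgen (tl j) (dgen (tr j) (tterm s l)) =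
  if l j then 0 else tterm s (fun i => (i == j) || l i).
Proof.
elim: s => // i s IHs /andP[ns us]; rewrite inE tterm_cons [in RHS]tterm_cons.
have [ej _|nij /= js] := eqVneq j i.
  rewrite -{}ej in ns *; have [e1 e2] := dgent_tterm l ns.
  have -> : tterm s (fun i => (i == j) || l i) = tterm s l.
    rewrite /tterm; apply: eq_big_seq => z zs.
    by have -> : (z == j) = false by apply: contraNF ns => /eqP <-.
  by rewrite dpair_tpair_same // eqxx.
rewrite -scalerAl !linearZ /= dpair_tpair // IHs //= -scalerAl.
by case: (l j); rewrite ?mulr0 ?scaler0.
Qed.

Lemma homogeneous_tprod s l :
  homogeneous (\sum_(j <- s) ((bl j - l j) + (br j - l j)))%N%:Z (tprod s l).
Proof.
elim: s => [|j s IHs]; first by rewrite /tprod !big_nil; apply: homogeneous1.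
rewrite /tprod !big_cons /tpair -mulrA.
have hb z k (b e : bool) f : homogeneous k%:Z f ->
    homogeneous ((b - e) + k)%N%:Z (gen z ^+ (b - e) * f).
  have -> : (b - e)%N = (b && ~~ e) by case: b; case: e.
  case: (b && ~~ e) => hf; last by rewrite mul1r.
  by rewrite expr1 addnC PoszD; apply: homogeneous_gen.
by rewrite -addnA; apply/hb/hb.
Qed.

Definition tset s : {set 'I_(n + n)} :=
  [set p | match split p with inl j => (j \in s) && bl j | inr j => (j \in s) && br j end].

Lemma gen_exp_monom p (b : bool) (e : K) (S : {set 'I_(n + n)}) : p \notin S -> e != 0 ->
  exists2 e' : K, e' != 0 & gen (rshift _ p) ^+ b * (e *: monom S 0%MM) =
    e' *: monom (if b then p |: S else S) 0%MM.
Proof.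
move=> pS e0; case: b; last by exists e; rewrite ?mul1r.
exists (e * (-1) ^+ ninv [set p] S); first by rewrite mulf_neq0 ?signr_eq0.
by rewrite expr1 -scalerAr gentheta_monom // scalerA.
Qed.

Lemma tprod_monom s : uniq s ->
  exists2 e : K, e != 0 & tprod s (fun=> false) = e *: monom (tset s) 0%MM.
Proof.
elim: s => [_|j s IHs /andP[js us]].
  exists 1; rewrite ?oner_neq0 // /tprod big_nil scale1r -monom0; congr (monom _ _).
  by apply/esym/setP => p; rewrite !inE; case: split.
have [e e0 E] := IHs us; rewrite /tprod big_cons -/(tprod s _) E /tpair !subn0 -mulrA.
have ns : rshift n j \notin tset s by rewrite inE splitE negb_and js.
have [e1 e10 ->] := gen_exp_monom (br j) ns e0.
set S := (if _ then _ else _).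
have nS : lshift n j \notin S.
  by rewrite /S; case: (br j); rewrite !inE ?eq_lrshift splitE negb_and js.
have [e2 e20 ->] := gen_exp_monom (bl j) nS e10.
exists e2 => //; congr (_ *: monom _ _); apply/setP => p.
rewrite /S; case: (split_ordP p) => i ->; have [eij|nij] := eqVneq i j.
- rewrite eij; case hb: (bl j); case hr: (br j);
    rewrite !inE ?eqxx ?eq_lrshift ?eq_lshift ?eq_rshift splitE ?inE ?eqxx ?hb ?hr ?andbF //=.
- case: (bl j); case: (br j) => /=;
    by rewrite !inE ?eq_lrshift ?eq_lshift ?(negPf nij) splitE ?inE ?(negPf nij).
- rewrite eij; case hb: (bl j); case hr: (br j);
    rewrite !inE ?eqxx ?eq_rlshift ?eq_lshift ?eq_rshift splitE ?inE ?eqxx ?hb ?hr ?andbF //=.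
- case: (bl j); case: (br j) => /=;
    by rewrite !inE ?eq_rlshift ?eq_rshift ?(negPf nij) splitE ?inE ?(negPf nij).
Qed.

End ThetaProducts.

(** * The explicit harmonic elements form a basis *)

Section HarmonicBasis.
Variables (K : numFieldType) (m1 n : nat).
Hypothesis m1_gt0 : (0 < m1)%N.
Local Notation dim := ((m1 + m1) + (n + n))%N.
Local Notation A := (oscA K m1 n).
Local Notation gen := (@Defs.gen K m1 n).
Local Notation dgen := (@Defs.dgen K m1 n).
Local Notation Delta := (@Defs.superDelta K m1 n).
Local Notation homogeneous := (@Defs.homogeneous K m1 n).
Local Notation harmonic := (@Defs.harmonic K m1 n).
Local Notation monom := (@monom K m1 n).
Local Notation xmonom := (@xmonom K m1 n).
Local Notation xl := (@Defs.xl m1 n).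
Local Notation xr := (@Defs.xr m1 n).
Local Notation tl := (@Defs.tl m1 n).
Local Notation tr := (@Defs.tr m1 n).
Local Notation last := (ilast m1_gt0).
Local Notation a := (lshift m1 last).
Local Notation b := (rshift m1 last).
Implicit Types (f g h v : A) (y z : 'I_dim) (S : {set 'I_(n + n)}) (mu nu : 'X_{1.. m1 + m1}).

(** Induction on the exponent of x_(m1). The equation Delta f = 0, read at mu divided by x_(m1) x_(2
    m1), expresses a nonzero multiple of the coefficient at mu through coefficients whose x_(m1)
    exponent is one less. *)
Lemma harmonic_uniq f : Delta f = 0 ->
  (forall S mu, (mu a * mu b = 0)%N -> (f S)@_mu = 0) -> f = 0.
Proof.
move=> D0 h0.
have H N : forall S mu, mu a = N -> (f S)@_mu = 0.
  elim: N => [|N IHN] S mu hN; first by apply: h0; rewrite hN.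
  have [hb|hb] := posnP (mu b); first by apply: h0; rewrite hb muln0.
  pose nu := (mu - (U_(a) + U_(b)))%MM.
  have le : (U_(a) + U_(b) <= mu)%MM.
    apply/mnm_lepP => i; rewrite mnmDE !mnm1E.
    have [<-|na] := eqVneq a i; first by rewrite eq_rlshift hN.
    by have [<-|nb] := eqVneq b i.
  have nua : nu a = N by rewrite mnmBE mnmDE !mnm1E eqxx eq_rlshift hN addn0 subn1.
  have := congr1 (fun g : A => (g S)@_nu) D0.
  rewrite /superDelta oscDE !osc_sumE mcoeffD !raddf_sum /= osc0E mcoeff0.
  rewrite [X in _ + X]big1 ?addr0 => [|p _]; last first.
    rewrite coef_dgentheta; case: ifP => _; first by rewrite mcoeff0.
    rewrite mcoeff_signM coef_dgentheta; case: ifP => _; first by rewrite mcoeff0 mulr0.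
    by rewrite mcoeff_signM IHN ?mulr0.
  rewrite (bigD1 last) //= big1 ?addr0 => [|i ni]; last first.
    rewrite !coef_dgenx IHN ?mulr0 // !mnmDE !mnm1E eq_lshift eq_rlshift (negPf ni) !addn0.
    exact: nua.
  rewrite !coef_dgenx -addmA submK // => /eqP.
  by rewrite !mulf_eq0 !pnatr_eq0 /= => /eqP.
by apply: oscP => S mu; rewrite osc0E mcoeff0; apply: H.
Qed.

Section Element.
Variables (alpha : {ffun 'I_(m1 + m1) -> nat}) (beta : {ffun 'I_(n + n) -> bool}).
Local Notation al i := (alpha (lshift m1 i)).
Local Notation ar i := (alpha (rshift m1 i)).
Implicit Types (r : 'I_m1 -> nat) (l : 'I_n -> bool) (M : nat).

Definition rest_exp r : 'X_{1.. m1 + m1} :=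
  (\sum_(i < m1 | i != last)
     (U_(lshift m1 i) *+ (al i - r i) + U_(rshift m1 i) *+ (ar i - r i)))%MM.

Definition term_exp M r : 'X_{1.. m1 + m1} :=
  (U_(a) *+ (al last + M) + U_(b) *+ (ar last + M) + rest_exp r)%MM.

Definition rest_coef r : K :=
  \prod_(i < m1 | i != last) ((r i)`! * 'C(al i, r i) * 'C(ar i, r i))%N%:R.

Definition last_coef M : K :=
  (al last)`!%:R * (ar last)`!%:R / ((al last + M)`! * (ar last + M)`!)%N%:R.

Local Notation theta_term l := (@tterm K m1 n beta (index_enum 'I_n) l).

(* The monomial obtained from the leading one by [M] integrations in the last *)
(* pair of variables and by the derivations counted by [r] and [l].           *)
Definition elt_term M r l : A :=
  (last_coef M * rest_coef r) *: (xmonom (term_exp M r) * theta_term l).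

Definition elt_count r l : nat := (\sum_(i < m1 | i != last) r i + \sum_(j < n) l j)%N.

Lemma rest_exp_lr r i (lr : bool) : i != last ->
  rest_exp r (if lr then rshift m1 i else lshift m1 i) =
  ((if lr then ar i else al i) - r i)%N.
Proof.
move=> ni; rewrite /rest_exp mnm_sumE (bigD1 i) //= big1 ?addn0 => [|j /andP[_ nj]].
  rewrite mnmDE !mulmnE !mnm1E; case: lr; rewrite ?eq_lrshift ?eq_rlshift eqxx /=.
    by rewrite mul0n mul1n.
  by rewrite mul0n mul1n addn0.
rewrite mnmDE !mulmnE !mnm1E.
by case: lr; rewrite ?eq_lshift ?eq_rshift ?eq_lrshift ?eq_rlshift (negPf nj).
Qed.

Lemma rest_exp_last r (lr : bool) : rest_exp r (if lr then b else a) = 0%N.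
Proof.
rewrite /rest_exp mnm_sumE big1 // => j nj; rewrite mnmDE !mulmnE !mnm1E.
by case: lr; rewrite ?eq_lshift ?eq_rshift ?eq_lrshift ?eq_rlshift (negPf nj).
Qed.

Lemma term_exp_a M r : term_exp M r a = (al last + M)%N.
Proof.
by rewrite !mnmDE !mulmnE !mnm1E (rest_exp_last r false) eqxx eq_rlshift mul1n mul0n !addn0.
Qed.

Lemma term_exp_b M r : term_exp M r b = (ar last + M)%N.
Proof.
by rewrite !mnmDE !mulmnE !mnm1E (rest_exp_last r true) eqxx eq_lrshift mul1n mul0n add0n addn0.
Qed.

Lemma term_exp_l M r i : i != last -> term_exp M r (lshift m1 i) = (al i - r i)%N.
Proof.
move=> ni; rewrite !mnmDE !mulmnE !mnm1E (rest_exp_lr r false ni) eq_lshift eq_rlshift.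
by rewrite eq_sym (negPf ni).
Qed.

Lemma term_exp_r M r i : i != last -> term_exp M r (rshift m1 i) = (ar i - r i)%N.
Proof.
move=> ni; rewrite !mnmDE !mulmnE !mnm1E (rest_exp_lr r true ni) eq_rshift eq_lrshift.
by rewrite eq_sym (negPf ni).
Qed.

Lemma term_expP M r mu :
  mu a = (al last + M)%N -> mu b = (ar last + M)%N ->
  (forall i, i != last -> mu (lshift m1 i) = (al i - r i)%N /\ mu (rshift m1 i) = (ar i - r i)%N) ->
  term_exp M r = mu.
Proof.
move=> ea eb ei; apply/mnmP => j; case: (split_ordP j) => i ->; have [->|ni] := eqVneq i last.
- by rewrite term_exp_a ea.
- by rewrite term_exp_l //; case: (ei _ ni).
- by rewrite term_exp_b eb.
- by rewrite term_exp_r //; case: (ei _ ni).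
Qed.

Lemma dgenx_theta_term i l : dgen (lshift _ i) (theta_term l) = 0.
Proof. by rewrite ttermE linearZ /= dgenx_tprod scaler0. Qed.

Lemma dgen2Z y z k f : dgen y (dgen z (k *: f)) = k *: dgen y (dgen z f).
Proof. by rewrite !linearZ. Qed.

Lemma dgenx2_xmonomM i i' mu l :
  dgen (lshift _ i) (dgen (lshift _ i') (xmonom mu * theta_term l)) =
  ((mu i')%:R * ((mu - U_(i'))%MM i)%:R) *: (xmonom (mu - U_(i') - U_(i))%MM * theta_term l).
Proof.
have d0 k : dgen (lshift (n + n) k) (theta_term l) = 0 by apply: dgenx_theta_term.
by rewrite (dgenx_xmonomM _ (d0 i')) linearZ /= (dgenx_xmonomM _ (d0 i)) scalerA.
Qed.

Lemma natr_fact_neq0 k : k`!%:R != 0 :> K.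
Proof. by rewrite pnatr_eq0 -lt0n fact_gt0. Qed.

Lemma dlast_elt_term M r l :
  dgen (xl last) (dgen (xr last) (elt_term M.+1 r l)) = elt_term M r l.
Proof.
rewrite /elt_term !linearZ /= dgenx2_xmonomM scalerA.
have xa : (term_exp M.+1 r - U_(b))%MM a = (al last + M.+1)%N.
  by rewrite mnmBE mnm1E eq_rlshift subn0 term_exp_a.
rewrite xa term_exp_b.
have -> : (term_exp M.+1 r - U_(b) - U_(a))%MM = term_exp M r.
  apply/esym/term_expP => [||i ni]; rewrite !mnmBE !mnm1E ?eqxx ?eq_rlshift ?eq_lrshift.
  - by rewrite subn0 term_exp_a addnS subn1.
  - by rewrite subn0 term_exp_b addnS subn1.
  - rewrite !eq_lshift !eq_rshift ![last == _]eq_sym (negPf ni) !subn0.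
    by rewrite term_exp_l // term_exp_r.
congr (_ *: _); rewrite /last_coef !addnS !factS !natrM.
have f1 := natr_fact_neq0 (al last + M); have f2 := natr_fact_neq0 (ar last + M).
have g1 : (al last + M).+1%:R != 0 :> K by rewrite pnatr_eq0.
have g2 : (ar last + M).+1%:R != 0 :> K by rewrite pnatr_eq0.
move: f1 f2 g1 g2; move: (_.+1%:R) (_.+1%:R) ((al last + M)`!%:R) ((ar last + M)`!%:R) => g2 g1 f1 f2.
by move=> h1 h2 h3 h4; field; rewrite h1 h2 h3 h4.
Qed.

Hypothesis alpha_last : (al last * ar last = 0)%N.

Lemma dlast_elt_term0 r l : dgen (xl last) (dgen (xr last) (elt_term 0 r l)) = 0.
Proof.
rewrite /elt_term !linearZ /= dgenx2_xmonomM mnmBE mnm1E eq_rlshift subn0.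
by rewrite term_exp_a term_exp_b !addn0 -natrM mulnC alpha_last scale0r scaler0.
Qed.

Definition incr r (i : 'I_m1) : 'I_m1 -> nat := fun j => (r j + (j == i))%N.

Lemma di_elt_term i M r l : i != last ->
  dgen (xl i) (dgen (xr i) (elt_term M r l)) = (r i).+1%:R *: elt_term M (incr r i) l.
Proof.
move=> ni; rewrite /elt_term !linearZ /= dgenx2_xmonomM !scalerA.
have xi : (term_exp M r - U_(rshift m1 i))%MM (lshift m1 i) = (al i - r i)%N.
  by rewrite mnmBE mnm1E eq_rlshift subn0 term_exp_l.
rewrite xi (term_exp_r _ _ ni).
have ec : rest_coef r * ((ar i - r i)%:R * (al i - r i)%:R) = (r i).+1%:R * rest_coef (incr r i).
  have ei : incr r i i = (r i).+1 by rewrite /incr eqxx addn1.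
  rewrite /rest_coef (bigD1 i) //= [in RHS](bigD1 i) //= ei.
  rewrite [X in _ = _ * (_ * X)](eq_bigr (fun j => ((r j)`! * 'C(al j, r j) * 'C(ar j, r j))%N%:R)); last first.
    by move=> j /andP[_ /negPf nj]; rewrite /incr nj addn0.
  set P := \prod_(_ | _) _.
  (* This is (r + 1) C(a, r + 1) = (a - r) C(a, r), used once for each variable of the pair. *)
  suff e : ((r i)`! * 'C(al i, r i) * 'C(ar i, r i) * ((ar i - r i) * (al i - r i)) =
            (r i).+1 * ((r i).+1`! * 'C(al i, (r i).+1) * 'C(ar i, (r i).+1)))%N.
    by rewrite mulrAC -!natrM e natrM mulrA.
  have e1 := mul_bin_left (al i) (r i); have e2 := mul_bin_left (ar i) (r i).
  rewrite factS; move: e1 e2; set B1 := 'C(_, _.+1); set B2 := 'C(_, _.+1) => e1 e2.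
  transitivity ((r i)`! * ((al i - r i) * 'C(al i, r i)) * ((ar i - r i) * 'C(ar i, r i)))%N; first by ring.
  by rewrite -e1 -e2; ring.
have [z|nz] := eqVneq ((ar i - r i)%:R * (al i - r i)%:R : K) 0.
  rewrite z mulr0 scale0r; move: ec; rewrite z mulr0 => /esym ec.
  by rewrite -mulrA [_ * _.+1%:R]mulrC ec mulr0 scale0r.
have -> : (term_exp M r - U_(rshift m1 i) - U_(lshift m1 i))%MM = term_exp M (incr r i).
  apply/esym/term_expP => [||j nj]; rewrite !mnmBE !mnm1E ?eq_lshift ?eq_rshift ?eq_rlshift ?eq_lrshift.
  - by rewrite (negPf ni) !subn0 term_exp_a.
  - by rewrite (negPf ni) !subn0 term_exp_b.
  by rewrite !subn0 term_exp_l // term_exp_r // /incr [j == i]eq_sym !subnDA.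
by rewrite -!mulrA ec [rest_coef (incr _ _) * _]mulrC.
Qed.

Lemma dj_elt_term j M r l :
  dgen (tl j) (dgen (tr j) (elt_term M r l)) =
  if l j then 0 else elt_term M r (fun i => (i == j) || l i).
Proof.
rewrite /elt_term !linearZ /= !dgentheta_xmonomM dpair_tterm ?index_enum_uniq ?mem_index_enum //.
by case: (l j); rewrite // mulr0 scaler0.
Qed.

Lemma rest_coef_eq0 r i : i != last -> (al i < r i)%N -> rest_coef r = 0.
Proof.
by move=> ni lt; rewrite /rest_coef (bigD1 i) //= bin_small // muln0 mul0n mul0r.
Qed.

Lemma elt_count_incr r l i : i != last -> elt_count (incr r i) l = (elt_count r l).+1.
Proof.
move=> ni; rewrite /elt_count -addSn; congr (_ + _)%N.
rewrite (bigD1 i) //= [in RHS](bigD1 i) //= {1}/incr eqxx addn1 addSn; congr (_ + _).+1.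
by apply: eq_bigr => j /andP[_ /negPf nj]; rewrite /incr nj addn0.
Qed.

Lemma elt_count_flip r l j : l j = false ->
  elt_count r (fun i => (i == j) || l i) = (elt_count r l).+1.
Proof.
move=> lj; rewrite /elt_count -addnS; congr (_ + _)%N.
rewrite (bigD1 j) //= [in RHS](bigD1 j) //= eqxx lj add0n add1n; congr _.+1.
by apply: eq_bigr => i /negPf ->.
Qed.

(* [elt_delta r l] is, up to the factor [elt_count r l], what the pair of     *)
(* last variables in Delta makes of the term of index [(r, l)].               *)
Definition elt_delta r l : A :=
  if elt_count r l is M.+1 then ((-1) ^+ M * M`!%:R) *: elt_term M r l else 0.

Definition signed_term r l : A :=
  ((-1) ^+ elt_count r l * (elt_count r l)`!%:R) *: elt_term (elt_count r l) r l.

Lemma dlast_signed_term r l :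
  dgen (xl last) (dgen (xr last) (signed_term r l)) =
  - (\sum_(i < m1 | i != last) (r i)%:R *: elt_delta r l
     + \sum_(j < n) (l j)%:R *: elt_delta r l).
Proof.
rewrite -!scaler_suml -scalerDl -!natr_sum -natrD -/(elt_count r l).
rewrite /signed_term /elt_delta dgen2Z; case: (elt_count r l) => [|M].
  by rewrite dlast_elt_term0 !scaler0 oppr0.
rewrite dlast_elt_term -scaleNr [RHS]scalerA; congr (_ *: _).
by rewrite exprS factS natrM; ring.
Qed.

Lemma di_signed_term i r l : i != last ->
  dgen (xl i) (dgen (xr i) (signed_term r l)) =
  (incr r i i)%:R *: elt_delta (incr r i) l.
Proof.
move=> ni; rewrite /signed_term /elt_delta dgen2Z di_elt_term; last exact: ni.
rewrite elt_count_incr; last exact: ni.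
have -> : incr r i i = (r i).+1 by rewrite /incr eqxx addn1.
by rewrite scalerA [RHS]scalerA [X in X *: _ = _]mulrC.
Qed.

Lemma dj_signed_term j r l :
  dgen (tl j) (dgen (tr j) (signed_term r l)) =
  if l j then 0 else elt_delta r (fun i => (i == j) || l i).
Proof.
rewrite /signed_term /elt_delta dgen2Z dj_elt_term.
case e: (l j); first by rewrite scaler0.
by rewrite elt_count_flip.
Qed.

Local Notation box := (\sum_i alpha i)%N.
Local Notation rfun := {ffun 'I_m1 -> 'I_box.+1}.
Local Notation lfun := {ffun 'I_n -> bool}.
Local Notation natf r := (fun i => nat_of_ord (r i)).

(** Incrementing moves the range 0, ..., box of r_i to 1, ..., box + 1. The cyclic successor makes
    this a bijection of the index set; the ranges differ only at the two ends, where [phi]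
    vanishes. *)
Lemma sum_shift (V : nmodType) i (phi : ('I_m1 -> nat) -> V) : i != last ->
  (forall r, r i = 0%N -> phi r = 0) -> (forall r, r i = box.+1 -> phi r = 0) ->
  \sum_(r : rfun | r last == ord0) phi (incr (natf r) i) =
  \sum_(r : rfun | r last == ord0) phi (natf r).
Proof.
move=> ni phi0 phi1.
pose h (r : rfun) : rfun := [ffun j => if j == i then ordS (r j) else r j].
pose h' (r : rfun) : rfun := [ffun j => if j == i then ord_pred (r j) else r j].
have hK : cancel h h' by move=> r; apply/ffunP => j; rewrite !ffunE; case: (j == i); rewrite ?ordSK.
have h'K : cancel h' h by move=> r; apply/ffunP => j; rewrite !ffunE; case: (j == i); rewrite ?ord_predK.
rewrite [RHS](reindex h) /=; last by exists h' => r _; [apply: hK | apply: h'K].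
apply: eq_big => [r|r _]; first by rewrite ffunE [last == i]eq_sym (negPf ni).
have [lt|ge] := ltnP (r i) box.
  congr phi; apply/funext => j; rewrite ffunE /incr.
  by case: eqP => [->|_]; rewrite ?addn0 //= addn1 modn_small // ltnS.
have eb : nat_of_ord (r i) = box.
  by apply/eqP; rewrite eqn_leq ge andbT -ltnS ltn_ord.
rewrite phi1 ?phi0 //; last by rewrite /incr eqxx addn1 eb.
by rewrite ffunE eqxx /= eb modnn.
Qed.

Lemma sum_flip (V : nmodType) j (phi : ('I_n -> bool) -> V) :
  \sum_(l : lfun) (if l j then 0 else phi (fun i => (i == j) || l i)) =
  \sum_(l : lfun) (if l j then phi l else 0).
Proof.
pose h (l : lfun) : lfun := [ffun i => if i == j then ~~ l i else l i].
have hK : involutive h.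
  by move=> l; apply/ffunP => i; rewrite !ffunE; case: (i == j); rewrite ?negbK.
rewrite [RHS](reindex_inj (inv_inj hK)); apply: eq_bigr => l _ /=.
rewrite ffunE eqxx; case e: (l j) => //=; congr phi; apply/funext => i.
by rewrite ffunE; case: eqP => [->|_] //=; rewrite e.
Qed.

Definition harmonic_sum : A :=
  \sum_(r : rfun | r last == ord0) \sum_(l : lfun) signed_term (natf r) l.

Lemma al_le_box i : (alpha i <= box)%N.
Proof. by rewrite (bigD1 i) //= leq_addr. Qed.

Lemma elt_delta_out r l i : i != last -> r i = box.+1 -> elt_delta r l = 0.
Proof.
move=> ni e; rewrite /elt_delta; case: elt_count => // M.
rewrite /elt_term (@rest_coef_eq0 r i) ?mulr0 ?scale0r ?scaler0 // e ltnS.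
exact: al_le_box.
Qed.

(** Telescoping. The last pair turns the term of index (r, l) into -N times [elt_delta r l], with N
    the sum of the r_i and l_j. After reindexing by [sum_shift] and [sum_flip], the pair i
    contributes r_i times [elt_delta r l] and the theta pair j contributes l_j times it, so
    everything cancels. *)
Lemma Delta_harmonic_sum : Delta harmonic_sum = 0.
Proof.
pose D z z' f := dgen z (dgen z' f).
have Dsum z z' : D z z' harmonic_sum =
    \sum_(r : rfun | r last == ord0) \sum_(l : lfun) D z z' (signed_term (natf r) l).
  rewrite /D /harmonic_sum !linear_sum; apply: eq_bigr => r _.
  by rewrite !linear_sum.
rewrite /superDelta (bigD1 last) //=.
have -> : dgen (xl last) (dgen (xr last) harmonic_sum) =
    - (\sum_(r : rfun | r last == ord0) \sum_(l : lfun)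
         \sum_(i < m1 | i != last) (r i : nat)%:R *: elt_delta (natf r) l
       + \sum_(r : rfun | r last == ord0) \sum_(l : lfun)
         \sum_(j < n) (l j)%:R *: elt_delta (natf r) l).
  rewrite -/(D _ _ _) Dsum -big_split -sumrN; apply: eq_bigr => r _.
  rewrite -big_split -sumrN; apply: eq_bigr => l _; exact: dlast_signed_term.
have -> : \sum_(i < m1 | i != last) dgen (xl i) (dgen (xr i) harmonic_sum) =
    \sum_(r : rfun | r last == ord0) \sum_(l : lfun)
      \sum_(i < m1 | i != last) (r i : nat)%:R *: elt_delta (natf r) l.
  under [RHS]eq_bigr => r _ do rewrite exchange_big /=.
  rewrite [RHS]exchange_big /=; apply: eq_bigr => i ni.
  rewrite -/(D _ _ _) Dsum /D.
  transitivity (\sum_(r : rfun | r last == ord0) \sum_(l : lfun)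
      (incr (natf r) i i)%:R *: elt_delta (incr (natf r) i) l).
    by apply: eq_bigr => r _; apply: eq_bigr => l _; apply: di_signed_term.
  apply: (@sum_shift _ i (fun r => \sum_(l : lfun) (r i)%:R *: elt_delta r l)) => // r e.
    by rewrite big1 // => l _; rewrite e scale0r.
  by rewrite big1 // => l _; rewrite (elt_delta_out _ ni e) scaler0.
have -> : \sum_(j < n) dgen (tl j) (dgen (tr j) harmonic_sum) =
    \sum_(r : rfun | r last == ord0) \sum_(l : lfun)
      \sum_(j < n) (l j)%:R *: elt_delta (natf r) l.
  under [RHS]eq_bigr => r _ do rewrite exchange_big /=.
  rewrite [RHS]exchange_big /=; apply: eq_bigr => j _.
  rewrite -/(D _ _ _) Dsum /D; apply: eq_bigr => r _.
  transitivity (\sum_(l : lfun) if l j then 0 else elt_delta (natf r) (fun i => (i == j) || l i)).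
    by apply: eq_bigr => l _; apply: dj_signed_term.
  rewrite (sum_flip j (fun l => elt_delta (natf r) l)); apply: eq_bigr => l _.
  by case: (l j); rewrite ?scale1r ?scale0r.
by rewrite -addrA addNr.
Qed.

Lemma xmonom_term_exp M r :
  xmonom (term_exp M r) =
  gen (xl last) ^+ (al last + M) * gen (xr last) ^+ (ar last + M)
  * \prod_(i < m1 | i != last) (gen (xl i) ^+ (al i - r i) * gen (xr i) ^+ (ar i - r i)).
Proof.
rewrite /term_exp /rest_exp -xmonomD -xmonomD -xmonom_sum /Defs.xl /Defs.xr !gen_exp_xmonom.
by congr (_ * _); apply: eq_bigr => i _; rewrite !gen_exp_xmonom xmonomD.
Qed.

Lemma harmonic_eltE : harmonic_elt K m1_gt0 (alpha, beta) = harmonic_sum.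
Proof.
apply: eq_bigr => r _; apply: eq_bigr => l _ /=.
rewrite /signed_term /elt_term ttermE -scalerAr !scalerA xmonom_term_exp.
apply: (f_equal2 ( *:%R)); last by [].
rewrite -/(elt_count (natf r) l) /last_coef /rest_coef.
have -> : \prod_(j < n) tcoef K beta j (l j) = \prod_(j < n)
  (if l j then (-1) ^+ beta (lshift n j) * (beta (lshift n j))%:R * (beta (rshift n j))%:R
   else 1) by [].
move: (\prod_(j < n) _) (\prod_(i < m1 | _) _) => P Q; ring.
Qed.

(** The exponents use truncated subtraction, so indices that ask for more derivations than the
    monomial allows are treated first: there the coefficient is 0. Otherwise each step removes one
    pair of variables and adds one last pair. *)
Lemma homogeneous_signed_term r l :
  homogeneous (\sum_i alpha i + \sum_p beta p)%N%:Z (signed_term r l).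
Proof.
rewrite /signed_term /elt_term ttermE; apply: homogeneousZ.
have [/existsP[i /andP[ni lt]]|/existsPn hr] :=
    boolP [exists i, (i != last) && ((al i < r i) || (ar i < r i))%N].
  have -> : rest_coef r = 0.
    rewrite /rest_coef (bigD1 i) //=; case/orP: lt => lt.
      by rewrite [in 'C(al i, _)]bin_small // muln0 mul0n mul0r.
    by rewrite ['C(ar i, _)]bin_small // muln0 mul0r.
  by rewrite mulr0 scale0r; apply: homogeneous0.
have [/existsP[j /andP[lj nbj]]|/existsPn hl] :=
    boolP [exists j, l j && ~~ (beta (lshift n j) && beta (rshift n j))].
  have -> : \prod_(j <- index_enum 'I_n) tcoef K beta j (l j) = 0.
    rewrite (bigD1 j) //= /tcoef lj.
    by move: nbj; case: (beta _); case: (beta _); rewrite // ?mulr0 ?mul0r.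
  by rewrite scale0r mulr0 scaler0; apply: homogeneous0.
rewrite -scalerAr; do 2!apply: homogeneousZ.
have := @homogeneous_xmonomM _ _ _ _ (term_exp (elt_count r l) r) _ (@homogeneous_tprod K m1 n beta (index_enum 'I_n) l).
apply: homogeneous_eq.
rewrite -PoszD; congr Posz.
rewrite mdegE !big_split_ord /= !(bigD1 last (P := predT)) //= term_exp_a term_exp_b.
rewrite (eq_bigr (fun i => (al i - r i)%N)); last by move=> i ni; rewrite term_exp_l.
rewrite [X in (_ + (_ + (_ + X)))%N](eq_bigr (fun i => (ar i - r i)%N)); last by move=> i ni; rewrite term_exp_r.
have e1 : (\sum_(i < m1 | i != last) r i + \sum_(i < m1 | i != last) (al i - r i)
           = \sum_(i < m1 | i != last) al i)%N.
  rewrite -big_split; apply: eq_bigr => i ni /=; rewrite subnKC //.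
  by have := hr i; rewrite ni negb_or -!leqNgt => /andP[].
have e2 : (\sum_(i < m1 | i != last) r i + \sum_(i < m1 | i != last) (ar i - r i)
           = \sum_(i < m1 | i != last) ar i)%N.
  rewrite -big_split; apply: eq_bigr => i ni /=; rewrite subnKC //.
  by have := hr i; rewrite ni negb_or -!leqNgt => /andP[].
have e3 : (\sum_(j < n) (beta (lshift n j) - l j + (beta (rshift n j) - l j)) + 2 * \sum_(j < n) l j
           = \sum_(j < n) beta (lshift n j) + \sum_(j < n) beta (rshift n j))%N.
  rewrite mul2n -addnn -!big_split; apply: eq_bigr => j _ /=.
  by have := hl j; case: (l j); case: (beta _); case: (beta _).
rewrite /elt_count; move: e1 e2 e3.
move: (\sum_(i < m1 | i != last) r i)%N (\sum_(i < m1 | i != last) (al i - r i))%N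
  (\sum_(i < m1 | i != last) (ar i - r i))%N (\sum_(i < m1 | i != last) al i)%N
  (\sum_(i < m1 | i != last) ar i)%N (\sum_(j < n) l j)%N
  (\sum_(j < n) (beta (lshift n j) - l j + (beta (rshift n j) - l j)))%N
  (\sum_(j < n) beta (lshift n j))%N (\sum_(j < n) beta (rshift n j))%N => *.
lia.
Qed.

Lemma harmonic_harmonic_elt :
  harmonic (\sum_i alpha i + \sum_p beta p)%N%:Z (harmonic_elt K m1_gt0 (alpha, beta)).
Proof.
rewrite harmonic_eltE; split; last exact: Delta_harmonic_sum.
apply: homogeneous_sum => r _; apply: homogeneous_sum => l _.
exact: homogeneous_signed_term.
Qed.

(** Both x_(m1) and x_(2 m1) occur in such a term with exponent at least N > 0. *)
Lemma coef_signed_term_gt0 r l S mu : (mu a * mu b = 0)%N -> (0 < elt_count r l)%N ->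
  (signed_term r l S)@_mu = 0.
Proof.
move=> mu0 gt0; rewrite /signed_term /elt_term !oscZE !mcoeffZ coef_xmonomM.
case: ifP => [/mnm_lepP le|_]; last by rewrite !mulr0.
have := le a; have := le b; rewrite term_exp_a term_exp_b => lb la.
move/eqP: mu0; rewrite muln_eq0 => /orP[] /eqP e.
  by move: la; rewrite e leqn0 addn_eq0 => /andP[_ /eqP z]; rewrite z in gt0.
by move: lb; rewrite e leqn0 addn_eq0 => /andP[_ /eqP z]; rewrite z in gt0.
Qed.

Definition theta_set : {set 'I_(n + n)} := [set p | beta p].

Lemma theta_term0 : exists2 e : K, e != 0 &
  theta_term (fun=> false) = e *: monom theta_set 0%MM.
Proof.
have [e e0 E] := @tprod_monom K m1 n beta _ (index_enum_uniq 'I_n).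
exists e => //; rewrite ttermE big1 // scale1r E; congr (_ *: monom _ _).
by apply/setP => p; rewrite !inE; case: (split_ordP p) => i ->; rewrite mem_index_enum.
Qed.

(** The explicit elements multiply the thetas pair by pair, while coefficients refer to increasing
    order. This is the factor between the two orders; only its being nonzero is used. *)
Definition lead_coef_elt : K := (theta_term (fun=> false) theta_set)@_0.

Lemma lead_coef_elt_neq0 : lead_coef_elt != 0.
Proof.
rewrite /lead_coef_elt; have [e e0 ->] := theta_term0.
by rewrite oscZE mcoeffZ coef_monom !eqxx mulr1.
Qed.

Lemma coef_harmonic_elt S mu : (mu a * mu b = 0)%N ->
  (harmonic_elt K m1_gt0 (alpha, beta) S)@_mu =
  lead_coef_elt * ((S == theta_set) && (mu == [multinom alpha i | i < m1 + m1]))%:R.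
Proof.
move=> mu0; rewrite harmonic_eltE /harmonic_sum osc_sumE raddf_sum /=.
pose r0 : rfun := [ffun=> ord0]; pose l0 : lfun := [ffun=> false].
have er0 : (natf r0) = (fun=> 0%N) by apply/funext => i; rewrite ffunE.
have el0 : (l0 : 'I_n -> bool) = (fun=> false) by apply/funext => i; rewrite ffunE.
rewrite (bigD1 r0) /=; last by rewrite ffunE.
rewrite [X in _ + X]big1 ?addr0 => [|r /andP[rl nr]]; last first.
  rewrite osc_sumE raddf_sum big1 //= => l _; apply: coef_signed_term_gt0 => //.
  rewrite lt0n; apply: contra nr; rewrite /elt_count addn_eq0 => /andP[+ _].
  rewrite sum_nat_eq0 => /forallP h; apply/eqP/ffunP => i; rewrite ffunE; apply/val_inj => /=.
  by have [->|ni] := eqVneq i last; [rewrite (eqP rl) | have := h i; rewrite ni => /eqP].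
rewrite osc_sumE raddf_sum (bigD1 l0) //= [X in _ + X]big1 ?addr0 => [|l nl]; last first.
  apply: coef_signed_term_gt0 => //; rewrite lt0n; apply: contra nl.
  rewrite /elt_count addn_eq0 => /andP[_]; rewrite sum_nat_eq0 => /forallP h.
  by apply/eqP/ffunP => j; rewrite ffunE; have := h j; case: (l j).
rewrite /signed_term /elt_term er0 el0.
have -> : elt_count (fun=> 0%N) (fun=> false) = 0%N by rewrite /elt_count !big1.
have -> : last_coef 0 = 1.
  by rewrite /last_coef !addn0 natrM divff // mulf_neq0 // natr_fact_neq0.
have -> : rest_coef (fun=> 0%N) = 1 by rewrite /rest_coef big1 // => i _; rewrite !bin0 !muln1.
have -> : term_exp 0 (fun=> 0%N) = [multinom alpha i | i < m1 + m1].
  apply: term_expP => [||i ni]; rewrite ?mnmE ?addn0 //.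
  by rewrite !subn0.
rewrite expr0 fact0 !mulr1 !scale1r.
rewrite /lead_coef_elt; have [e e0 ->] := theta_term0.
rewrite -scalerAr xmonom_monom addm0 !oscZE !mcoeffZ !coef_monom !eqxx mulr1.
by rewrite [mu == _]eq_sym.
Qed.


End Element.
Local Notation expT := ({ffun 'I_(m1 + m1) -> nat} * {ffun 'I_(n + n) -> bool})%type.

Definition exp_pair (S : {set 'I_(n + n)}) (mu : 'X_{1.. m1 + m1}) : expT :=
  ([ffun i => mu i], [ffun p => p \in S]).

Lemma exp_pairK S mu : theta_set (exp_pair S mu).2 = S /\
  [multinom (exp_pair S mu).1 i | i < m1 + m1] = mu.
Proof.
split; first by apply/setP => p; rewrite inE ffunE.
by apply/mnmP => i; rewrite mnmE ffunE.
Qed.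

Lemma exp_pair_eq (ab : expT) : exp_pair (theta_set ab.2) [multinom ab.1 i | i < m1 + m1] = ab.
Proof.
case: ab => al be; congr (_, _); apply/ffunP => i; rewrite ffunE ?mnmE //.
by rewrite inE.
Qed.

Lemma coef_harmonic_elt_pair (ab : expT) S mu k : basis_index m1_gt0 k ab ->
  (mu a * mu b = 0)%N ->
  (harmonic_elt K m1_gt0 ab S)@_mu = lead_coef_elt ab.2 * (ab == exp_pair S mu)%:R.
Proof.
case: ab => al be /andP[/eqP h _] mu0; rewrite coef_harmonic_elt //; congr (_ * _%:R).
congr nat_of_bool; apply/andP/eqP => [[/eqP -> /eqP ->]|e].
  exact/esym/(exp_pair_eq (al, be)).
by have := exp_pairK S mu; rewrite -e /= => -[-> ->]; rewrite !eqxx.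
Qed.

(** On monomials lacking x_(m1) or x_(2 m1), the family is diagonal with nonzero entries. This gives
    independence; it also gives spanning, since subtracting the combination with matching
    coefficients leaves a harmonic element that [harmonic_uniq] kills. *)
Lemma harmonic_basis k :
  is_basis (basis_index m1_gt0 k) (@harmonic_elt K m1 n m1_gt0) (harmonic k%:Z).
Proof.
split.
- move=> [al be] /andP[/eqP h /eqP <-]; exact: harmonic_harmonic_elt.
- move=> s c us Ps e0 i si; have Pi := allP Ps _ si.
  pose S := theta_set i.2; pose mu := [multinom i.1 j | j < m1 + m1].
  have mu0 : (mu a * mu b = 0)%N by case/andP: Pi => /eqP h _; rewrite !mnmE.
  have := congr1 (fun g : A => (g S)@_mu) e0.
  rewrite osc_sumE raddf_sum /= osc0E mcoeff0 (bigD1_seq i) //= big1_seq ?addr0 => [|j /andP[nj sj]].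
    rewrite oscZE mcoeffZ (coef_harmonic_elt_pair _ Pi mu0) exp_pair_eq eqxx mulr1.
    by move/eqP; rewrite mulf_eq0 (negPf (lead_coef_elt_neq0 _)) orbF => /eqP.
  rewrite oscZE mcoeffZ (coef_harmonic_elt_pair _ (allP Ps _ sj) mu0) exp_pair_eq.
  by rewrite (negPf nj) !mulr0.
move=> f [hf Df].
(* The admissible indices among the finitely many exponents occurring in f. *)
pose s := undup [seq ab <- [seq exp_pair T nu | T <- enum {: {set 'I_(n + n)}}, nu <- msupp (f T)]
                  | basis_index m1_gt0 k ab].
pose c (ab : expT) : K := (f (theta_set ab.2))@_[multinom ab.1 i | i < m1 + m1] / lead_coef_elt ab.2.
have Ps : all (basis_index m1_gt0 k) s.
  by apply/allP => ab; rewrite mem_undup mem_filter => /andP[].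
exists s, c; split=> //; apply/eqP; rewrite -subr_eq0; apply/eqP/harmonic_uniq.
  rewrite linearB /= Df linear_sum big1_seq ?subrr //= => -[al be] sab.
  have /andP[/eqP h _] := allP Ps _ sab.
  by rewrite linearZ /=; case: (harmonic_harmonic_elt be h) => _ ->; rewrite scaler0.
move=> S mu mu0; rewrite oscDE oscNE mcoeffB osc_sumE raddf_sum /=.
have -> : \sum_(i <- s) ((c i *: harmonic_elt K m1_gt0 i : A) S)@_mu =
    \sum_(i <- s) (if i == exp_pair S mu then (f S)@_mu else 0).
  apply: eq_big_seq => i si; rewrite oscZE mcoeffZ (coef_harmonic_elt_pair _ (allP Ps _ si) mu0).
  case: eqP => [e|_]; last by rewrite !mulr0.
  rewrite mulr1 divfK ?lead_coef_elt_neq0 // e.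
  by have [-> ->] := exp_pairK S mu.
have [z|nz] := eqVneq (f S)@_mu 0.
  by rewrite z big1 ?subr0 // => i _; case: ifP.
have sin : exp_pair S mu \in s.
  rewrite mem_undup mem_filter; apply/andP; split.
    apply/andP; split; first by rewrite !ffunE mu0.
    have /homogeneousP /(_ _ _ nz) [<-] := hf; apply/eqP.
    rewrite mdegE -sum1_card [in RHS](big_mkcond (mem S)) /=; congr (_ + _)%N;
      by apply: eq_bigr => i _; rewrite ffunE //; case: ifP.
  by apply/allpairsPdep; exists S, mu; rewrite mem_enum mcoeff_msupp.
rewrite (bigD1_seq (exp_pair S mu)) ?undup_uniq //= eqxx big1 ?addr0 ?subrr //.
by move=> i /negPf ->.
Qed.

End HarmonicBasis.

(* When m1 = 1 and k > n, the elements x_1^k and x_2^k generate distinct      *)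
(* proper submodules of H_k, so irreducibility of H_k, and of its quotient by *)
(* W, is asserted for m1 = 1 only in the range k <= n - m1 + 1.               *)
Theorem theorem2p2 (R : realType) (m1 n k : nat)
    (m1_gt0 : (0 < m1)%N) (n_gt0 : (0 < n)%N) :
  let c : int := n%:Z - m1%:Z + 1 in
  let H : int -> oscA R[i] m1 n -> Prop := @harmonic R[i] m1 n in
  let etaA : oscA R[i] m1 n -> Prop :=
    mulspace (eta R[i] m1 n) (@homogeneous R[i] m1 n (k%:Z - 2)) in
  let W : oscA R[i] m1 n -> Prop :=
    mulspace (eta R[i] m1 n ^+ absz (k%:Z - c)%R) (H (2 * c - k%:Z)) in
  let x1k : oscA R[i] m1 n := x1 R[i] n m1_gt0 ^+ k in
  [/\ (2 * c < k%:Z) || (k%:Z <= c) ->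
        [/\ is_direct_sum (@homogeneous R[i] m1 n k%:Z) (H k%:Z) etaA,
            submodule (H k%:Z),
            (1 < m1)%N || (k%:Z <= c) -> irreducible_module (H k%:Z),
            H k%:Z x1k
          & highest_weight_vector
              (fun h => k%:R * lambda1 m1_gt0 h) x1k],
      c < k%:Z <= 2 * c ->
        [/\ submodule (H k%:Z),
            strict_subspace W (H k%:Z),
            irreducible_module W
          & (1 < m1)%N ->
            composition_series (H k%:Z) [:: W; @zerospace R[i] m1 n]]
    & (0 < k)%N ->
        is_basis (@basis_index m1 n m1_gt0 k)
          (@harmonic_elt R[i] m1 n m1_gt0) (H k%:Z)].
Proof.
move=> c H etaA W x1k; split=> [nc|crit|_].
- split.
  + exact: (@harmonic_direct_sum R[i] m1 n m1_gt0 k%:Z nc).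
  + exact: (@submodule_harmonic R[i] m1 n).
  + by move=> hk; apply: (@irreducible_harmonic R[i] m1 n m1_gt0 n_gt0 k hk nc).
  + exact: (@harmonic_x1 R[i] m1 n m1_gt0 k).
  + exact: (@highest_weight_x1 R[i] m1 n m1_gt0 k).
- split.
  + exact: (@submodule_harmonic R[i] m1 n).
  + exact: (critical_strict R[i] m1_gt0 n_gt0 crit).
  + exact: (irreducible_critical R[i] m1_gt0 n_gt0 crit).
  + move=> m1_gt1; split; first exact: (harmonic_factor R[i] m1_gt0 n_gt0 crit m1_gt1).
    by split; first exact: (critical_factor R[i] m1_gt0 n_gt0 crit).
- exact: (@harmonic_basis R[i] m1 n m1_gt0 k).
Qed.
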